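(* There is an absolute constant $C>0$ such that for every integer $N\ge1$ and every $\beta>0$: (i) for every $u\in L^2(\mathbb{R})$, $\|u-\widehat{\Pi}_N^\beta u\|\le C\,E_N^\beta(u)$; (ii) for every $u\in H^1(\mathbb{R})$, $\|\partial_x(u-\widehat{\Pi}_N^\beta u)\|\le C\bigl(E_N^\beta(\partial_xu)+\beta\sqrt N\,E_N^\beta(u)\bigr)$; (iii) for every $u\in H^2(\mathbb{R})$, $\|\partial_x^2(u-\widehat{\Pi}_N^\beta u)\|\le C\bigl(E_N^\beta(\partial_x^2u)+\beta\,E_N^\beta(\partial_xu)+\beta^2N\,E_N^\beta(u)\bigr)$.
   Context: $\|\cdot\|$ is the $L^2(\mathbb{R})$ norm, $\mathbb{I}_A$ the indicator function of $A$, and $\mathcal{F}[u](k)=\frac{1}{\sqrt{2\pi}}\int u(x)e^{-ikx}dx$ the Fourier transform. For $\beta>0$, $\widehat{P}_N^\beta=\{e^{-\beta^2x^2/2}\psi(x):\ \psi\text{ a polynomial of degree}\le N\}$ and $\widehat{\Pi}_N^\beta$ is the $L^2$-orthogonal projection onto $\widehat{P}_N^\beta$. For $w\in L^2(\mathbb{R})$ define $E_{s,N}^\beta(w)=\|w\cdot\mathbb{I}_{\{|x|>\frac{1}{2\sqrt2}\sqrt N/\beta\}}\|$, $E_{f,N}^\beta(w)=\|\mathcal{F}[w](k)\cdot\mathbb{I}_{\{|k|>\frac{1}{2\sqrt2}\sqrt N\beta\}}\|$, $E_{h,N}(w)=\|w\|e^{-N/16}$, and $E_N^\beta(w)=E_{s,N}^\beta(w)+E_{f,N}^\beta(w)+E_{h,N}(w)$.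 *)

(* Defs.v *)
(* the real line is an arbitrary realType R (all are isomorphic to the reals). *)
From HB Require Import structures.
From mathcomp Require Import all_boot all_order all_algebra.
From mathcomp Require Import all_classical all_reals all_analysis.
From mathcomp Require Import complex.
Set Implicit Arguments. Unset Strict Implicit. Unset Printing Implicit Defensive.
Import Order.TTheory GRing.Theory Num.Theory.
Import numFieldNormedType.Exports.
Local Open Scope classical_set_scope.
Local Open Scope ring_scope.
Local Open Scope complex_scope.

Section HermiteDefs.
Variable R : realType.
Local Notation C := (R[i]).
Local Notation leb := (@lebesgue_measure R).
Local Notation cRe := (@complex.Re R).
Local Notation cIm := (@complex.Im R).

Definition csq (z : C) : R := cRe z ^+ 2 + cIm z ^+ 2.

Definition cint (D : set R) (f : R -> C) : C :=
  Complex (Rintegral leb D (fun x => cRe (f x))) (Rintegral leb D (fun x => cIm (f x))).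

Definition L2 (u : R -> C) : Prop :=
  measurable_fun [set: R] (fun x => cRe (u x)) /\ measurable_fun [set: R] (fun x => cIm (u x)) /\
  (\int[leb]_x (csq (u x))%:E < +oo)%E.

Definition l2norm_on (A : set R) (w : R -> C) : R :=
  Num.sqrt (fine (\int[leb]_(x in A) (csq (w x))%:E)).

Definition l2norm (w : R -> C) : R := l2norm_on setT w.

Definition expi (t : R) : C := Complex (cos t) (sin t).

Definition fourier_trunc (r : R) (w : R -> C) (k : R) : C :=
  (Num.sqrt (2 * pi))^-1%:C * cint `[- r, r] (fun x => w x * expi (- (k * x))).

(** g = F[w] for w in L^2(R): the Plancherel Fourier transform, i.e. the
    L^2-limit of the truncated Fourier integrals as r -> +oo *)
Definition is_fourier (w g : R -> C) : Prop :=
  L2 g /\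
  ((fun r : R => (\int[leb]_k (csq (g k - fourier_trunc r w k))%:E)%E) @ +oo --> 0%E).

Definition test_fun (phi : R -> R) : Prop :=
  (forall (n : nat) (x : R), derivable (derive1n n phi) x 1) /\
  (exists M : R, forall x, M < `|x| -> phi x = 0).

Definition is_weak_deriv (u v : R -> C) : Prop :=
  forall phi, test_fun phi ->
    cint setT (fun x => u x * (derive1 phi x)%:C) = - cint setT (fun x => v x * (phi x)%:C).

Definition hermite_space (N : nat) (beta : R) (q : R -> C) : Prop :=
  exists psi : {poly C}, (size psi <= N.+1)%N /\
    forall x, q x = (expR (- (beta ^+ 2 * x ^+ 2) / 2))%:C * psi.[x%:C].

Definition is_proj (N : nat) (beta : R) (u p : R -> C) : Prop :=
  hermite_space N beta p /\
  forall q, hermite_space N beta q -> cint setT (fun x => (u x - p x) * (q x)^*%C) = 0.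

(** the error quantities; Fw stands for F[w] *)
Definition Es (N : nat) (beta : R) (w : R -> C) : R :=
  l2norm_on [set x | Num.sqrt N%:R / beta / (2 * Num.sqrt 2) < `|x|] w.
Definition Ef (N : nat) (beta : R) (Fw : R -> C) : R :=
  l2norm_on [set k | Num.sqrt N%:R * beta / (2 * Num.sqrt 2) < `|k|] Fw.
Definition Eh (N : nat) (w : R -> C) : R := l2norm w * expR (- (N%:R / 16)).
Definition EN (N : nat) (beta : R) (w Fw : R -> C) : R :=
  Es N beta w + Ef N beta Fw + Eh N w.

End HermiteDefs.

(* Main.v *)
Require Import Defs.
From mathcomp Require Import all_boot all_order all_algebra.
From mathcomp Require Import all_classical all_reals all_analysis.
From mathcomp Require Import measurable_realfun complex.
From mathcomp Require Import ring lra zify.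
Set Implicit Arguments. Unset Strict Implicit. Unset Printing Implicit Defensive.
Import Order.TTheory GRing.Theory Num.Theory.
Import numFieldNormedType.Exports.
Local Open Scope classical_set_scope.
Local Open Scope ring_scope.

(* Each real component f of u - Pi u is orthogonal to P_N, so ||f||^2 = <u, f> (for
   the corresponding component of u), and it suffices to bound <u, f> for f orthogonal
   to P_N.  Let
   M = sqrt N / (2 sqrt 2 beta), B = sqrt N beta / (2 sqrt 2), and let chi be the
   indicator of [-2M, 2M] convolved with a normal density of deviation 1/beta.
   Since 1 - chi <= 2 exp(-N/16) on [-M, M], <u, (1 - chi) f> is controlled by E_s and
   E_h.  By Parseval <u, chi f> = <F[u], F[chi f]>; the part |k| > B is controlled by
   E_f.  For |k| <= B, F[chi f](k) is an integral over |y| <= 2M of inner products of f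
   with Gaussian wave packets centred at y of frequency k.  The Hermite coefficients
   of a wave packet are explicit, its distance to P_N is the tail of a Poisson
   distribution, and orthogonality of f to P_N makes F[chi f](k) exponentially small.

   For derivatives, let g be the projection of (u - Pi u)' onto P_{N+1}.  Then
   (u - Pi u)' - g is orthogonal to P_{N+1}, which contains (Pi u)', and the bound above
   applies to it with u' in place of u.  Moreover ||g||^2 = - <u - Pi u, g'>, and
   ||g'|| <= C beta sqrt N ||g|| by a Bernstein inequality.  Second derivatives are
   treated in the same way with P_{N+2}. *)

(** * Integration on the real line *)

(** The deviation [1/beta] of the smoothing is forced. As a function of [x], a normal density of
    that width is a multiple of [exp(-b x^2/2 + c x)] with [b = beta^2], so the packets are coherent
    states of the oscillator whose ground state defines the Hermite space. The Poisson parameter of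
    the packet at [(y, k)] is [b y^2/2 + k^2/(2 b)]; for [|y| <= 2 M] and [|k| <= B] it is at most
    [5 N/16], well below [N], and this is what the factor [1/(2 sqrt 2)] in the thresholds buys. The
    squared pairing of [f] with a packet is then of order [exp(-3N/16)] where [exp(-N/8)] is
    required; the surplus [exp(-N/16)] pays for the factor [N^(3/2)] that integration over [y] and
    [k] brings. A sharp cut-off would not decompose into packets; [chi] does, being a superposition
    of Gaussians. Since [F[u]] exists only as an L^2 limit, Parseval is proved against real
    functions lying in both L^1 and L^2, such as [chi f], whose cosine and sine transforms are plain
    integrals. Complex functions enter only through their components. *)

Section Integrable.
Variable R : realType.
Local Notation mu := (@lebesgue_measure R).
Implicit Types (f g h : R -> R) (a M : R).

Definition L1 f := mu.-integrable setT (EFin \o f).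

Lemma L1_meas f : L1 f -> measurable_fun setT f.
Proof. by move=> /integrableP[/measurable_EFinP]. Qed.

Lemma L1D f g : L1 f -> L1 g -> L1 (fun x => f x + g x).
Proof. by move=> *; exact: (@integrableD _ _ _ mu _ measurableT (EFin \o f) (EFin \o g)). Qed.

Lemma L1B f g : L1 f -> L1 g -> L1 (fun x => f x - g x).
Proof. by move=> *; exact: (@integrableB _ _ _ mu _ measurableT (EFin \o f) (EFin \o g)). Qed.

Lemma L1Z a f : L1 f -> L1 (fun x => a * f x).
Proof. by move=> *; exact: (@integrableZl _ _ _ mu _ measurableT a (EFin \o f)). Qed.

Lemma L1_norm f : L1 f -> L1 (fun x => `|f x|).
Proof. exact: integrable_norm. Qed.

Lemma L1_le f g : measurable_fun setT f -> (forall x, `|f x| <= g x) -> L1 g -> L1 f.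
Proof.
move=> mf fg; apply: le_integrable => //; first exact/measurable_EFinP.
by move=> x _; rewrite lee_fin (le_trans (fg x))// ler_norm.
Qed.

Lemma L1Mb f h M : L1 f -> measurable_fun setT h -> (forall x, `|h x| <= M) ->
  L1 (fun x => f x * h x).
Proof.
move=> f1 mh hM; apply: (@L1_le _ (fun x => M * `|f x|)).
- by apply: measurable_funM => //; exact: L1_meas.
- by move=> x; rewrite normrM mulrC ler_wpM2r.
- exact/L1Z/L1_norm.
Qed.

Lemma L1_ge0_lty f : measurable_fun setT f -> (forall x, 0 <= f x) ->
  (\int[mu]_x (f x)%:E < +oo)%E -> L1 f.
Proof.
move=> mf f0 foo; apply/integrableP; split; first exact/measurable_EFinP.
by under eq_integral do rewrite /= ger0_norm//.
Qed.

Lemma L1_EFin f : L1 f -> (\int[mu]_x (f x)%:E = (\int[mu]_x f x)%:E)%E.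
Proof. by move=> f1; rewrite fineK//; exact: integrable_fin_num. Qed.

Lemma int_ge0 f : (forall x, 0 <= f x) -> 0 <= \int[mu]_x f x.
Proof. by move=> f0; apply: Rintegral_ge0. Qed.

Lemma int_le f g : L1 f -> L1 g -> (forall x, f x <= g x) ->
  \int[mu]_x f x <= \int[mu]_x g x.
Proof. by move=> f1 g1 fg; apply: le_Rintegral. Qed.

Lemma intD f g : L1 f -> L1 g -> \int[mu]_x (f x + g x) = \int[mu]_x f x + \int[mu]_x g x.
Proof. by move=> f1 g1; rewrite RintegralD. Qed.

Lemma intB f g : L1 f -> L1 g -> \int[mu]_x (f x - g x) = \int[mu]_x f x - \int[mu]_x g x.
Proof. by move=> f1 g1; rewrite RintegralB. Qed.

Lemma intZ a f : L1 f -> \int[mu]_x (a * f x) = a * \int[mu]_x f x.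
Proof. by move=> f1; rewrite RintegralZl. Qed.

Lemma intN f : L1 f -> \int[mu]_x (- f x) = - \int[mu]_x f x.
Proof.
move=> f1; rewrite -[RHS]mulN1r -intZ//; apply: eq_Rintegral => x _.
by rewrite mulN1r.
Qed.

Lemma int_norm f : L1 f -> `|\int[mu]_x f x| <= \int[mu]_x `|f x|.
Proof. by move=> f1; apply: le_normr_Rintegral. Qed.

Lemma eq_int f g : f =1 g -> \int[mu]_x f x = \int[mu]_x g x.
Proof. by move=> fg; apply: eq_Rintegral => x _. Qed.

Lemma L1_sum (I : Type) (s : seq I) (F : I -> R -> R) :
  (forall i, L1 (F i)) -> L1 (fun x => \sum_(i <- s) F i x).
Proof.
move=> F1; elim: s => [|i s IH].
  rewrite (_ : (fun _ => _) = cst 0); last by apply/funext => x; rewrite big_nil.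
  exact: integrable0.
rewrite (_ : (fun _ => _) = fun x => F i x + \sum_(j <- s) F j x); last first.
  by apply/funext => x; rewrite big_cons.
exact: L1D.
Qed.

Lemma dominated_cvg (f_ : nat -> R -> R) f g : (forall n, measurable_fun setT (f_ n)) ->
  (forall x, (f_ n x) @[n --> \oo] --> f x) -> L1 g ->
  (forall n x, `|f_ n x| <= g x) ->
  L1 f /\ \int[mu]_x f_ n x @[n --> \oo] --> \int[mu]_x f x.
Proof.
move=> mf_ cf g1 fg.
have mf : measurable_fun setT f.
  by apply: measurable_fun_cvg => // x _; exact: cf.
have [] := @dominated_convergence _ _ _ mu setT measurableT
  (fun n => EFin \o f_ n) (EFin \o f) (EFin \o g).
- by move=> n /=; apply/measurable_EFinP; exact: mf_.
- exact/measurable_EFinP.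
- by apply: aeW => x _ /=; apply: cvg_EFin; [exact: nearW|exact: cf].
- exact: g1.
- by apply: aeW => x n _ /=; rewrite lee_fin.
move=> f1 _ cv; split => //.
by apply: fine_cvg; rewrite -(L1_EFin f1); exact: cv.
Qed.

End Integrable.

(** * Square-integrable real functions *)

Section SquareIntegrable.
Variable R : realType.
Local Notation mu := (@lebesgue_measure R).
Implicit Types (f g h : R -> R) (a M : R).

Definition sqint f := measurable_fun setT f /\ L1 (fun x => f x ^+ 2).

Definition nrm2 f := \int[mu]_x (f x ^+ 2).
Definition nrm f := Num.sqrt (nrm2 f).

Lemma nrm2_ge0 f : 0 <= nrm2 f.
Proof. by apply: int_ge0 => x; exact: sqr_ge0. Qed.

Lemma nrm_ge0 f : 0 <= nrm f.
Proof. exact: sqrtr_ge0. Qed.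

Lemma nrm_sqr f : nrm f ^+ 2 = nrm2 f.
Proof. by rewrite sqr_sqrtr// nrm2_ge0. Qed.

Lemma sqintM f g : sqint f -> sqint g -> L1 (fun x => f x * g x).
Proof.
move=> [mf f2] [mg g2]; apply: (@L1_le _ _ (fun x => f x ^+ 2 + g x ^+ 2)).
- exact: measurable_funM.
- move=> x; rewrite normrM -[f x ^+ 2]real_normK ?num_real//.
  rewrite -[g x ^+ 2]real_normK ?num_real//.
  have := sqr_ge0 (`|f x| - `|g x|); have := normr_ge0 (f x).
  have := normr_ge0 (g x); nra.
- exact: L1D.
Qed.

Lemma sqintZ a f : sqint f -> sqint (fun x => a * f x).
Proof.
move=> [mf f2]; split; first exact: measurable_funM.
rewrite (_ : (fun _ => _) = fun x => a ^+ 2 * f x ^+ 2); first exact: L1Z.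
by apply/funext => x; rewrite exprMn.
Qed.

Lemma sqintD f g : sqint f -> sqint g -> sqint (fun x => f x + g x).
Proof.
move=> Sf Sg; have [mf f2] := Sf; have [mg g2] := Sg.
split; first exact: measurable_funD.
rewrite (_ : (fun _ => _) = fun x => f x ^+ 2 + (2 * (f x * g x) + g x ^+ 2)).
  by apply: L1D => //; apply: L1D => //; apply/L1Z/sqintM.
by apply/funext => x; ring.
Qed.

Lemma sqintN f : sqint f -> sqint (fun x => - f x).
Proof.
move=> /(sqintZ (-1)); rewrite (_ : (fun _ => _) = fun x => - f x)//.
by apply/funext => x; rewrite mulN1r.
Qed.

Lemma sqintB f g : sqint f -> sqint g -> sqint (fun x => f x - g x).
Proof. by move=> Sf Sg; apply: sqintD => //; exact: sqintN. Qed.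

Lemma sqintMb f h M : sqint f -> measurable_fun setT h -> (forall x, `|h x| <= M) ->
  sqint (fun x => f x * h x).
Proof.
move=> [mf f2] mh hM; split; first exact: measurable_funM.
rewrite (_ : (fun _ => _) = fun x => f x ^+ 2 * h x ^+ 2).
  apply: (@L1Mb _ _ _ (M ^+ 2)) => //; first exact: measurable_funX.
  move=> x; rewrite normrX lerXn2r ?nnegrE//.
  exact: le_trans (hM x).
by apply/funext => x; rewrite exprMn.
Qed.

Lemma nrm2Z a f : sqint f -> nrm2 (fun x => a * f x) = a ^+ 2 * nrm2 f.
Proof.
move=> [_ f2]; rewrite /nrm2 -intZ//; apply: eq_int => x; exact: exprMn.
Qed.

Lemma nrmZ a f : sqint f -> nrm (fun x => a * f x) = `|a| * nrm f.
Proof. by move=> Sf; rewrite /nrm nrm2Z// sqrtrM ?sqr_ge0// sqrtr_sqr. Qed.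

Lemma nrm2D f g : sqint f -> sqint g ->
  nrm2 (fun x => f x + g x) = nrm2 f + 2 * \int[mu]_x (f x * g x) + nrm2 g.
Proof.
move=> Sf Sg; have [mf f2] := Sf; have [mg g2] := Sg.
have fg := sqintM Sf Sg.
rewrite /nrm2 -intZ// -intD//; last exact: L1Z.
rewrite -intD//; last by apply: L1D => //; exact: L1Z.
by apply: eq_int => x; ring.
Qed.

(** The quadratic polynomial [nrm2 (f + t g)] in [t] is nonnegative; it is evaluated at its minimum.
    When [nrm2 g] is zero it is affine, hence constant. *)
Lemma cauchy_schwarz2 f g : sqint f -> sqint g ->
  (\int[mu]_x (f x * g x)) ^+ 2 <= nrm2 f * nrm2 g.
Proof.
move=> Sf Sg; set p := \int[mu]_x (f x * g x).
have H (t : R) : 0 <= nrm2 f + 2 * t * p + t ^+ 2 * nrm2 g.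
  have := nrm2_ge0 (fun x => f x + t * g x).
  rewrite nrm2D//; last exact: sqintZ.
  rewrite nrm2Z// (_ : \int[mu]_x (f x * (t * g x)) = t * p) ?mulrA//.
  by rewrite -intZ; [apply: eq_int => x; ring|exact: sqintM].
have [g0|g0] := eqVneq (nrm2 g) 0.
  have := H 1; have := H (-1); rewrite g0 => h1 h2.
  suff -> : p = 0 by rewrite expr0n mulr0.
  apply/eqP/negPn/negP => p0.
  (* At this [t] the affine function would take the value [-1]. *)
  have := H (- (nrm2 f + 1) / (2 * p)); rewrite g0.
  rewrite (_ : 2 * _ * p = - (nrm2 f + 1)); first lra.
  by field.
have gp : 0 < nrm2 g by rewrite lt_neqAle eq_sym g0 nrm2_ge0.
have := H (- p / nrm2 g).
rewrite (_ : nrm2 f + _ + _ = (nrm2 f * nrm2 g - p ^+ 2) / nrm2 g); last by field.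
by rewrite pmulr_lge0 ?invr_gt0// subr_ge0.
Qed.

Lemma cauchy_schwarz f g : sqint f -> sqint g ->
  `|\int[mu]_x (f x * g x)| <= nrm f * nrm g.
Proof.
move=> Sf Sg; rewrite -sqrtr_sqr -sqrtrM ?nrm2_ge0// ler_wsqrtr//.
exact: cauchy_schwarz2.
Qed.

Lemma nrmD f g : sqint f -> sqint g -> nrm (fun x => f x + g x) <= nrm f + nrm g.
Proof.
move=> Sf Sg; rewrite -(@ler_pXn2r _ 2)// ?nnegrE ?addr_ge0 ?nrm_ge0//.
rewrite nrm_sqr nrm2D// sqrrD !nrm_sqr lerD2r lerD2l -[leRHS]mulr_natl ler_wpM2l//.
exact: le_trans (ler_norm _) (cauchy_schwarz Sf Sg).
Qed.

Lemma nrm2_le f g : sqint f -> sqint g -> (forall x, `|f x| <= `|g x|) ->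
  nrm2 f <= nrm2 g.
Proof.
move=> [_ f2] [_ g2] fg; apply: int_le => // x.
by rewrite -real_normK ?num_real// -[leRHS]real_normK ?num_real// lerXn2r ?nnegrE.
Qed.

Lemma nrm_le f g : sqint f -> sqint g -> (forall x, `|f x| <= `|g x|) ->
  nrm f <= nrm g.
Proof. by move=> *; rewrite ler_wsqrtr// nrm2_le. Qed.

End SquareIntegrable.

(** * Fubini for a bounded kernel between two integrable factors *)

Section FubiniBounded.
Variable R : realType.
Local Notation mu := (@lebesgue_measure R).

Variables (a c : R -> R) (k : R * R -> R) (M : R).
Hypotheses (a1 : L1 a) (c1 : L1 c) (mk : measurable_fun setT k) (kM : forall z, `|k z| <= M).

Let F (z : R * R) := (a z.1 * (c z.2 * k z))%:E.

Let mkx x : measurable_fun setT (fun y => k (x, y)).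
Proof. exact: measurableT_comp. Qed.

Let mky y : measurable_fun setT (fun x => k (x, y)).
Proof. exact: measurableT_comp. Qed.

Let iF : (mu \x mu)%E.-integrable setT F.
Proof.
have ma := L1_meas a1; have mc := L1_meas c1.
have M0 : 0 <= M by exact: le_trans (kM (0, 0)).
have mF : measurable_fun setT F.
  apply/measurable_EFinP; apply: measurable_funM; first exact: measurableT_comp.
  by apply: measurable_funM => //; exact: measurableT_comp.
apply/integrable12ltyP => //.
have la x : (\int[mu]_y `|F (x, y)| <= (`|a x| * (M * \int[mu]_y `|c y|))%:E)%E.
    apply: (@le_trans _ _ (\int[mu]_y (`|a x| * (M * `|c y|))%:E)%E).
      apply: ge0_le_integral => //.
      - by apply: measurableT_comp => //; exact: measurableT_comp.
      - apply/measurable_EFinP; apply: measurable_funM => //.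
        by apply: measurable_funM => //; exact: measurableT_comp.
      - move=> y _; rewrite /F/= lee_fin 2!normrM ler_wpM2l// mulrC ler_wpM2r//.
    rewrite L1_EFin; last by do 2 apply: L1Z; exact: L1_norm.
    by rewrite !intZ//; [exact: L1_norm|apply/L1Z/L1_norm].
  have mFx : measurable_fun setT (fun x => \int[mu]_y `|F (x, y)|)%E.
    have mF' : measurable_fun setT (abse \o F) by exact: measurableT_comp.
    have F0 z : (0 <= (abse \o F) z)%E by exact: abse_ge0.
    exact: (@measurable_fun_fubini_tonelli_F _ _ _ _ R mu _ mF' F0).
  apply: (@le_lt_trans _ _ (\int[mu]_x (`|a x| * (M * \int[mu]_y `|c y|))%:E)%E).
    apply: ge0_le_integral => //.
    - by move=> x _; exact: integral_ge0.
    - apply/measurable_EFinP; apply: measurable_funM => //.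
      exact: measurableT_comp.
  rewrite L1_EFin ?ltry//.
  under eq_fun do rewrite mulrC.
  exact/L1Z/L1_norm.
Qed.

Let FxE : (fun x => (\int[mu]_y F (x, y))%E) = EFin \o (fun x => a x * \int[mu]_y (c y * k (x, y))).
Proof.
apply/funext => x /=.
have i1 : L1 (fun y => c y * k (x, y)) by exact: L1Mb c1 (mkx x) _.
by rewrite /F/= (L1_EFin (L1Z _ i1)) intZ.
Qed.

Let FyE : (fun y => (\int[mu]_x F (x, y))%E) = EFin \o (fun y => c y * \int[mu]_x (a x * k (x, y))).
Proof.
apply/funext => y /=.
have i1 : L1 (fun x => a x * k (x, y)) by exact: L1Mb a1 (mky y) _.
rewrite /F/= -intZ// -(L1_EFin (L1Z _ i1)); apply: eq_integral => x _.
by congr EFin; ring.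
Qed.

(** Kept beside the exchange itself because [ft_chi_bound] moves an absolute value inside the outer
    integral. *)
Lemma fubini_bounded_L1 : L1 (fun x => a x * \int[mu]_y (c y * k (x, y))).
Proof. by rewrite /L1 -FxE; exact: (integrable_fubini_F iF). Qed.

Lemma fubini_bounded :
  \int[mu]_x (a x * \int[mu]_y (c y * k (x, y))) =
  \int[mu]_y (c y * \int[mu]_x (a x * k (x, y))).
Proof.
transitivity (fine (\int[mu]_x \int[mu]_y F (x, y))%E); first by rewrite FxE.
by rewrite (Fubini iF) FyE.
Qed.

End FubiniBounded.

(** * Derivatives and integration over the whole line *)

Section Derivation.
Variable R : realType.
Local Notation mu := (@lebesgue_measure R).
Implicit Types (f g : R -> R) (x a b : R).

Lemma derM f g x a b : is_derive x 1 f a -> is_derive x 1 g b ->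
  is_derive x 1 (fun x => f x * g x) (a * g x + f x * b).
Proof.
move=> df dg; have := @is_deriveM _ _ f g x 1 a b df dg.
by move=> /is_derive_eq; apply; rewrite addrC mulrC; congr (_ + _).
Qed.

Lemma derD f g x a b : is_derive x 1 f a -> is_derive x 1 g b ->
  is_derive x 1 (fun x => f x + g x) (a + b).
Proof. by move=> df dg; exact: is_deriveD. Qed.

Lemma derZ f x (c a : R) : is_derive x 1 f a -> is_derive x 1 (fun x => c * f x) (c * a).
Proof. by move=> df; exact: is_deriveZ. Qed.

Lemma der_comp f g x a b : is_derive (g x) 1 f a -> is_derive x 1 g b ->
  is_derive x 1 (fun x => f (g x)) (a * b).
Proof. by move=> df dg; exact: is_derive1_comp. Qed.

Lemma der_eq f x a b : is_derive x 1 f a -> a = b -> is_derive x 1 f b.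
Proof. by move=> + <-. Qed.

Lemma der_cont f x a : is_derive x 1 f a -> {for x, continuous f}.
Proof.
move=> df; apply: differentiable_continuous; apply/derivable1_diffP.
exact: ex_derive.
Qed.

Lemma cont_meas f : continuous f -> measurable_fun setT f.
Proof. exact: continuous_measurable_fun. Qed.

(** The fundamental theorem of calculus on [[-n, n]], followed by dominated convergence. Every
    integration by parts below is an instance in which [f] is a product. *)
Lemma int_derive0 f g : (forall x, is_derive x 1 f (g x)) -> continuous g -> L1 g ->
  f n%:R @[n --> \oo] --> 0 -> f (- n%:R) @[n --> \oo] --> 0 ->
  \int[mu]_x g x = 0.
Proof.
move=> df cg g1 f0 fN0.
pose h n x := g x * \1_(`[- n%:R, n%:R] : set R) x.
have [||||_ hg] := @dominated_cvg _ h g (fun x => `|g x|).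
- by move=> n; apply: measurable_funM; [exact: cont_meas|exact: measurable_indic].
- move=> x; apply: cvg_near_cst; near=> n.
  rewrite /h indicE mem_set ?mulr1//= in_itv/= -ler_norml.
  near: n; exact: nbhs_infty_ger.
- exact: L1_norm.
- move=> n x; rewrite normrM -[leRHS]mulr1 ler_wpM2l//.
  by rewrite indicE; case: (_ \in _); rewrite ?normr1 ?normr0.
have hE n : (0 < n)%N -> \int[mu]_x h n x = f n%:R - f (- n%:R).
  move=> n0; rewrite /h.
  transitivity (\int[mu]_(x in `[- n%:R, n%:R]) g x).
    rewrite [RHS]Rintegral_mkcond; apply: eq_int => x.
    by rewrite patchE indicE; case: ifPn; rewrite ?mulr1 ?mulr0.
  rewrite /Rintegral (@continuous_FTC2 _ g f)//.
  - by rewrite -subr_gt0 opprK addr_gt0 ?ltr0n.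
  - exact: continuous_subspaceT.
  - split.
    + by move=> x _; exact: ex_derive.
    + by apply: cvg_at_right_filter; exact: der_cont.
    + by apply: cvg_at_left_filter; exact: der_cont.
  - by move=> x _; rewrite derive1E; exact: derive_val.
have : \int[mu]_x h n x @[n --> \oo] --> 0 - 0.
  apply: cvg_trans (cvgB f0 fN0); apply: near_eq_cvg; near=> n.
  by rewrite hE//; near: n; exact: nbhs_infty_gt.
rewrite subr0; move/(cvg_lim (@Rhausdorff _)) => <-.
by apply/esym/cvg_lim.
Unshelve. all: by end_near. Qed.

End Derivation.

(** * Gaussian integrals *)

Section GaussianWeight.
Variables (R : realType) (b : R).
Hypothesis b0 : 0 < b.
Local Notation mu := (@lebesgue_measure R).
Implicit Types (c k x : R) (p q : {poly R}).

(** A multiple of the Gaussian centred at [c / (2 b)]. The linear term keeps the family closed under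
    multiplication by exponentials; [c = 0] is the weight in the product of two Hermite
    functions. *)
Definition gw c x := expR (- (b * x ^+ 2) + c * x).

Lemma gw_ge0 c x : 0 <= gw c x. Proof. exact: expR_ge0. Qed.

Lemma gwD c c' x : gw c x * expR (c' * x) = gw (c + c') x.
Proof. by rewrite /gw -expRD; congr expR; ring. Qed.

Lemma der_gw c x : is_derive x 1 (gw c) ((c - 2 * b * x) * gw c x).
Proof.
have d1 : is_derive x 1 (fun x => - (b * x ^+ 2) + c * x) (c - 2 * b * x).
  have did : is_derive x 1 (fun x : R => x) 1 by exact: is_derive_id.
  have dsq := derM did did.
  have := derD (derZ (- b) dsq) (derZ c did).
  move=> h; apply: (@der_eq _ _ _ (- b * (1 * x + x * 1) + c * 1)); last ring.
  by congr is_derive : h; apply/funext => y; ring.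
apply: der_eq (der_comp (is_derive_expR _) d1) _.
by rewrite mulrC.
Qed.

Lemma meas_gw c : measurable_fun setT (gw c).
Proof. by apply: cont_meas => x; exact: der_cont (der_gw c x). Qed.

Let s : R := Num.sqrt (2 * b)^-1.

Let s2 : s ^+ 2 = (2 * b)^-1.
Proof. by rewrite sqr_sqrtr// invr_ge0 mulr_ge0// ltW. Qed.

Let s_neq0 : s != 0.
Proof. by rewrite gt_eqF// sqrtr_gt0 invr_gt0 mulr_gt0. Qed.

Let gw_normal c x : gw c x =
  (Num.sqrt (pi / b) * expR (c ^+ 2 / (4 * b))) * normal_pdf (c / (2 * b)) s x.
Proof.
rewrite normal_pdfE// /normal_peak /normal_fun s2.
rewrite (_ : (2 * b)^-1 * pi *+ 2 = pi / b); last by rewrite -mulr_natr; field; rewrite gt_eqF.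
have pb : Num.sqrt (pi / b) != 0.
  by rewrite gt_eqF// sqrtr_gt0 divr_gt0// pi_gt0.
rewrite mulrACA divff// mul1r -expRD /gw; congr expR.
rewrite (_ : (2 * b)^-1 *+ 2 = b^-1); first by field; rewrite gt_eqF.
by rewrite -mulr_natr; field; rewrite gt_eqF.
Qed.

Lemma L1_gw c : L1 (gw c).
Proof.
rewrite (_ : gw c = fun x => (Num.sqrt (pi / b) * expR (c ^+ 2 / (4 * b))) *
  normal_pdf (c / (2 * b)) s x); last by apply/funext => x; exact: gw_normal.
by apply: L1Z; exact: integrable_normal_pdf.
Qed.

Lemma int_gw c : \int[mu]_x gw c x = Num.sqrt (pi / b) * expR (c ^+ 2 / (4 * b)).
Proof.
under eq_int do rewrite gw_normal.
rewrite intZ; last exact: integrable_normal_pdf.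
by rewrite /Rintegral integral_normal_pdf mulr1.
Qed.

Lemma gw_ub c x : gw c x <= expR (c ^+ 2 / (4 * b)).
Proof.
rewrite ler_expR -subr_ge0.
rewrite (_ : _ - _ = (c - 2 * b * x) ^+ 2 / (4 * b)); last by field; rewrite gt_eqF.
by rewrite divr_ge0 ?sqr_ge0// mulr_ge0// ltW.
Qed.

Let absX x : `|x| <= expR (1 * x) + expR (-1 * x).
Proof.
rewrite mul1r mulN1r; have := expR_ge1Dx x; have := expR_ge1Dx (- x).
by have := expR_ge0 x; have := expR_ge0 (- x); case: (ger0P x); lra.
Qed.

(** A factor [x] is traded for shifts of [c] by [1] and [-1], so polynomial factors disappear by
    induction on the degree. *)
Let absXgw n c x : `|x ^+ n.+1 * gw c x| <=
  `|x ^+ n * gw (c + 1) x| + `|x ^+ n * gw (c - 1) x|.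
Proof.
rewrite exprS -mulrA normrM.
apply: (@le_trans _ _ ((expR (1 * x) + expR (-1 * x)) * `|x ^+ n * gw c x|)).
  by rewrite ler_wpM2r.
rewrite -(gwD c 1 x) -(gwD c (-1) x).
have := gw_ge0 c x; have := expR_ge0 (1 * x); have := expR_ge0 (-1 * x).
move: (gw c x) (expR (1 * x)) (expR (-1 * x)) => g e1 e2 h2 h1 hg.
rewrite !normrM (ger0_norm hg) (ger0_norm h1) (ger0_norm h2).
by rewrite le_eqVlt; apply/orP; left; apply/eqP; ring.
Qed.

Lemma L1_Xgw n c : L1 (fun x => x ^+ n * gw c x).
Proof.
elim: n c => [|n IH] c.
  by under eq_fun do rewrite mul1r; exact: L1_gw.
apply: (@L1_le _ _ (fun x => `|x ^+ n * gw (c + 1) x| + `|x ^+ n * gw (c - 1) x|)).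
- by apply: measurable_funM; [exact: exprn_measurable|exact: meas_gw].
- by move=> x; exact: absXgw.
- by apply: L1D; apply: L1_norm.
Qed.

Lemma Xgw_bounded n c : exists M, forall x, `|x ^+ n * gw c x| <= M.
Proof.
elim: n c => [|n IH] c.
  exists (expR (c ^+ 2 / (4 * b))) => x; rewrite mul1r ger0_norm ?gw_ge0//.
  exact: gw_ub.
have [M hM] := IH (c + 1); have [M' hM'] := IH (c - 1); exists (M + M') => x.
by apply: le_trans (absXgw n c x) _; rewrite lerD.
Qed.

Let polyE p c x : p.[x] * gw c x = \sum_(i < size p) p`_i * (x ^+ i * gw c x).
Proof. by rewrite horner_coef mulr_suml; apply: eq_bigr => i _; rewrite mulrA. Qed.

Lemma L1_pgw p c : L1 (fun x => p.[x] * gw c x).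
Proof.
under eq_fun do rewrite polyE.
by apply: L1_sum => i; apply: L1Z; exact: L1_Xgw.
Qed.

Lemma pgw_bounded p c : exists M, forall x, `|p.[x] * gw c x| <= M.
Proof.
have [M hM] := choice (fun i => Xgw_bounded i c).
exists (\sum_(i < size p) `|p`_i| * M i) => x.
rewrite polyE; apply: le_trans (ler_norm_sum _ _ _) _.
by apply: ler_sum => i _; rewrite normrM ler_wpM2l.
Qed.

(** Boundedness of [x p(x) gw c x] yields decay like [1/|x|]. The sequence [u] stands for both [n]
    and [- n], the two boundary points of [int_derive0]. *)
Lemma pgw_cvg0 p c (u : nat -> R) : (forall n, `|u n| = n%:R) ->
  p.[u n] * gw c (u n) @[n --> \oo] --> 0.
Proof.
move=> un; have [M hM] := pgw_bounded ('X * p) c.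
have M0 : 0 <= M by exact: le_trans (hM 0).
apply/cvgr0Pnorm_le => e e0; near=> n.
have n0 : (0 : R) < n%:R.
  by rewrite ltr0n; near: n; exact: nbhs_infty_gt.
rewrite -(ler_pM2l n0) -{1}un -normrM mulrA.
have := hM (u n); rewrite hornerM hornerX => /le_trans; apply.
rewrite -ler_pdivrMr//; near: n; exact: nbhs_infty_ger.
Unshelve. all: by end_near. Qed.

Lemma der_pgw p c x :
  is_derive x 1 (fun x => p.[x] * gw c x) ((p^`() + (c%:P - (2 * b) *: 'X) * p).[x] * gw c x).
Proof.
apply: der_eq (derM (is_derive_poly p x) (der_gw c x)) _.
by rewrite !(hornerD, hornerM, hornerN, hornerC, hornerX, hornerZ); ring.
Qed.

Lemma cont_pgw p c : continuous (fun x => p.[x] * gw c x).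
Proof. by move=> x; exact: der_cont (der_pgw p c x). Qed.

Lemma der_cosk k x : is_derive x 1 (fun x => cos (k * x)) (- (k * sin (k * x))).
Proof.
have did : is_derive x 1 (fun x : R => x) 1 by exact: is_derive_id.
apply: der_eq (der_comp (is_derive_cos _) (derZ k did)) _; ring.
Qed.

Lemma der_sink k x : is_derive x 1 (fun x => sin (k * x)) (k * cos (k * x)).
Proof.
have did : is_derive x 1 (fun x : R => x) 1 by exact: is_derive_id.
apply: der_eq (der_comp (is_derive_sin _) (derZ k did)) _; ring.
Qed.

Lemma cont_cosk k : continuous (fun x => cos (k * x)).
Proof. by move=> x; exact: der_cont (der_cosk k x). Qed.

Lemma cont_sink k : continuous (fun x => sin (k * x)).
Proof. by move=> x; exact: der_cont (der_sink k x). Qed.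

Lemma norm_cos x : `|cos x| <= 1.
Proof. by rewrite ler_norml cos_geN1 cos_le1. Qed.

Lemma norm_sin x : `|sin x| <= 1.
Proof. by rewrite ler_norml sin_geN1 sin_le1. Qed.

(** [Jc + i Js] is the integral of [p] against the Gaussian weight with complex linear coefficient
    [c + i k]. *)
Definition Jc c k p := \int[mu]_x (p.[x] * gw c x * cos (k * x)).
Definition Js c k p := \int[mu]_x (p.[x] * gw c x * sin (k * x)).

Lemma L1_pgwc c k p : L1 (fun x => p.[x] * gw c x * cos (k * x)).
Proof.
apply: (@L1Mb _ _ _ 1); first exact: L1_pgw.
  by apply: cont_meas; exact: cont_cosk.
by move=> x; exact: norm_cos.
Qed.

Lemma L1_pgws c k p : L1 (fun x => p.[x] * gw c x * sin (k * x)).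
Proof.
apply: (@L1Mb _ _ _ 1); first exact: L1_pgw.
  by apply: cont_meas; exact: cont_sink.
by move=> x; exact: norm_sin.
Qed.

Let raise p := (2 * b) *: 'X * p - p^`().

Let pgw_cvg0_bounded p c (h : R -> R) (u : nat -> R) : (forall x, `|h x| <= 1) ->
  (forall n, `|u n| = n%:R) ->
  p.[u n] * gw c (u n) * h (u n) @[n --> \oo] --> 0.
Proof.
move=> h1 un; apply/cvgr0Pnorm_le => e e0; near=> n.
rewrite normrM; apply: (@le_trans _ _ (`|p.[u n] * gw c (u n)| * 1)).
  by rewrite ler_wpM2l.
rewrite mulr1; near: n.
by move/cvgr0Pnorm_le : (pgw_cvg0 p c un); apply.
Unshelve. all: by end_near. Qed.

Let normn (n : nat) : `|n%:R : R| = n%:R. Proof. by rewrite ger0_norm. Qed.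
Let normNn (n : nat) : `|- n%:R : R| = n%:R. Proof. by rewrite normrN ger0_norm. Qed.

(** Since [raise p] times [exp(-b x^2)] is minus the derivative of [p exp(-b x^2)], integration by
    parts makes [raise] act on [Jc + i Js] as multiplication by [c + i k]. This is the real part,
    [Js_raise] the imaginary one. *)
Lemma Jc_raise c k p : Jc c k (raise p) = c * Jc c k p - k * Js c k p.
Proof.
have h : \int[mu]_x ((p^`() + (c%:P - (2 * b) *: 'X) * p).[x] * gw c x * cos (k * x)
    - k * (p.[x] * gw c x * sin (k * x))) = 0.
  apply: (@int_derive0 _ (fun x => p.[x] * gw c x * cos (k * x))).
  - move=> x; apply: der_eq (derM (der_pgw p c x) (der_cosk k x)) _; ring.
  - move=> x; apply: cvgB; first by apply: cvgM; [exact: cont_pgw|exact: cont_cosk].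
    apply: cvgM; first exact: cvg_cst.
    by apply: cvgM; [exact: cont_pgw|exact: cont_sink].
  - by apply: L1B; [exact: L1_pgwc|apply: L1Z; exact: L1_pgws].
  - by apply: (@pgw_cvg0_bounded _ _ (fun x => cos (k * x))) => // x; exact: norm_cos.
  - by apply: (@pgw_cvg0_bounded _ _ (fun x => cos (k * x))) => // x; exact: norm_cos.
rewrite intB in h; [|exact: L1_pgwc|by apply: L1Z; exact: L1_pgws].
rewrite intZ in h; last exact: L1_pgws.
rewrite (_ : Jc c k (raise p) = c * Jc c k p - \int[mu]_x
   ((p^`() + (c%:P - (2 * b) *: 'X) * p).[x] * gw c x * cos (k * x))); last first.
  rewrite -intZ -?intB; [|by apply: L1Z; exact: L1_pgwc|exact: L1_pgwc|exact: L1_pgwc].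
  by apply: eq_int => x; rewrite /raise !(hornerD, hornerM, hornerN, hornerC, hornerX, hornerZ); ring.
by move/eqP: h; rewrite subr_eq0 => /eqP ->.
Qed.

Lemma Js_raise c k p : Js c k (raise p) = c * Js c k p + k * Jc c k p.
Proof.
have h : \int[mu]_x ((p^`() + (c%:P - (2 * b) *: 'X) * p).[x] * gw c x * sin (k * x)
    + k * (p.[x] * gw c x * cos (k * x))) = 0.
  apply: (@int_derive0 _ (fun x => p.[x] * gw c x * sin (k * x))).
  - move=> x; apply: der_eq (derM (der_pgw p c x) (der_sink k x)) _; ring.
  - move=> x; apply: cvgD; first by apply: cvgM; [exact: cont_pgw|exact: cont_sink].
    apply: cvgM; first exact: cvg_cst.
    by apply: cvgM; [exact: cont_pgw|exact: cont_cosk].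
  - by apply: L1D; [exact: L1_pgws|apply: L1Z; exact: L1_pgwc].
  - by apply: (@pgw_cvg0_bounded _ _ (fun x => sin (k * x))) => // x; exact: norm_sin.
  - by apply: (@pgw_cvg0_bounded _ _ (fun x => sin (k * x))) => // x; exact: norm_sin.
rewrite intD in h; [|exact: L1_pgws|by apply: L1Z; exact: L1_pgwc].
rewrite intZ in h; last exact: L1_pgwc.
rewrite (_ : Js c k (raise p) = c * Js c k p - \int[mu]_x
   ((p^`() + (c%:P - (2 * b) *: 'X) * p).[x] * gw c x * sin (k * x))); last first.
  rewrite -intZ -?intB; [|by apply: L1Z; exact: L1_pgws|exact: L1_pgws|exact: L1_pgws].
  by apply: eq_int => x; rewrite /raise !(hornerD, hornerM, hornerN, hornerC, hornerX, hornerZ); ring.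
by rewrite -[in RHS](subr0 (c * _)) -h /Jc; ring.
Qed.

Lemma der_Jc c k : is_derive k 1 (fun k => Jc c k 1) (- Js c k 'X).
Proof.
have kk : `]k - 1, k + 1[%classic k by rewrite /= in_itv/= ltrBlDr ltrDl ltr01.
pose f (k x : R) := (1 : {poly R}).[x] * gw c x * cos (k * x).
have df (y x : R) : is_derive y 1 (f ^~ x) (- ('X.[x] * gw c x * sin (y * x))).
  have dc : is_derive y 1 (fun y : R => cos (y * x)) (- (x * sin (y * x))).
    by under eq_fun do rewrite mulrC; rewrite [y * x]mulrC; exact: der_cosk.
  apply: der_eq (derZ _ dc) _; rewrite hornerC hornerX; ring.
have d1f y x : partial1of2 f y x = - ('X.[x] * gw c x * sin (y * x)).
  by rewrite partial1of2E; exact: derive_val.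
have i1 y : `]k - 1, k + 1[%classic y -> mu.-integrable setT (EFin \o f y).
  by move=> _; exact: L1_pgwc.
have i2 y x : `]k - 1, k + 1[%classic y -> setT x -> derivable (f ^~ x) y 1.
  by move=> _ _; apply: ex_derive.
have i3 x : 0 <= `|'X.[x] * gw c x| by [].
have i4 : mu.-integrable setT (EFin \o (fun x => `|'X.[x] * gw c x|)).
  by apply: L1_norm; exact: L1_pgw.
have i5 y x : `]k - 1, k + 1[%classic y -> setT x ->
    `|partial1of2 f y x| <= `|'X.[x] * gw c x|.
  by move=> _ _; rewrite d1f normrN normrM -[leRHS]mulr1 ler_wpM2l// norm_sin.
have := @derivable_under_integral _ _ _ mu f setT measurableT k _ _ kk i1 i2 _ i3 i4 i5.
have := @differentiation_under_integral _ _ _ mu f setT measurableT k _ _ kk i1 i2 _ i3 i4 i5.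
rewrite derive1E => E /DeriveDef; apply; rewrite E -intN; last exact: L1_pgws.
by apply: eq_int => x; rewrite d1f.
Qed.

Lemma der_Js c k : is_derive k 1 (fun k => Js c k 1) (Jc c k 'X).
Proof.
have kk : `]k - 1, k + 1[%classic k by rewrite /= in_itv/= ltrBlDr ltrDl ltr01.
pose f (k x : R) := (1 : {poly R}).[x] * gw c x * sin (k * x).
have df (y x : R) : is_derive y 1 (f ^~ x) ('X.[x] * gw c x * cos (y * x)).
  have dc : is_derive y 1 (fun y : R => sin (y * x)) (x * cos (y * x)).
    by under eq_fun do rewrite mulrC; rewrite [y * x]mulrC; exact: der_sink.
  apply: der_eq (derZ _ dc) _; rewrite hornerC hornerX; ring.
have d1f y x : partial1of2 f y x = 'X.[x] * gw c x * cos (y * x).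
  by rewrite partial1of2E; exact: derive_val.
have i1 y : `]k - 1, k + 1[%classic y -> mu.-integrable setT (EFin \o f y).
  by move=> _; exact: L1_pgws.
have i2 y x : `]k - 1, k + 1[%classic y -> setT x -> derivable (f ^~ x) y 1.
  by move=> _ _; apply: ex_derive.
have i3 x : 0 <= `|'X.[x] * gw c x| by [].
have i4 : mu.-integrable setT (EFin \o (fun x => `|'X.[x] * gw c x|)).
  by apply: L1_norm; exact: L1_pgw.
have i5 y x : `]k - 1, k + 1[%classic y -> setT x ->
    `|partial1of2 f y x| <= `|'X.[x] * gw c x|.
  by move=> _ _; rewrite d1f normrM -[leRHS]mulr1 ler_wpM2l// norm_cos.
have := @derivable_under_integral _ _ _ mu f setT measurableT k _ _ kk i1 i2 _ i3 i4 i5.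
have := @differentiation_under_integral _ _ _ mu f setT measurableT k _ _ kk i1 i2 _ i3 i4 i5.
rewrite derive1E => E /DeriveDef; apply; rewrite E.
by apply: eq_int => x; rewrite d1f.
Qed.

Let raise1 : raise 1 = (2 * b) *: 'X.
Proof. by rewrite /raise mulr1 derivC subr0. Qed.

(** The case [p = 1] of [Jc_raise]. With [JsX] it turns [der_Jc] and [der_Js] into a closed linear
    system in [k]. *)
Lemma JcX c k : Jc c k 'X = (c * Jc c k 1 - k * Js c k 1) / (2 * b).
Proof.
have b2 : 2 * b != 0 by rewrite mulf_neq0// gt_eqF.
apply: (mulfI b2); rewrite mulrC [RHS]mulrC divfK// -Jc_raise raise1 mulrC /Jc -intZ.
  by apply: eq_int => x; rewrite hornerZ; ring.
exact: L1_pgwc.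
Qed.

Lemma JsX c k : Js c k 'X = (c * Js c k 1 + k * Jc c k 1) / (2 * b).
Proof.
have b2 : 2 * b != 0 by rewrite mulf_neq0// gt_eqF.
apply: (mulfI b2); rewrite mulrC [RHS]mulrC divfK// -Js_raise raise1 mulrC /Js -intZ.
  by apply: eq_int => x; rewrite hornerZ; ring.
exact: L1_pgws.
Qed.

Lemma Jc0 c : Jc c 0 1 = \int[mu]_x gw c x.
Proof. by apply: eq_int => x; rewrite mul0r cos0 mulr1 hornerC mul1r. Qed.

Lemma Js0 c p : Js c 0 p = 0.
Proof.
rewrite /Js (@eq_int _ _ (cst 0)) ?Rintegral_cst ?mul0r// => x.
by rewrite mul0r sin0 mulr0.
Qed.

Let der_esq (a k : R) : is_derive k 1 (fun k => expR (k ^+ 2 * a)) (2 * k * a * expR (k ^+ 2 * a)).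
Proof.
have did : is_derive k 1 (fun x : R => x) 1 by exact: is_derive_id.
have d2 : is_derive k 1 (fun x : R => x ^+ 2 * a) (2 * k * a).
  under eq_fun do rewrite mulrC expr2.
  by apply: der_eq (derZ a (derM did did)) _; ring.
by apply: der_eq (der_comp (is_derive_expR _) d2) _; ring.
Qed.

(** By that linear system, the squared modulus times [exp(k^2/(2 b))] has derivative zero in [k]; at
    [k = 0] it is the square of a real Gaussian integral. Working with the modulus avoids any
    complex Gaussian integral. *)
Lemma J_sqr c k : Jc c k 1 ^+ 2 + Js c k 1 ^+ 2 =
  pi / b * expR ((c ^+ 2 - k ^+ 2) / (2 * b)).
Proof.
pose A k := (Jc c k 1 * Jc c k 1 + Js c k 1 * Js c k 1) * expR (k ^+ 2 * (2 * b)^-1).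
have bn0 : b != 0 by rewrite gt_eqF.
have dA x : is_derive x 1 A 0.
  have dc := der_Jc c x; have ds := der_Js c x.
  apply: der_eq (derM (derD (derM dc dc) (derM ds ds)) (der_esq _ x)) _.
  by rewrite JcX JsX; field.
have := is_derive_0_is_cst k 0 dA; rewrite /A Jc0 Js0 int_gw expr0n/= !mul0r expR0.
rewrite addr0 mulr1 mulrACA -!expr2 sqr_sqrtr; last by rewrite divr_ge0 ?pi_ge0 ?ltW.
rewrite -expRM_natr => H.
apply: (mulIf (lt0r_neq0 (expR_gt0 (k ^+ 2 * (2 * b)^-1)))).
rewrite H -[RHS]mulrA -expRD; congr (_ * expR _).
by field.
Qed.

(** For [c = 0] the system decouples: [Js] and [Jc] both solve [J' = -(k/(2 b)) J], so each is
    determined by its value at [k = 0]. *)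
Lemma Js_centered k : Js 0 k 1 = 0.
Proof.
pose A k := Js 0 k 1 * expR (k ^+ 2 * (4 * b)^-1).
have bn0 : b != 0 by rewrite gt_eqF.
have dA x : is_derive x 1 A 0.
  have ds := der_Js 0 x; apply: der_eq (derM ds (der_esq _ x)) _.
  by rewrite JcX; field.
have := is_derive_0_is_cst k 0 dA; rewrite /A Js0 mul0r => /eqP.
by rewrite mulf_eq0 (gt_eqF (expR_gt0 _)) orbF => /eqP.
Qed.

Lemma Jc_centered k : Jc 0 k 1 = Num.sqrt (pi / b) * expR (- (k ^+ 2 / (4 * b))).
Proof.
pose A k := Jc 0 k 1 * expR (k ^+ 2 * (4 * b)^-1).
have bn0 : b != 0 by rewrite gt_eqF.
have dA x : is_derive x 1 A 0.
  have dc := der_Jc 0 x; apply: der_eq (derM dc (der_esq _ x)) _.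
  by rewrite JsX; field.
have := is_derive_0_is_cst k 0 dA; rewrite /A Jc0 int_gw expr0n/= !mul0r expR0 !mulr1.
by move=> <-; rewrite -mulrA -expRD addrN expR0 mulr1.
Qed.

End GaussianWeight.

(** * The tail of the exponential series *)

Section ExponentialTail.
Variable R : realType.
Implicit Types x : R.

(* Chernoff: the weight [2 ^ (n - N)] is at least [1] for [n > N]. *)
Lemma exp_tail x N : 0 <= x ->
  expR x - \sum_(n < N.+1) x ^+ n / n`!%:R <= (2^-1) ^+ N * expR (2 * x).
Proof.
move=> x0; rewrite lerBlDr.
have cx := @is_cvg_series_exp_coeff R x; have c2 := @is_cvg_series_exp_coeff R (2 * x).
apply: limr_le => //; near=> m.
have Nm : (N.+1 <= m)%N by near: m; exact: nbhs_infty_ge.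
have cn y : (0 : R) <= y -> nondecreasing_seq (series (exp_coeff y)).
  by move=> y0; apply: nondecreasing_series => n _ _; exact: exp_coeff_ge0.
have : series (exp_coeff (2 * x)) m <= expR (2 * x).
  by apply: nondecreasing_cvgn_le => //; apply: cn; rewrite mulr_ge0.
move=> h2; apply: (@le_trans _ _ ((2^-1) ^+ N * series (exp_coeff (2 * x)) m + \sum_(n < N.+1) x ^+ n / n`!%:R)); last first.
  by rewrite lerD2r ler_wpM2l// exprn_ge0// invr_ge0.
rewrite /series/= big_mkord big_mkord mulr_sumr.
rewrite (big_ord_widen_cond m xpredT (fun n => x ^+ n / n`!%:R) Nm)/=.
rewrite [X in _ + X]big_mkcond/= -big_split/=; apply: ler_sum => i _.
rewrite /exp_coeff/= exprMn; set t := x ^+ i / _.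
have t0 : 0 <= t by rewrite divr_ge0// exprn_ge0.
have s0 : 0 <= (2^-1) ^+ N * (2 ^+ i * x ^+ i / i`!%:R) :> R.
  by rewrite mulr_ge0 ?exprn_ge0 ?invr_ge0// -mulrA mulr_ge0// exprn_ge0.
case: ifPn => [_|]; first by rewrite lerDr.
rewrite -leqNgt addr0 => Ni.
rewrite (_ : _ * (_ / _) = (2^-1) ^+ N * 2 ^+ i * t); last by rewrite /t !mulrA.
rewrite -[leLHS]mul1r ler_wpM2r// exprVn mulrC.
rewrite ler_pdivlMr ?exprn_gt0// mul1r ler_eXn2l ?ltr1n//.
exact: leq_trans (leqnSn N) Ni.
Unshelve. all: by end_near. Qed.

End ExponentialTail.

(** * Hermite functions *)

Section HermiteFunctions.
Variables (R : realType) (b : R).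
Hypothesis b0 : 0 < b.
Local Notation mu := (@lebesgue_measure R).
Implicit Types (c k x : R) (p q r : {poly R}) (f : R -> R) (n N : nat).

Definition hfun p x := expR (- (b * x ^+ 2) / 2) * p.[x].

Lemma hfunM p q x : hfun p x * hfun q x = (p * q).[x] * gw b 0 x.
Proof.
rewrite hornerM /gw mul0r addr0 /hfun mulrACA -expRD mulrC; congr (_ * expR _).
by field.
Qed.

Lemma hfunD p q x : hfun (p + q) x = hfun p x + hfun q x.
Proof. by rewrite /hfun hornerD mulrDr. Qed.

Lemma hfunB p q x : hfun (p - q) x = hfun p x - hfun q x.
Proof. by rewrite /hfun hornerD hornerN mulrBr. Qed.

Lemma hfunZ a p x : hfun (a *: p) x = a * hfun p x.
Proof. by rewrite /hfun hornerZ mulrCA. Qed.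

Lemma der_hfun p x : is_derive x 1 (hfun p) (hfun (p^`() - b *: ('X * p)) x).
Proof.
have b2 : 0 < b / 2 by rewrite divr_gt0.
have := der_pgw (b / 2) p 0 x.
rewrite (_ : (fun x => p.[x] * gw (b / 2) 0 x) = hfun p).
  move/der_eq; apply; rewrite /hfun /gw mulrC.
  rewrite (_ : - (b / 2 * x ^+ 2) + 0 * x = - (b * x ^+ 2) / 2); last by field.
  rewrite !(hornerD, hornerM, hornerN, hornerC, hornerX, hornerZ).
  by field.
apply/funext => y; rewrite /hfun /gw mulrC; congr (expR _ * _).
by field.
Qed.

Lemma cont_hfun p : continuous (hfun p).
Proof. by move=> x; exact: der_cont (der_hfun p x). Qed.

Lemma sqint_hfun p : sqint (hfun p).
Proof.
split; first by apply: cont_meas; exact: cont_hfun.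
by under eq_fun do rewrite expr2 hfunM; exact: L1_pgw.
Qed.

Definition ip p q := \int[mu]_x (hfun p x * hfun q x).

Lemma ipE p q : ip p q = Jc b 0 0 (p * q).
Proof. by apply: eq_int => x; rewrite hfunM mul0r cos0 mulr1. Qed.

Lemma ipC p q : ip p q = ip q p.
Proof. by rewrite !ipE mulrC. Qed.

Lemma ipDl p q r : ip (p + q) r = ip p r + ip q r.
Proof.
rewrite /ip -intD; last 2 first.
- by apply: sqintM; exact: sqint_hfun.
- by apply: sqintM; exact: sqint_hfun.
by apply: eq_int => x; rewrite hfunD mulrDl.
Qed.

Lemma ipZl a p r : ip (a *: p) r = a * ip p r.
Proof.
rewrite /ip -intZ; last by apply: sqintM; exact: sqint_hfun.
by apply: eq_int => x; rewrite hfunZ mulrA.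
Qed.

Lemma ip0l r : ip 0 r = 0.
Proof. by rewrite -(scale0r (0 : {poly R})) ipZl mul0r. Qed.

Lemma ip_nrm2 p : ip p p = nrm2 (hfun p).
Proof. by apply: eq_int => x; rewrite expr2. Qed.

Lemma ip_ge0 p : 0 <= ip p p.
Proof. by rewrite ip_nrm2 nrm2_ge0. Qed.

(** The creation operator in polynomial form: the adjoint of differentiation for [ip], see
    [ip_adj]. *)
Definition raise p := (2 * b) *: 'X * p - p^`().

Let JcB p q : Jc b 0 0 (p - q) = Jc b 0 0 p - Jc b 0 0 q.
Proof.
rewrite /Jc -intB; [|exact: L1_pgwc|exact: L1_pgwc].
by apply: eq_int => x; rewrite hornerD hornerN; ring.
Qed.

Lemma ip_adj p q : ip p^`() q = ip p (raise q).
Proof.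
apply/eqP; rewrite eq_sym -subr_eq0 !ipE -JcB.
rewrite (_ : p * raise q - _ = (2 * b) *: 'X * (p * q) - (p * q)^`()).
  by rewrite (Jc_raise b0) !mul0r subr0.
by rewrite /raise derivM -mul_polyC; ring.
Qed.

(** Adjointness together with the commutation relation between differentiation and [raise], whose
    commutator is [2 b]. *)
Lemma ip_raise q : ip (raise q) (raise q) = ip q^`() q^`() + 2 * b * ip q q.
Proof.
rewrite -ip_adj (_ : (raise q)^`() = raise q^`() + (2 * b) *: q).
  by rewrite ipDl ipZl ipC -ip_adj.
by rewrite /raise derivB derivM derivZ derivX -!mul_polyC; ring.
Qed.

Lemma ip_cauchy p q : ip p q ^+ 2 <= ip p p * ip q q.
Proof. by rewrite 2!ip_nrm2; apply: cauchy_schwarz2; exact: sqint_hfun. Qed.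

Lemma size_deriv_le n p : (size p <= n.+1)%N -> (size p^`() <= n)%N.
Proof.
move=> sp; apply/leq_sizeP => j nj.
by rewrite coef_deriv nth_default ?mul0rn// (leq_trans sp).
Qed.

(** The number operator has eigenvalues [2 b j] with [j <= n] in degree at most [n]. Instead of
    diagonalising it, the proof bounds [t = ip p' p' = ip p (raise p')] by Cauchy-Schwarz;
    [ip_raise] and the induction hypothesis for [p'] give [t^2 <= ip p p * 2 b (n+1) t]. *)
Lemma ip_deriv n p : (size p <= n.+1)%N -> ip p^`() p^`() <= 2 * b * n%:R * ip p p.
Proof.
elim: n p => [|n IH] p sp.
  by rewrite (size1_polyC sp) derivC ip0l mulr0 mul0r.
set t := ip p^`() p^`(); set P := ip p p.
have t0 : 0 <= t by exact: ip_ge0.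
have P0 : 0 <= P by exact: ip_ge0.
have sp' : (size p^`() <= n.+1)%N.
  exact: size_deriv_le.
have h1 : t ^+ 2 <= P * (2 * b * n.+1%:R * t).
  rewrite {1}/t ip_adj; apply: le_trans (ip_cauchy _ _) _.
  rewrite ler_wpM2l// ip_raise -/t (_ : n.+1%:R = n%:R + 1); last by rewrite natr1.
  by have := IH _ sp'; rewrite -/t; lra.
have [->|tn0] := eqVneq t 0; first by rewrite !mulr_ge0// ltW.
have tp : 0 < t by rewrite lt_neqAle eq_sym tn0.
by rewrite -(ler_pM2r tp) -expr2; apply: le_trans h1 _; rewrite mulrCA mulrA mulrC mulrA.
Qed.

Lemma size_raise n p : (size p <= n)%N -> (size (raise p) <= n.+1)%N.
Proof.
move=> sp; rewrite (leq_trans (size_polyD _ _))// geq_max size_polyN; apply/andP; split.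
  rewrite -scalerAl (leq_trans (size_scale_leq _ _))//.
  rewrite (leq_trans (size_polyMleq _ _))// size_polyX.
  by rewrite add2n ltnS.
by apply: size_deriv_le; exact: leq_trans sp (leq_trans (leqnSn _) (leqnSn _)).
Qed.

(** The polynomial factor of the derivative of [hfun p], see [der_hfun]. *)
Definition dfun p := p^`() - b *: ('X * p).

Lemma size_dfun n p : (size p <= n)%N -> (size (dfun p) <= n.+1)%N.
Proof.
move=> sp; rewrite (leq_trans (size_polyD _ _))// geq_max size_polyN; apply/andP; split.
  by apply: size_deriv_le; exact: leq_trans sp (leq_trans (leqnSn _) (leqnSn _)).
rewrite (leq_trans (size_scale_leq _ _))//.
rewrite (leq_trans (size_polyMleq _ _))// size_polyX.
by rewrite add2n ltnS.
Qed.

(* A Bernstein inequality: twice the derivative is the difference of the lowering and the raising operator. *)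
Lemma nrm2_dfun n p : (size p <= n.+1)%N ->
  nrm2 (hfun (dfun p)) <= b * (2 * n%:R + 1) * nrm2 (hfun p).
Proof.
move=> sp; have h := ip_deriv sp; have hr := ip_raise p.
rewrite -!ip_nrm2; apply: (@le_trans _ _ (2^-1 * (ip p^`() p^`() + ip (raise p) (raise p)))).
  rewrite !ip_nrm2 /nrm2 -intD; [|by case: (sqint_hfun p^`())|by case: (sqint_hfun (raise p))].
  rewrite -intZ; last by apply: L1D; [case: (sqint_hfun p^`())|case: (sqint_hfun (raise p))].
  apply: int_le.
  - by case: (sqint_hfun (dfun p)).
  - by apply/L1Z/L1D; [case: (sqint_hfun p^`())|case: (sqint_hfun (raise p))].
  - move=> x; have -> : hfun (dfun p) x = 2^-1 * (hfun p^`() x - hfun (raise p) x).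
      by rewrite -hfunB -hfunZ /hfun /dfun /raise !(hornerD, hornerM, hornerN, hornerC, hornerX, hornerZ); field.
    by have := sqr_ge0 (hfun p^`() x + hfun (raise p) x); lra.
by rewrite hr; lra.
Qed.

(** Hermite polynomials, unnormalised; for [b = 1] they are the physicists' ones, by
    [H_(n+1) = 2 x H_n - H_n']. *)
Definition herm n := iter n raise 1.

Lemma size_herm n : (size (herm n) <= n.+1)%N.
Proof. by elim: n => [|n IH]; [rewrite size_polyC oner_neq0|exact: size_raise]. Qed.

Lemma ip_herm n p : ip p (herm n) = ip p^`(n) 1.
Proof. by elim: n p => [//|n IH] p; rewrite /herm iterS -ip_adj -/(herm n) IH -derivSn. Qed.

Lemma ip_herm0 n p : (size p <= n)%N -> ip p (herm n) = 0.
Proof. by move=> sp; rewrite ip_herm derivn_poly0// ip0l. Qed.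

(** This is the true squared norm of [hfun (herm n)]. [nrm2_herm] gives it as an upper bound, the
    direction that [herm_approx] uses. *)
Definition herm_bound n := (2 * b) ^+ n * n`!%:R * Num.sqrt (pi / b).

Lemma herm_bound_gt0 n : 0 < herm_bound n.
Proof.
rewrite /herm_bound !mulr_gt0// ?exprn_gt0 ?mulr_gt0 ?ltr0n ?fact_gt0//.
by rewrite sqrtr_gt0 divr_gt0// pi_gt0.
Qed.

Lemma nrm2_herm n : ip (herm n) (herm n) <= herm_bound n.
Proof.
elim: n => [|n IH].
  rewrite /herm/= ipE mulr1 Jc0 int_gw// /herm_bound fact0 expr0 !mul1r.
  by rewrite expr0n/= mul0r expR0 mulr1.
rewrite /herm iterS ip_raise -/(herm n).
have := ip_deriv (size_herm n); rewrite /herm_bound exprS factS natrM -natr1.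
move: IH; rewrite /herm_bound => IH h.
apply: (@le_trans _ _ (2 * b * (n%:R + 1) * ip (herm n) (herm n))); first lra.
rewrite (_ : 2 * b * _ ^+ n * _ * _ = 2 * b * (n%:R + 1) * ((2 * b) ^+ n * n`!%:R * Num.sqrt (pi / b))); last ring.
by rewrite ler_wpM2l// !mulr_ge0 ?addr_ge0// ltW.
Qed.

(** Bessel's inequality with its approximant. Subtracting [(a/M) herm n] changes the squared norm by
    [-2 a^2/M + (a/M)^2 ip (herm n) (herm n)], at most [-a^2/M] as soon as [M] bounds the squared
    norm of [herm n] from above. The coefficient [a] is not affected by the earlier steps, since
    [herm n] is orthogonal to lower degrees. *)
Lemma herm_approx (F : R -> R) n : sqint F -> exists p, (size p <= n)%N /\
  nrm2 (fun x => F x - hfun p x) <=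
  nrm2 F - \sum_(i < n) (\int[mu]_x (F x * hfun (herm i) x)) ^+ 2 / herm_bound i.
Proof.
move=> SF; elim: n => [|n [p [sp IH]]].
  exists 0; rewrite size_poly0 big_ord0 subr0; split => //.
  rewrite (_ : (fun _ => _) = F)//; apply/funext => x.
  by rewrite /hfun horner0 mulr0 subr0.
set a := \int[mu]_x (F x * hfun (herm n) x); set M := herm_bound n.
have M0 : 0 < M by exact: herm_bound_gt0.
exists (p + (a / M) *: herm n); split.
  rewrite (leq_trans (size_polyD _ _))// geq_max (leq_trans sp)//=.
  by rewrite (leq_trans (size_scale_leq _ _))// size_herm.
have SG : sqint (fun x => F x - hfun p x) by apply: sqintB => //; exact: sqint_hfun.
have Sh := sqint_hfun (herm n).
have aE : \int[mu]_x ((F x - hfun p x) * hfun (herm n) x) = a.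
  rewrite (_ : a = a - ip p (herm n)); last by rewrite ip_herm0// subr0.
  rewrite /a /ip -intB; [|exact: sqintM|by apply: sqintM => //; exact: sqint_hfun].
  by apply: eq_int => x; rewrite mulrBl.
rewrite (_ : (fun _ => _) = fun x => (F x - hfun p x) + (- (a / M)) * hfun (herm n) x); last first.
  by apply/funext => x; rewrite hfunD hfunZ; ring.
rewrite nrm2D//; last exact: sqintZ.
rewrite nrm2Z// big_ord_recr/= -/a -/M.
rewrite (_ : \int[mu]_x _ = - (a / M) * a); last first.
  rewrite -[X in _ = _ * X]aE -intZ; last exact: sqintM.
  by apply: eq_int => x; ring.
have hM := nrm2_herm n; rewrite ip_nrm2 -/M in hM.
have : (- (a / M)) ^+ 2 * nrm2 (hfun (herm n)) <= (- (a / M)) ^+ 2 * M.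
  by rewrite ler_wpM2l ?sqr_ge0.
have -> : (- (a / M)) ^+ 2 * M = a ^+ 2 / M by field; rewrite gt_eqF.
have -> : 2 * (- (a / M) * a) = - 2 * (a ^+ 2 / M) by field; rewrite gt_eqF.
move: IH; lra.
Qed.

(** [size p <= n] means degree below [n], so orthogonality to [P_N] reads [orth N.+1]. *)
Definition orth n f := forall p, (size p <= n)%N -> \int[mu]_x (f x * hfun p x) = 0.

(** Gram-Schmidt, one degree at a time: [e] is the monomial of degree [n] minus its projection on
    lower degrees. *)
Lemma proj_exists n f : sqint f ->
  exists p, (size p <= n)%N /\ orth n (fun x => f x - hfun p x).
Proof.
elim: n f => [|n IH] f Sf.
  exists 0; split; first by rewrite size_poly0.
  move=> p; rewrite leqn0 size_poly_eq0 => /eqP ->.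
  rewrite (@eq_int _ _ (cst 0)) ?Rintegral_cst ?mul0r// => x.
  by rewrite /hfun horner0 !mulr0.
have [p [sp op]] := IH f Sf.
have [r [sr or]] := IH _ (sqint_hfun 'X^n).
pose e := 'X^n - r.
have se : (size e <= n.+1)%N.
  rewrite (leq_trans (size_polyD _ _))// geq_max size_polyXn leqnn size_polyN.
  exact: leq_trans sr _.
have oe q : (size q <= n)%N -> ip e q = 0.
  move=> /or <-; by apply: eq_int => x; rewrite hfunB.
(* If [ip e e] were zero, Cauchy-Schwarz would make the pairing of [f] with [e] zero too, so [c = 0]
   works; positivity of [ip e e] never has to be shown. *)
pose c := if ip e e == 0 then 0 else \int[mu]_x (f x * hfun e x) / ip e e.
have Sp := sqint_hfun p; have Se := sqint_hfun e.
exists (p + c *: e); split.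
  rewrite (leq_trans (size_polyD _ _))// geq_max (leq_trans sp)//=.
  exact: leq_trans (size_scale_leq _ _) se.
have key q : sqint (hfun q) -> \int[mu]_x ((f x - hfun (p + c *: e) x) * hfun q x) =
    \int[mu]_x ((f x - hfun p x) * hfun q x) - c * ip e q.
  move=> Sq; rewrite -intZ; last exact: sqintM.
  rewrite -intB; [|by apply: sqintM => //; apply: sqintB|by apply/L1Z/sqintM].
  by apply: eq_int => x; rewrite hfunD hfunZ; ring.
have hE q : (size q <= n)%N -> \int[mu]_x ((f x - hfun (p + c *: e) x) * hfun q x) = 0.
  move=> sq; rewrite key; last exact: sqint_hfun.
  by rewrite oe// mulr0 subr0 op.
have hee : \int[mu]_x ((f x - hfun (p + c *: e) x) * hfun e x) = 0.
  rewrite key// (_ : \int[mu]_x _ = \int[mu]_x (f x * hfun e x)); last first.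
    rewrite -[RHS]subr0 -(oe p sp) ipC /ip -intB; [|exact: sqintM|exact: sqintM].
    by apply: eq_int => x; rewrite mulrBl.
  rewrite /c; case: ifPn => [/eqP e0|e0]; last by rewrite divfK// subrr.
  rewrite mul0r subr0; have := cauchy_schwarz2 Sf Se.
  rewrite -ip_nrm2 e0 mulr0 => h; apply/eqP; rewrite -sqrf_eq0.
  by rewrite eq_le h sqr_ge0.
(* As [e] is monic of degree [n], removing [a *: e] from [q] lowers the degree and reduces to [hE]
   and [hee]. *)
move=> q sq; pose a := q`_n.
have sq' : (size (q - a *: e)%R <= n)%N.
  apply/leq_sizeP => j; rewrite leq_eqVlt => /orP[/eqP <-|nj].
    rewrite coefB coefZ coefB coefXn eqxx (nth_default 0 sr) subr0 mulr1.
    by rewrite subrr.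
  by rewrite nth_default// (leq_trans _ nj)// (leq_trans (size_polyD _ _))// geq_max sq size_polyN (leq_trans (size_scale_leq _ _)).
have Sg : sqint (fun x => f x - hfun (p + c *: e) x) by apply: sqintB => //; exact: sqint_hfun.
rewrite (_ : \int[mu]_x _ = \int[mu]_x ((f x - hfun (p + c *: e) x) * hfun (q - a *: e) x)
   + a * \int[mu]_x ((f x - hfun (p + c *: e) x) * hfun e x)).
  by rewrite hE// hee mulr0 addr0.
rewrite -intZ; last exact: sqintM.
rewrite -intD; [|by apply: sqintM => //; exact: sqint_hfun|by apply/L1Z/sqintM].
by apply: eq_int => x; rewrite hfunB hfunZ; ring.
Qed.

(** [Fc] and [Fs] are the real and imaginary parts of an unnormalised wave packet of frequency [k]
    centred at [c / b]. *)
Let Fc c k x := gw (b / 2) c x * cos (k * x).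
Let Fs c k x := gw (b / 2) c x * sin (k * x).

Let gw2 c x : gw (b / 2) c x ^+ 2 = gw b (2 * c) x.
Proof. by rewrite /gw -expRM_natr; congr expR; field. Qed.

Let gw_half c p x : gw (b / 2) c x * hfun p x = p.[x] * gw b c x.
Proof. by rewrite /gw /hfun mulrA -expRD mulrC; congr (_ * expR _); field. Qed.

Lemma sqint_gwb c (h : R -> R) : continuous h -> (forall x, `|h x| <= 1) ->
  sqint (fun x => gw (b / 2) c x * h x).
Proof.
move=> ch h1; apply: (sqintMb (M := 1)) => //; last exact: cont_meas.
split; first exact: meas_gw.
by under eq_fun do rewrite gw2; exact: L1_gw.
Qed.

Let SFc c k : sqint (Fc c k).
Proof. by apply: sqint_gwb => x; [exact: cont_cosk|exact: norm_cos]. Qed.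

Let SFs c k : sqint (Fs c k).
Proof. by apply: sqint_gwb => x; [exact: cont_sink|exact: norm_sin]. Qed.

Let nrm2_F c k : nrm2 (Fc c k) + nrm2 (Fs c k) = Num.sqrt (pi / b) * expR (c ^+ 2 / b).
Proof.
have [_ i1] := SFc c k; have [_ i2] := SFs c k.
rewrite /nrm2 -intD// (@eq_int _ _ (gw b (2 * c))).
  by rewrite int_gw//; congr (_ * expR _); field; rewrite gt_eqF.
by move=> x; rewrite /Fc /Fs !exprMn -mulrDr cos2Dsin2 mulr1 gw2.
Qed.

(** Each [raise] multiplies the complex Hermite coefficient of the packet by [c + i k]. Divided by
    [herm_bound n], the result is proportional to the Poisson weight [l^n / n!] with
    [l = (c^2 + k^2)/(2 b)]. *)
Let J_herm c k n : Jc b c k (herm n) ^+ 2 + Js b c k (herm n) ^+ 2 =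
  (c ^+ 2 + k ^+ 2) ^+ n * (pi / b * expR ((c ^+ 2 - k ^+ 2) / (2 * b))).
Proof.
elim: n => [|n IH]; first by rewrite expr0 mul1r -J_sqr.
by rewrite [in RHS]exprS -mulrA -IH /herm iterS -/(herm n) Jc_raise// Js_raise//; ring.
Qed.

(** Orthogonality lets the packet be replaced by its residual after approximation in [P_N]. By
    [herm_approx] the squared residual is the total mass minus a Poisson partial sum, and [exp_tail]
    bounds the rest. *)
Lemma orth_gabor_bound c k N f : sqint f -> orth N.+1 f ->
  let B := nrm2 f * (Num.sqrt (pi / b) * (2^-1) ^+ N *
    expR (c ^+ 2 / b + (c ^+ 2 + k ^+ 2) / (2 * b))) in
  (\int[mu]_x (f x * (gw (b / 2) c x * cos (k * x)))) ^+ 2 <= B /\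
  (\int[mu]_x (f x * (gw (b / 2) c x * sin (k * x)))) ^+ 2 <= B.
Proof.
move=> Sf of_.
set l := (c ^+ 2 + k ^+ 2) / (2 * b).
set Q := Num.sqrt (pi / b).
have Q0 : 0 < Q by rewrite sqrtr_gt0 divr_gt0// pi_gt0.
have l0 : 0 <= l by rewrite divr_ge0 ?addr_ge0 ?sqr_ge0// mulr_ge0// ltW.
have [pc [spc hc]] := herm_approx N.+1 (SFc c k).
have [ps [sps hs]] := herm_approx N.+1 (SFs c k).
set Gc := nrm2 (fun x => Fc c k x - _) in hc.
set Gs := nrm2 (fun x => Fs c k x - _) in hs.
have Gc0 : 0 <= Gc by exact: nrm2_ge0.
have Gs0 : 0 <= Gs by exact: nrm2_ge0.
have main : Gc + Gs <= Q * (2^-1) ^+ N * expR (c ^+ 2 / b + l).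
  have := lerD hc hs; rewrite addrACA nrm2_F -opprD -big_split/=.
  rewrite (eq_bigr (fun i : 'I_N.+1 => Q * expR ((c ^+ 2 - k ^+ 2) / (2 * b)) * (l ^+ i / i`!%:R))); last first.
    move=> i _; rewrite -mulrDl.
    rewrite (_ : \int[mu]_x _ = Jc b c k (herm i)); last first.
      by apply: eq_int => x; rewrite /Fc mulrAC gw_half.
    rewrite (_ : \int[mu]_x _ = Js b c k (herm i)); last first.
      by apply: eq_int => x; rewrite /Fs mulrAC gw_half.
    rewrite J_herm /herm_bound -/Q /l expr_div_n.
    have -> : pi / b = Q ^+ 2 by rewrite sqr_sqrtr// divr_ge0 ?pi_ge0// ltW.
    field; rewrite !gt_eqF//= ?exprn_gt0 ?mulr_gt0// ?ltr0n ?fact_gt0//.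
  rewrite -mulr_sumr => /le_trans; apply.
  rewrite -/Q -!(mulrA Q) -mulrBr ler_wpM2l//; first exact: ltW.
  (* The total mass thus carries the factor [expR l] beside the common prefactor of the Poisson
     terms, and the difference is exactly an exponential tail. *)
  have -> : c ^+ 2 / b = (c ^+ 2 - k ^+ 2) / (2 * b) + l by rewrite /l; field; rewrite gt_eqF.
  rewrite expRD -mulrBr.
  apply: (@le_trans _ _ (expR ((c ^+ 2 - k ^+ 2) / (2 * b)) * ((2^-1) ^+ N * expR (2 * l)))).
    by rewrite ler_wpM2l ?expR_ge0// exp_tail.
  rewrite mulrCA -expRD le_eqVlt; apply/orP; left; apply/eqP; congr (_ * expR _).
  ring.
have key (F : R -> R) p : sqint F -> (size p <= N.+1)%N ->
    (\int[mu]_x (f x * F x)) ^+ 2 <= nrm2 f * nrm2 (fun x => F x - hfun p x).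
  move=> SF sp; have Sp := sqint_hfun p.
  rewrite (_ : \int[mu]_x (f x * F x) = \int[mu]_x (f x * (F x - hfun p x))).
    by apply: cauchy_schwarz2 => //; exact: sqintB.
  rewrite -[LHS]subr0 -(of_ p sp) -intB; [|exact: sqintM|exact: sqintM].
  by apply: eq_int => x; rewrite mulrBr.
have f0 := nrm2_ge0 f.
move=> B; split.
  apply: le_trans (key _ _ (SFc c k) spc) _; rewrite ler_wpM2l//.
  by apply: le_trans _ main; rewrite lerDl.
apply: le_trans (key _ _ (SFs c k) sps) _; rewrite ler_wpM2l//.
by apply: le_trans _ main; rewrite lerDr.
Qed.

End HermiteFunctions.

(** * The heat kernel *)

Section Heat.
Variable R : realType.
Local Notation mu := (@lebesgue_measure R).
Implicit Types (f g h : R -> R) (s x y : R).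

Lemma L1_pdf x s : s != 0 -> L1 (normal_pdf x s).
Proof. by move=> s0; exact: integrable_normal_pdf. Qed.

Lemma int_pdf x s : s != 0 -> \int[mu]_y normal_pdf x s y = 1.
Proof. by move=> s0; rewrite /Rintegral integral_normal_pdf. Qed.

Lemma pdfE m s x : s != 0 ->
  normal_pdf m s x = normal_peak s * expR (- (x - m) ^+ 2 / (s ^+ 2 *+ 2)).
Proof. by move=> s0; rewrite normal_pdfE. Qed.

Lemma pdfC x y s : s != 0 -> normal_pdf x s y = normal_pdf y s x.
Proof.
by move=> s0; rewrite (pdfE x y s0) (pdfE y x s0) -[in RHS]sqrrN opprB.
Qed.

Lemma pdf_norm_ub x s y : s != 0 -> `|normal_pdf x s y| <= normal_peak s.
Proof. by move=> s0; rewrite ger0_norm ?normal_pdf_ge0// normal_pdf_ub. Qed.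

Lemma meas_pdf2 s : s != 0 -> measurable_fun setT (fun z : R * R => normal_pdf z.1 s z.2).
Proof.
move=> s0; rewrite (_ : (fun z => _) = fun z : R * R => normal_peak s * normal_fun 0 s (z.2 - z.1)).
  apply: measurable_funM => //; apply: measurableT_comp; first exact: measurable_normal_fun.
  by apply: measurable_funB; [exact: measurable_snd|exact: measurable_fst].
by apply/funext => z; rewrite (pdfE _ _ s0) /normal_fun subr0.
Qed.

(* For [|y - x| >= M], [(y - x) ^ 2 >= M ^ 2 + (|y - x| - M) ^ 2]. *)
Lemma pdf_tail x s (M K : R) h : s != 0 -> 0 <= M -> measurable_fun setT h ->
  (forall y, `|h y| <= K) -> (forall y, `|y - x| < M -> h y = 0) ->
  `|\int[mu]_y (normal_pdf x s y * h y)| <= K * (2 * expR (- (M ^+ 2 / (s ^+ 2 *+ 2)))).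
Proof.
move=> s0 M0 mh hK hM; have K0 : 0 <= K by exact: le_trans (hK 0).
have i1 : L1 (fun y => normal_pdf x s y * h y) by exact: L1Mb (L1_pdf x s0) mh hK.
set E := expR _.
have i2 : L1 (fun y => K * (E * (normal_pdf (x + M) s y + normal_pdf (x - M) s y))).
  by apply/L1Z/L1Z/L1D; exact: L1_pdf.
apply: le_trans (int_norm i1) _.
rewrite (_ : K * (2 * E) = \int[mu]_y (K * (E * (normal_pdf (x + M) s y + normal_pdf (x - M) s y)))); last first.
  rewrite intZ; last by apply/L1Z/L1D; exact: L1_pdf.
  rewrite intZ; last by apply/L1D; exact: L1_pdf.
  by rewrite intD; [rewrite !int_pdf//; ring|exact: L1_pdf|exact: L1_pdf].
apply: int_le => //; first exact: L1_norm.
move=> y; have E0 : 0 <= E by exact: expR_ge0.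
have p1 := normal_pdf_ge0 (x + M) s y; have p2 := normal_pdf_ge0 (x - M) s y.
have [yM|yM] := ltP `|y - x| M.
  by rewrite hM// mulr0 normr0 mulr_ge0// mulr_ge0// addr_ge0.
rewrite normrM (ger0_norm (normal_pdf_ge0 _ _ _)) mulrC ler_pM ?normal_pdf_ge0//.
have s2 : 0 < s ^+ 2 *+ 2 by rewrite pmulrn_lgt0// lt_neqAle eq_sym sqrf_eq0 s0 sqr_ge0.
have key (z : R) : (y - x) ^+ 2 >= M ^+ 2 + (y - z) ^+ 2 ->
    normal_pdf x s y <= E * normal_pdf z s y.
  move=> hz; rewrite (pdfE x _ s0) (pdfE z _ s0) mulrCA ler_wpM2l ?normal_peak_ge0//.
  rewrite /E -expRD ler_expR !mulNr -opprD lerN2 -mulrDl.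
  by rewrite ler_pM2r// invr_gt0.
move: yM; rewrite ler_normr => /orP[yM|yM].
  apply: (@le_trans _ _ (E * normal_pdf (x + M) s y)); last by rewrite ler_wpM2l// lerDl.
  by apply: key; nra.
apply: (@le_trans _ _ (E * normal_pdf (x - M) s y)); last by rewrite ler_wpM2l// lerDr.
by apply: key; nra.
Qed.

(** Convolution with the centred normal density of deviation [s]. It is used twice: with
    [s = 1/(n+1)] as an approximate identity, and with [s = 1/beta] to build the cut-off [chi]. *)
Definition heat s g x := \int[mu]_y (g y * normal_pdf x s y).

Lemma L1_heat_kernel s g x : s != 0 -> L1 g -> L1 (fun y => g y * normal_pdf x s y).
Proof.
move=> s0 g1; apply: (L1Mb (M := normal_peak s)) => //.
  exact: measurable_normal_pdf.
by move=> y; exact: pdf_norm_ub.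
Qed.

Lemma heatB s g h x : s != 0 -> L1 g -> L1 h ->
  heat s (fun y => g y - h y) x = heat s g x - heat s h x.
Proof.
move=> s0 g1 h1; rewrite /heat -intB; [|exact: L1_heat_kernel|exact: L1_heat_kernel].
by apply: eq_int => y; rewrite mulrBl.
Qed.

Lemma heat_norm s g x : s != 0 -> L1 g -> `|heat s g x| <= heat s (fun y => `|g y|) x.
Proof.
move=> s0 g1; apply: le_trans (int_norm (L1_heat_kernel x s0 g1)) _.
rewrite le_eqVlt; apply/orP; left; apply/eqP; apply: eq_int => y.
by rewrite normrM (ger0_norm (normal_pdf_ge0 _ _ _)).
Qed.

Lemma heat_bound s g x : s != 0 -> L1 g -> `|heat s g x| <= normal_peak s * \int[mu]_y `|g y|.
Proof.
move=> s0 g1; apply: le_trans (int_norm (L1_heat_kernel x s0 g1)) _.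
rewrite -intZ; last exact: L1_norm.
apply: int_le; first exact/L1_norm/L1_heat_kernel.
  exact/L1Z/L1_norm.
by move=> y; rewrite normrM mulrC ler_wpM2r// pdf_norm_ub.
Qed.

(** Fubini, where the symmetry [pdfC] of the kernel makes the integral over [x] equal to one. *)
Lemma L1_heat s g : s != 0 -> L1 g ->
  L1 (heat s g) /\ \int[mu]_x heat s g x = \int[mu]_x g x.
Proof.
move=> s0 g1; have mg := L1_meas g1.
pose F (z : R * R) := (g z.2 * normal_pdf z.1 s z.2)%:E.
have mF : measurable_fun setT F.
  apply/measurable_EFinP; apply: measurable_funM; last exact: meas_pdf2.
  exact: measurableT_comp.
have pC y : L1 (fun x => normal_pdf x s y).
  by under eq_fun do rewrite pdfC//; exact: L1_pdf.
have ipC y : \int[mu]_x normal_pdf x s y = 1.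
  by under eq_int do rewrite pdfC//; exact: int_pdf.
have iF : (mu \x mu)%E.-integrable setT F.
  apply/integrable21ltyP => //.
  have -> : (\int[mu]_y \int[mu]_x `|F (x, y)| = \int[mu]_y (`|g y|)%:E)%E.
    apply: eq_integral => y _.
    have -> : (\int[mu]_x `|F (x, y)| = \int[mu]_x (`|g y| * normal_pdf x s y)%:E)%E.
      apply: eq_integral => x _.
      by rewrite /F/= normrM (ger0_norm (normal_pdf_ge0 _ _ _)).
    by rewrite L1_EFin ?intZ ?ipC ?mulr1//; exact: L1Z.
  by rewrite L1_EFin ?ltry//; exact: L1_norm.
have hE : EFin \o heat s g = fun x => (\int[mu]_y F (x, y))%E.
  by apply/funext => x /=; rewrite -L1_EFin//; exact: L1_heat_kernel.
have i1 : L1 (heat s g) by rewrite /L1 hE; exact: (integrable_fubini_F iF).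
split => //; rewrite /Rintegral; congr fine.
transitivity (\int[mu]_x \int[mu]_y F (x, y))%E.
  by apply: eq_integral => x _; rewrite -[RHS]/((fun x => (\int[mu]_y F (x, y))%E) x) -hE.
rewrite (Fubini iF); apply: eq_integral => y _.
by rewrite /F/= L1_EFin ?intZ ?ipC ?mulr1//; exact: L1Z.
Qed.

(* Jensen: [0 <= \int (g y - m) ^ 2 P(x, y) dy] at the mean [m = heat s g x]. *)
Lemma heat_jensen s g x : s != 0 -> L1 g -> sqint g ->
  heat s g x ^+ 2 <= heat s (fun y => g y ^+ 2) x.
Proof.
move=> s0 g1 [_ g2]; set m := heat s g x.
have j1 : L1 (fun y => g y ^+ 2 * normal_pdf x s y) by exact: L1_heat_kernel.
have j2 : L1 (fun y => g y * normal_pdf x s y) by exact: L1_heat_kernel.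
have j3 := L1_pdf x s0.
have : 0 <= \int[mu]_y ((g y - m) ^+ 2 * normal_pdf x s y).
  by apply: int_ge0 => y; rewrite mulr_ge0 ?sqr_ge0 ?normal_pdf_ge0.
have -> : \int[mu]_y ((g y - m) ^+ 2 * normal_pdf x s y) = heat s (fun y => g y ^+ 2) x +
    (- 2 * m * \int[mu]_y (g y * normal_pdf x s y) + m ^+ 2 * \int[mu]_y normal_pdf x s y).
  rewrite -(intZ (- 2 * m) j2) -(intZ (m ^+ 2) j3) -intD; [|exact: L1Z|exact: L1Z].
  rewrite -intD//; last by apply: L1D; exact: L1Z.
  by apply: eq_int => y; ring.
by rewrite int_pdf// -/(heat s g x) -/m; lra.
Qed.

(** Jensen pointwise, integrated with the mass preservation of [L1_heat] applied to [g^2]. *)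
Lemma heat_contract s g : s != 0 -> L1 g -> sqint g ->
  sqint (heat s g) /\ nrm (heat s g) <= nrm g.
Proof.
move=> s0 g1 Sg; have [mg g2] := Sg.
have [h1 _] := L1_heat s0 g1; have [h2 e2] := L1_heat s0 g2.
have Sh : sqint (heat s g).
  split; first exact: L1_meas.
  apply: L1_le h2.
    by apply: measurable_funX; exact: L1_meas.
  by move=> x; rewrite ger0_norm ?sqr_ge0//; exact: heat_jensen.
split => //; rewrite ler_wsqrtr// /nrm2 -e2; apply: int_le => //; first by case: Sh.
by move=> x; exact: heat_jensen.
Qed.

Lemma int_heat_le s f g K : s != 0 -> L1 g -> measurable_fun setT f -> (forall x, `|f x| <= K) ->
  `|\int[mu]_x (f x * heat s g x)| <= K * \int[mu]_x `|g x|.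
Proof.
move=> s0 g1 mf fK; have K0 : 0 <= K by exact: le_trans (fK 0).
have [h1 _] := L1_heat s0 g1; have [h2 e2] := L1_heat s0 (L1_norm g1).
have i1 : L1 (fun x => f x * heat s g x).
  by under eq_fun do rewrite mulrC; exact: L1Mb h1 mf fK.
apply: le_trans (int_norm i1) _; rewrite -e2 -intZ//.
apply: int_le; [exact: L1_norm|exact: L1Z|move=> x].
by rewrite normrM ler_pM// heat_norm.
Qed.

Let sn n : R := n.+1%:R^-1.

Let sn0 n : sn n != 0. Proof. by rewrite invr_eq0 pnatr_eq0. Qed.

Lemma heat_cvg_pt h x K : L1 h -> (forall y, `|h y| <= K) -> {for x, continuous h} ->
  heat (sn n) h x @[n --> \oo] --> h x.
Proof.
move=> h1 hK ch; have mh := L1_meas h1; have K0 : 0 <= K by exact: le_trans (hK 0).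
apply/cvgrPdist_le => e e0.
have e2 : 0 < e / 2 by rewrite divr_gt0.
move/cvgrPdist_le : ch => /(_ _ e2) [d /= d0 hd].
have tail : (2 * K) * (2 * expR (- (d ^+ 2 / (sn n ^+ 2 *+ 2)))) @[n --> \oo] --> 0.
  rewrite -[X in _ --> X](mulr0 (2 * K * 2)).
  under eq_fun do rewrite mulrA.
  apply: cvgM; first exact: cvg_cst.
  (* By [exp t >= 1 + t] with [t = (d^2/2)(n+1)^2], the tail is below [1/t], hence below this
     multiple of [1/(n+1)]. *)
  apply: (@squeeze_cvgr _ _ _ _ (fun=> 0) (fun n => (d ^+ 2 / 2)^-1 * sn n)).
  - near=> n; rewrite expR_ge0/= expRN.
    have a0 : 0 < d ^+ 2 / 2 by rewrite divr_gt0// exprn_gt0.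
    have -> : d ^+ 2 / (sn n ^+ 2 *+ 2) = d ^+ 2 / 2 * n.+1%:R ^+ 2.
      by rewrite /sn -mulr_natr; field; rewrite addrC natr1 pnatr_eq0.
    rewrite -invfM lef_pV2 ?posrE ?expR_gt0 ?mulr_gt0 ?ltr0n//.
    apply: le_trans (expR_ge1Dx _); rewrite ler_wpDl//.
    by rewrite ler_pM2l// -natrX ler_nat -{1}(expn1 n.+1) leq_pexp2l.
  - exact: cvg_cst.
  - rewrite -[X in _ --> X](mulr0 (d ^+ 2 / 2)^-1).
    by apply: cvgM; [exact: cvg_cst|exact: cvg_harmonic].
near=> n.
pose A : set R := [set y | `|y - x| < d].
have mA : measurable A.
  rewrite (_ : A = ball x d); first exact: measurable_ball.
  by apply/seteqP; split => y /=; rewrite /ball/= distrC.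
(* [u] is small by continuity of [h] at [x]; [v] is merely bounded, but vanishes near [x], so that
   [pdf_tail] applies. *)
pose u y := (h y - h x) * \1_A y; pose v y := (h y - h x) * \1_(~` A) y.
have mu1 : measurable_fun setT u.
  by apply: measurable_funM; [exact: measurable_funB|exact: measurable_indic].
have mv : measurable_fun setT v.
  apply: measurable_funM; [exact: measurable_funB|apply: measurable_indic].
  exact: measurableC.
have ue y : `|u y| <= e / 2.
  rewrite /u indicE; case: (boolP (y \in A)) => [|_]; last by rewrite mulr0 normr0 ltW.
  rewrite inE /A/= => yA; rewrite mulr1 distrC; apply: hd => /=.
  by rewrite /ball/= distrC.
have vK y : `|v y| <= 2 * K.
  rewrite /v normrM; apply: (@le_trans _ _ (`|h y - h x| * 1)).
    by rewrite ler_wpM2l// indicE; case: (_ \in _); rewrite ?normr1 ?normr0.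
  rewrite mulr1 (le_trans (ler_normB _ _))//.
  by have := hK x; have := hK y; lra.
have v0 y : `|y - x| < d -> v y = 0.
  by move=> yd; rewrite /v indicE memNset ?mulr0//=; apply; exact: yd.
have pL := L1_pdf x (sn0 n).
have iu : L1 (fun y => normal_pdf x (sn n) y * u y) by exact: L1Mb pL mu1 ue.
have iv : L1 (fun y => normal_pdf x (sn n) y * v y) by exact: L1Mb pL mv vK.
have -> : h x - heat (sn n) h x = - (\int[mu]_y (normal_pdf x (sn n) y * u y)
     + \int[mu]_y (normal_pdf x (sn n) y * v y)).
  rewrite -[X in X - _]mulr1 -(int_pdf x (sn0 n)) -intZ// /heat.
  rewrite -intD// -opprB -intB; [|exact: (L1_heat_kernel x (sn0 n) h1)|exact: L1Z].
  congr (- _); apply: eq_int => y; rewrite /u /v !indicE in_setC.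
  by case: (y \in A) => /=; ring.
rewrite normrN (le_trans (ler_normD _ _))// (splitr e) lerD//.
  apply: le_trans (int_norm iu) _.
  have -> : e / 2 = \int[mu]_y (e / 2 * normal_pdf x (sn n) y).
    by rewrite intZ// (int_pdf x (sn0 n)) mulr1.
  apply: int_le; [exact: L1_norm|exact: L1Z|move=> y].
  by rewrite normrM (ger0_norm (normal_pdf_ge0 _ _ _)) mulrC ler_wpM2r ?normal_pdf_ge0.
apply: le_trans (pdf_tail (sn0 n) (ltW d0) mv vK v0) _.
rewrite -[leLHS]ger0_norm; last by rewrite !mulr_ge0// expR_ge0.
by near: n; move/cvgr0Pnorm_le : tail; apply.
Unshelve. all: by end_near. Qed.

End Heat.

(** * Truncation to a set *)

Section Truncation.
Variable R : realType.
Local Notation mu := (@lebesgue_measure R).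
Implicit Types (f g h : R -> R) (s x y : R).

Definition cut (A : set R) f x := f x * \1_A x.

Lemma norm_cut A f x : `|cut A f x| <= `|f x|.
Proof.
rewrite /cut normrM -[leRHS]mulr1 ler_wpM2l// indicE.
by case: (_ \in _); rewrite ?normr1 ?normr0.
Qed.

Lemma meas_cut A f : measurable A -> measurable_fun setT f -> measurable_fun setT (cut A f).
Proof. by move=> mA mf; apply: measurable_funM => //; exact: measurable_indic. Qed.

Lemma L1_cut A f : measurable A -> L1 f -> L1 (cut A f).
Proof.
move=> mA f1; apply: (@L1_le _ _ (fun x => `|f x|)); last exact: L1_norm.
  by apply: meas_cut => //; exact: L1_meas.
exact: norm_cut.
Qed.

Lemma cut_sqr A f x : cut A f x ^+ 2 = cut A (fun x => f x ^+ 2) x.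
Proof.
by rewrite /cut indicE exprMn; case: (_ \in _); rewrite ?expr1n// expr0n.
Qed.

Lemma sqint_cut A f : measurable A -> sqint f -> sqint (cut A f).
Proof.
move=> mA [mf f2]; split; first exact: meas_cut.
by under eq_fun do rewrite cut_sqr; exact: L1_cut.
Qed.

Lemma nrm_cut A f : measurable A -> sqint f -> nrm (cut A f) <= nrm f.
Proof. by move=> mA Sf; apply: nrm_le => //; [exact: sqint_cut|exact: norm_cut]. Qed.

Lemma cut_cvg (A : nat -> set R) f : sqint f -> (forall m, measurable (A m)) ->
  (forall x, \forall m \near \oo, A m x) ->
  nrm (fun x => f x - cut (A m) f x) @[m --> \oo] --> 0.
Proof.
move=> [mf f2] mA Ax; rewrite -(sqrtr0 R).
apply: (continuous_cvg _ (@sqrt_continuous R 0)).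
have [||||_] := @dominated_cvg _ (fun m x => (f x - cut (A m) f x) ^+ 2) (fun=> 0) (fun x => f x ^+ 2).
- by move=> n; apply: measurable_funX; apply: measurable_funB => //; exact: meas_cut.
- move=> x; apply: cvg_near_cst; near=> m.
  have Am : A m x by near: m; exact: Ax.
  by rewrite /cut indicE mem_set// mulr1 subrr expr0n.
- exact: f2.
- move=> n x; rewrite ger0_norm ?sqr_ge0// /cut indicE.
  by case: (_ \in _); rewrite ?mulr1 ?subrr ?expr0n ?sqr_ge0// mulr0 subr0.
by rewrite Rintegral_cst// mul0r.
Unshelve. all: by end_near. Qed.

Lemma L1_sqint_cut A f : measurable A -> L1 (\1_A : R -> R) -> sqint f -> L1 (cut A f).
Proof.
move=> mA A1 Sf; apply: sqintM => //; split; first exact: measurable_indic.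
rewrite (_ : (fun _ => _) = \1_A)//; apply/funext => x.
by rewrite indicE; case: (_ \in _); rewrite ?expr1n// expr0n.
Qed.

Lemma L1_indic_itv (a c : R) : L1 (\1_(`[a, c]) : R -> R).
Proof. exact: integrable_indic_itv. Qed.

End Truncation.

(** * The heat kernel as an approximate identity *)

Section ApproximateIdentity.
Variable R : realType.
Local Notation mu := (@lebesgue_measure R).
Implicit Types (f g h : R -> R) (s x y : R).

Let sn n : R := n.+1%:R^-1.

Let sn0 n : sn n != 0. Proof. by rewrite invr_eq0 pnatr_eq0. Qed.

Let tri3 (Tg Th fg fh t e : R) : `|Tg - Th| <= t -> `|fg - fh| <= t -> t <= e / 3 ->
  `|fh - Th| <= e / 3 -> `|fg - Tg| <= e.
Proof.
rewrite !ler_norml => /andP[? ?] /andP[? ?] ? /andP[? ?].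
by apply/andP; split; lra.
Qed.

Let tri6 (e F F' G G' a1 a2 a3 b1 b2 b3 : R) : F' * (2 * G) + 2 * F * G' <= e / 2 ->
  `|a1| <= F' * G -> `|a2| <= F * G' -> `|b1| <= F' * G -> `|b2| <= F * G' ->
  `|b3 - a3| <= e / 2 -> `|b1 + (b2 + b3) - (a1 + (a2 + a3))| <= e.
Proof.
rewrite !ler_norml => ? /andP[? ?] /andP[? ?] /andP[? ?] /andP[? ?] /andP[? ?].
by apply/andP; split; lra.
Qed.

(** Density of continuous functions in L^1 of [[-m, m]]. Cutting the approximant to that interval
    makes it bounded and integrable at the price of jumps at the endpoints, where the function [f]
    of [heat_cvg_bounded] vanishes. *)
Let approx_cont g (m d : R) : 0 < m -> 0 < d -> L1 g -> (forall x, m < `|x| -> g x = 0) ->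
  exists h K, [/\ L1 h, forall x, `|h x| <= K,
    forall x, `|x| < m -> {for x, continuous h} & \int[mu]_x `|g x - h x| <= d].
Proof.
move=> m0 d0 g1 gm.
pose E : set R := `[- m, m]%classic.
have mE : measurable E by exact: measurable_itv.
have Eoo : (mu E < +oo)%E.
  by rewrite lebesgue_measure_itv/=; case: ifP => _; rewrite ltry.
have g1E : mu.-integrable E (EFin \o g) by exact: integrableS g1.
have [h_ [ch_ ih_ /fine_cvgP[_ /cvgr0Pnorm_le]]] :=
  approximation_continuous_integrable mE Eoo g1E.
move=> /(_ _ d0) [k _ /(_ k (leqnn k)) /=]; set h0 := h_ k => hd.
have ch0 : continuous h0 by exact: ch_.
have mm : - m <= m by rewrite ge0_cp// ltW.
have cn : {within `[- m, m], continuous (fun x => `|h0 x|)}.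
  apply: continuous_subspaceT => x; apply: continuous_comp; first exact: ch0.
  exact: norm_continuous.
have [c _ hc] := EVT_max mm cn.
exists (cut E h0), `|h0 c|; set h := cut E h0.
have mh : measurable_fun setT h by apply: meas_cut => //; exact: cont_meas.
have hK x : `|h x| <= `|h0 c|.
  rewrite /h /cut indicE; case: (boolP (x \in E)) => [|_]; last by rewrite mulr0 normr0.
  by rewrite inE mulr1 => xE; exact: hc.
split => //.
- have -> : h = fun x => \1_E x * h x.
    apply/funext => x; rewrite /h /cut indicE.
    by case: (_ \in _); rewrite ?mulr1 ?mul1r ?mulr0.
  by apply: (L1Mb (M := `|h0 c|)) => //; exact: L1_indic_itv.
- move=> x xm; have : {for x, continuous h0} by exact: ch0.
  rewrite /prop_for /continuous_at; have -> : h x = h0 x by rewrite /h /cut indicE mem_set ?mulr1// /E/= in_itv/= -ler_norml ltW.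
  apply: cvg_trans; apply: near_eq_cvg; near=> y.
  rewrite /h /cut indicE mem_set ?mulr1// /E/= in_itv/= -ler_norml ltW//.
  by near: y; apply: (@cvgr_norm_lt _ _ _ _ _ id x).
- apply: le_trans (le_trans (ler_norm _) hd); rewrite le_eqVlt; apply/orP; left; apply/eqP.
  rewrite -[RHS]/(\int[mu]_(x in E) `|g x - h0 x|) [RHS]Rintegral_mkcond.
  apply: eq_int => x; rewrite patchE /h /cut indicE.
  case: (boolP (x \in E)) => [_|]; first by rewrite mulr1.
  rewrite notin_setE /E/= in_itv/= -ler_norml => /negP; rewrite -ltNge => xm.
  by rewrite gm// mulr0 subrr normr0.
Unshelve. all: by end_near. Qed.

(** Replacing [g] by the approximant [h] costs at most [K] times the L^1 distance on either side,
    uniformly in [n] by [int_heat_le]; for [h] the convergence is pointwise and dominated. *)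
Let heat_cvg_bounded f g K (m : R) : 0 < m -> L1 f -> (forall x, `|f x| <= K) ->
  (forall x, m <= `|x| -> f x = 0) -> L1 g -> (forall x, m < `|x| -> g x = 0) ->
  \int[mu]_x (f x * heat (sn n) g x) @[n --> \oo] --> \int[mu]_x (f x * g x).
Proof.
move=> m0 f1 fK fm g1 gm; have mf := L1_meas f1; have mg := L1_meas g1.
have K0 : 0 <= K by exact: le_trans (fK 0).
apply/cvgrPdist_le => e e0.
pose d := e / 3 / (K + 1).
have d0 : 0 < d by rewrite !divr_gt0// ltr_wpDl.
have Kd : K * d <= e / 3.
  by rewrite /d mulrA ler_pdivrMr ?ltr_wpDl//; nra.
have [h [K' [h1 hK' hc gh]]] := approx_cont m0 d0 g1 gm.
have mh := L1_meas h1.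
have fh1 : L1 (fun x => f x * h x) by exact: L1Mb f1 mh hK'.
have K'0 : 0 <= K' by exact: le_trans (hK' 0).
have hb n x : `|heat (sn n) h x| <= K'.
  apply: le_trans (heat_norm x (sn0 n) h1) _.
  have -> : K' = \int[mu]_y (K' * normal_pdf x (sn n) y).
    by rewrite intZ ?(int_pdf x (sn0 n)) ?mulr1//; exact: L1_pdf.
  apply: int_le.
  - by apply: L1_heat_kernel => //; exact: L1_norm.
  - by apply: L1Z; exact: L1_pdf.
  - by move=> y; rewrite ler_wpM2r// normal_pdf_ge0.
have mhh n : measurable_fun setT (heat (sn n) h) by apply: L1_meas; have [] := L1_heat (sn0 n) h1.
have [||||_] := @dominated_cvg _ (fun n x => f x * heat (sn n) h x) (fun x => f x * h x) (fun x => K' * `|f x|).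
- by move=> n; exact: measurable_funM.
- move=> x; have [xm|xm] := ltP `|x| m; last first.
    by rewrite fm// mul0r; under eq_fun do rewrite mul0r; exact: cvg_cst.
  by apply: cvgM; [exact: cvg_cst|apply: (heat_cvg_pt h1 hK'); exact: hc].
- exact/L1Z/L1_norm.
- by move=> n x; rewrite normrM mulrC ler_wpM2r.
have e3 : 0 < e / 3 by rewrite divr_gt0.
move/cvgrPdist_le => /(_ _ e3) Hn.
near=> n.
have hn : `|\int[mu]_x (f x * h x) - \int[mu]_x (f x * heat (sn n) h x)| <= e / 3 by near: n.
have gh1 : L1 (fun x => g x - h x) by exact: L1B.
have i1 (u : R -> R) : L1 u -> L1 (fun x => f x * heat (sn n) u x).
  move=> u1; under eq_fun do rewrite mulrC.
  by have [hu _] := L1_heat (sn0 n) u1; exact: L1Mb hu mf fK.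
have fg1 : L1 (fun x => f x * g x) by under eq_fun do rewrite mulrC; exact: L1Mb g1 mf fK.
have t1 := int_heat_le (sn0 n) gh1 mf fK.
have e1 : \int[mu]_x (f x * heat (sn n) (fun x => g x - h x) x) =
    \int[mu]_x (f x * heat (sn n) g x) - \int[mu]_x (f x * heat (sn n) h x).
  rewrite -intB; [|exact: i1|exact: i1].
  by apply: eq_int => x; rewrite (heatB _ (sn0 n) g1 h1) mulrBr.
have t2 : `|\int[mu]_x (f x * g x) - \int[mu]_x (f x * h x)| <= K * \int[mu]_x `|g x - h x|.
  rewrite -intB// (le_trans (int_norm _))//; first exact: L1B.
  rewrite -intZ; last exact: L1_norm.
  apply: int_le; [exact/L1_norm/L1B|exact/L1Z/L1_norm|move=> x].
  by rewrite -mulrBr normrM ler_wpM2r.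
have t3 : K * \int[mu]_x `|g x - h x| <= e / 3.
  by apply: le_trans Kd; rewrite ler_wpM2l.
rewrite e1 in t1.
exact: tri3 t1 t2 t3 hn.
Unshelve. all: by end_near. Qed.

(** Truncation reduces to [heat_cvg_bounded]; the L^2 contraction of [heat] makes the truncation
    errors uniform in [n]. *)
Lemma heat_approx_id f g : L1 f -> sqint f -> L1 g -> sqint g ->
  \int[mu]_x (f x * heat (sn n) g x) @[n --> \oo] --> \int[mu]_x (f x * g x).
Proof.
move=> f1 Sf g1 Sg; have mf := L1_meas f1; have mg := L1_meas g1.
(* The truncated [f] becomes bounded as well as compactly supported. The inequality on [|x|] is
   strict because [heat_cvg_bounded] wants it to vanish at [|x| = m+1] too. *)
pose A m : set R := [set x | `|x| < m.+1%:R] `&` [set x | `|f x| <= m.+1%:R].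
pose D m : set R := [set x | `|x| <= m.+1%:R].
have mabs : measurable_fun setT (fun x : R => `|x|) by apply: cont_meas; exact: norm_continuous.
have mA m : measurable (A m).
  apply: measurableI.
    rewrite -[X in measurable X]setTI; exact: (measurable_fun_ltr (f := fun x : R => `|x|)).
  rewrite -[X in measurable X]setTI; apply: (measurable_fun_ler (f := fun x : R => `|f x|)) => //.
  exact: (measurableT_comp mabs mf).
have mD m : measurable (D m).
  rewrite -[X in measurable X]setTI; exact: (measurable_fun_ler (f := fun x : R => `|x|)).
have nat_ge (y : R) : \forall m \near \oo, y < m.+1%:R.
  near=> m; apply: (@lt_le_trans _ _ m.+1%:R) => //.
  near: m; have := @nbhs_infty_gtr R y; move=> [N _ hN]; exists N => // k Nk /=.
  by apply: hN => /=; rewrite (leq_trans Nk).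
have cf : nrm (fun x => f x - cut (A m) f x) @[m --> \oo] --> 0.
  apply: cut_cvg => // x; near=> m; split => /=; last apply: ltW; near: m; exact: nat_ge.
have cg : nrm (fun x => g x - cut (D m) g x) @[m --> \oo] --> 0.
  apply: cut_cvg => // x; near=> m => /=; apply: ltW; near: m; exact: nat_ge.
apply/cvgrPdist_le => e e0.
have tot : nrm (fun x => f x - cut (A m) f x) * (2 * nrm g) +
    (2 * nrm f) * nrm (fun x => g x - cut (D m) g x) @[m --> \oo] --> 0.
  rewrite -[X in _ --> X]addr0; apply: cvgD.
    by rewrite -(mul0r (2 * nrm g)); apply: cvgM => //; exact: cvg_cst.
  by rewrite -(mulr0 (2 * nrm f)); apply: cvgM => //; exact: cvg_cst.
have e2 : 0 < e / 2 by rewrite divr_gt0.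
move/cvgr0Pnorm_le : tot => /(_ _ e2) [m _ /(_ m (leqnn m)) /= hm].
set fm := cut (A m) f in hm; set gm := cut (D m) g in hm.
have fm1 : L1 fm by exact: L1_cut.
have gm1 : L1 gm by exact: L1_cut.
have Sfm : sqint fm by exact: sqint_cut.
have Sgm : sqint gm by exact: sqint_cut.
have lim_fg : \int[mu]_x (fm x * heat (sn n) gm x) @[n --> \oo] --> \int[mu]_x (fm x * gm x).
  apply: (@heat_cvg_bounded fm gm m.+1%:R m.+1%:R) => //.
  - move=> x; rewrite /fm /cut indicE; case: (boolP (x \in A m)) => [|_].
      by rewrite inE => -[_ /=]; rewrite mulr1.
    by rewrite mulr0 normr0.
  - move=> x xm; rewrite /fm /cut indicE memNset ?mulr0// => -[/=].
    by rewrite ltNge xm.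
  - move=> x xm; rewrite /gm /cut indicE memNset ?mulr0// /D/=.
    by apply/negP; rewrite -ltNge.
move/cvgrPdist_le : lim_fg => /(_ _ e2) Hn; near=> n.
have hn : `|\int[mu]_x (fm x * gm x) - \int[mu]_x (fm x * heat (sn n) gm x)| <= e / 2 by near: n.
have Sf' : sqint (fun x => f x - fm x) by exact: sqintB.
have Sg' : sqint (fun x => g x - gm x) by exact: sqintB.
have g1' : L1 (fun x => g x - gm x) by exact: L1B.
have [SH nH] := heat_contract (sn0 n) g1 Sg.
have [SH' nH'] := heat_contract (sn0 n) g1' Sg'.
have [SHm _] := heat_contract (sn0 n) gm1 Sgm.
have nfm : nrm fm <= nrm f by exact: nrm_cut.
have c1 := cauchy_schwarz Sf' SH; have c2 := cauchy_schwarz Sfm SH'.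
have c3 := cauchy_schwarz Sf' Sg; have c4 := cauchy_schwarz Sfm Sg'.
have E1 : \int[mu]_x (f x * heat (sn n) g x) =
    \int[mu]_x ((f x - fm x) * heat (sn n) g x)
  + (\int[mu]_x (fm x * heat (sn n) (fun x => g x - gm x) x)
  + \int[mu]_x (fm x * heat (sn n) gm x)).
  rewrite -intD; [|exact: sqintM|exact: sqintM].
  rewrite -intD; [|exact: sqintM|by apply: L1D; exact: sqintM].
  by apply: eq_int => x; rewrite (heatB _ (sn0 n) g1 gm1); ring.
have E2 : \int[mu]_x (f x * g x) = \int[mu]_x ((f x - fm x) * g x)
  + (\int[mu]_x (fm x * (g x - gm x)) + \int[mu]_x (fm x * gm x)).
  rewrite -intD; [|exact: sqintM|exact: sqintM].
  rewrite -intD; [|exact: sqintM|by apply: L1D; exact: sqintM].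
  by apply: eq_int => x; ring.
rewrite E1 E2.
have F1 := nrm_ge0 (fun x => f x - fm x); have F2 := nrm_ge0 (fun x => g x - gm x).
have F3 := nrm_ge0 f; have F4 := nrm_ge0 fm; have F5 := nrm_ge0 g.
have D1 := le_trans c1 (ler_wpM2l F1 nH).
have D2 := le_trans c2 (ler_pM F4 (nrm_ge0 _) nfm nH').
have D4 := le_trans c4 (ler_wpM2r F2 nfm).
have hm' := le_trans (ler_norm _) hm.
exact: tri6 hm' D1 D2 c3 D4 hn.
Unshelve. all: by end_near. Qed.

End ApproximateIdentity.

(** * The Fourier transform *)

Section Plancherel.
Variable R : realType.
Local Notation mu := (@lebesgue_measure R).
Implicit Types (f g h : R -> R) (s x y k : R).

(** For real [f], the Fourier transform is [ftc f - i fts f] divided by [sqrt (2 pi)]. *)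
Definition ftc f k := \int[mu]_x (f x * cos (k * x)).
Definition fts f k := \int[mu]_x (f x * sin (k * x)).

Lemma L1c f k : L1 f -> L1 (fun x => f x * cos (k * x)).
Proof.
move=> f1; apply: (L1Mb (M := 1)) => //; first by apply: cont_meas; exact: cont_cosk.
by move=> x; exact: norm_cos.
Qed.

Lemma L1s f k : L1 f -> L1 (fun x => f x * sin (k * x)).
Proof.
move=> f1; apply: (L1Mb (M := 1)) => //; first by apply: cont_meas; exact: cont_sink.
by move=> x; exact: norm_sin.
Qed.

Lemma ftc_bound f k : L1 f -> `|ftc f k| <= \int[mu]_x `|f x|.
Proof.
move=> f1; apply: le_trans (int_norm (L1c k f1)) _.
apply: int_le; [exact/L1_norm/L1c|exact: L1_norm|move=> x].
by rewrite normrM -[leRHS]mulr1 ler_wpM2l// norm_cos.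
Qed.

Lemma fts_bound f k : L1 f -> `|fts f k| <= \int[mu]_x `|f x|.
Proof.
move=> f1; apply: le_trans (int_norm (L1s k f1)) _.
apply: int_le; [exact/L1_norm/L1s|exact: L1_norm|move=> x].
by rewrite normrM -[leRHS]mulr1 ler_wpM2l// norm_sin.
Qed.

Let cont_param (F : R -> R -> R) f : L1 f -> (forall k, L1 (F k)) ->
  (forall k x, `|F k x| <= `|f x|) -> (forall x, continuous (F ^~ x)) ->
  continuous (fun k => \int[mu]_x F k x).
Proof.
move=> f1 F1 Ff cF k.
have kI : k \in (`]k - 1, k + 1[%classic : set R).
  by rewrite inE/= in_itv/= ltrBlDr ltrDl ltr01.
apply: (@continuity_under_integral _ _ _ mu F setT measurableT (k - 1) (k + 1) _ _ (fun x => `|f x|) _ _ _ kI).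
- by move=> x _; exact: F1.
- by apply: aeW => x _ y _; exact: cF.
- exact: L1_norm.
- by move=> y _; apply: aeW => x _; exact: Ff.
Qed.

Lemma cont_ftc f : L1 f -> continuous (ftc f).
Proof.
move=> f1; apply: (cont_param f1) => [k|k x|x k].
- exact: L1c.
- by rewrite normrM -[leRHS]mulr1 ler_wpM2l// norm_cos.
- apply: cvgM; first exact: cvg_cst.
  by under eq_fun do rewrite mulrC; rewrite mulrC; exact: cont_cosk.
Qed.

Lemma cont_fts f : L1 f -> continuous (fts f).
Proof.
move=> f1; apply: (cont_param f1) => [k|k x|x k].
- exact: L1s.
- by rewrite normrM -[leRHS]mulr1 ler_wpM2l// norm_sin.
- apply: cvgM; first exact: cvg_cst.
  by under eq_fun do rewrite mulrC; rewrite mulrC; exact: cont_sink.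
Qed.

(** The Fourier multiplier [exp(-s^2 k^2/2)] of [heat s], used as a convergence factor in
    frequency. *)
Definition gk s k := gw (s ^+ 2 / 2) 0 k.

Let s20 s : s != 0 -> 0 < s ^+ 2 / 2.
Proof. by move=> s0; rewrite divr_gt0// lt_neqAle eq_sym sqrf_eq0 s0 sqr_ge0. Qed.

Lemma L1_gk s : s != 0 -> L1 (gk s).
Proof. by move=> s0; apply: L1_gw; exact: s20. Qed.

Lemma int_gk_cos s t : s != 0 ->
  \int[mu]_k (gk s k * cos (t * k)) = 2 * pi * (normal_peak s * expR (- t ^+ 2 / (s ^+ 2 *+ 2))).
Proof.
move=> s0; transitivity (Jc (s ^+ 2 / 2) 0 t 1).
  by apply: eq_int => k; rewrite hornerC mul1r.
rewrite (Jc_centered (s20 s0)) [RHS]mulrA; congr (_ * expR _); last first.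
  by rewrite -mulr_natr; field.
have sp : 0 < s ^+ 2 * pi *+ 2.
  by rewrite pmulrn_lgt0// mulr_gt0 ?pi_gt0// lt_neqAle eq_sym sqrf_eq0 s0 sqr_ge0.
have p0 := @pi_gt0 R.
rewrite /normal_peak -[LHS]mulr1 -[RHS]mulr1 -[X in _ * X](divff (lt0r_neq0 (_ : 0 < Num.sqrt (s ^+ 2 * pi *+ 2)))) ?sqrtr_gt0//.
rewrite mulrA -sqrtrM; last by rewrite divr_ge0 ?pi_ge0// ltW// s20.
rewrite (_ : pi / _ * _ = (2 * pi) ^+ 2); last by rewrite -mulr_natr; field.
by rewrite sqrtr_sqr gtr0_norm ?mulr_gt0// mulr1.
Qed.

Lemma int_gk_sin s t : s != 0 -> \int[mu]_k (gk s k * sin (t * k)) = 0.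
Proof.
move=> s0; rewrite -(Js_centered (s20 s0) t).
by apply: eq_int => k; rewrite hornerC mul1r.
Qed.

Let meas_lin2 (a c : R) : measurable_fun setT (fun z : R * R => (a - c * z.2) * z.1).
Proof.
apply: measurable_funM => //; apply: measurable_funB => //.
by apply: measurable_funM => //.
Qed.

Let meas_sin : measurable_fun setT (@sin R).
Proof. by apply: cont_meas; exact: continuous_sin. Qed.

Let meas_cos : measurable_fun setT (@cos R).
Proof. by apply: cont_meas; exact: continuous_cos. Qed.

Let ftcB g x k : L1 g ->
  \int[mu]_y (g y * cos ((x - y) * k)) = cos (x * k) * ftc g k + sin (x * k) * fts g k.
Proof.
move=> g1; rewrite /ftc /fts -intZ; last exact: L1c.
rewrite -intZ; last exact: L1s.
rewrite -intD; [|exact/L1Z/L1c|exact/L1Z/L1s].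
by apply: eq_int => y; rewrite mulrBl (mulrC y) cosB; ring.
Qed.

Let ftsB g x k : L1 g ->
  \int[mu]_y (g y * sin ((x - y) * k)) = sin (x * k) * ftc g k - cos (x * k) * fts g k.
Proof.
move=> g1; rewrite /ftc /fts -intZ; last exact: L1c.
rewrite -intZ; last exact: L1s.
rewrite -intB; [|exact/L1Z/L1c|exact/L1Z/L1s].
by apply: eq_int => y; rewrite mulrBl (mulrC y) sinB; ring.
Qed.

(** Fourier inversion for the smoothed function: the factor [gk s] legitimates Fubini, and its
    cosine transform is [2 pi] times the heat kernel. [heatE0] is the matching sine identity. *)
Lemma heatE s g x : s != 0 -> L1 g ->
  2 * pi * heat s g x = \int[mu]_k (gk s k * (cos (x * k) * ftc g k + sin (x * k) * fts g k)).
Proof.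
move=> s0 g1; under [RHS]eq_int do rewrite -(ftcB x _ g1).
rewrite (@fubini_bounded _ (gk s) g (fun z => cos ((x - z.2) * z.1)) 1)//.
- rewrite /heat -intZ; last exact: L1_heat_kernel.
  apply: eq_int => y; rewrite /= int_gk_cos// (pdfE _ _ s0) -[in LHS]sqrrN opprB; ring.
- exact: L1_gk.
- apply: measurableT_comp => //; have := meas_lin2 x 1.
  by under eq_fun do rewrite mul1r.
- by move=> z; exact: norm_cos.
Qed.

Lemma heatE0 s g x : s != 0 -> L1 g ->
  \int[mu]_k (gk s k * (sin (x * k) * ftc g k - cos (x * k) * fts g k)) = 0.
Proof.
move=> s0 g1; under eq_int do rewrite -(ftsB x _ g1).
rewrite (@fubini_bounded _ (gk s) g (fun z => sin ((x - z.2) * z.1)) 1)//.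
- rewrite (@eq_int _ _ (cst 0)) ?Rintegral_cst ?mul0r// => y.
  by rewrite /= int_gk_sin// mulr0.
- exact: L1_gk.
- apply: measurableT_comp => //; have := meas_lin2 x 1.
  by under eq_fun do rewrite mul1r.
- by move=> z; exact: norm_sin.
Qed.

Let meas_snd (u : R -> R) : continuous u -> measurable_fun setT (fun z : R * R => u z.2).
Proof. by move=> cu; apply: measurableT_comp => //; exact: cont_meas. Qed.

Let meas_cos21 : measurable_fun setT (fun z : R * R => cos (z.1 * z.2)).
Proof. by apply: measurableT_comp => //; apply: measurable_funM. Qed.

Let meas_sin21 : measurable_fun setT (fun z : R * R => sin (z.1 * z.2)).
Proof. by apply: measurableT_comp => //; apply: measurable_funM. Qed.

Let trig_bound (c d a b M : R) : `|c| <= 1 -> `|d| <= 1 -> `|a| <= M -> `|b| <= M ->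
  `|c * a + d * b| <= 2 * M /\ `|c * a - d * b| <= 2 * M.
Proof.
move=> c1 d1 aM bM.
have h1 : `|c * a| <= M by rewrite normrM -[M]mul1r ler_pM.
have h2 : `|d * b| <= M by rewrite normrM -[M]mul1r ler_pM.
split; first by rewrite (le_trans (ler_normD _ _))// mulr_natl mulr2n lerD.
by rewrite (le_trans (ler_normB _ _))// mulr_natl mulr2n lerD.
Qed.

(** Plancherel with the convergence factor, by inserting [heatE] and exchanging integrals.
    [heat_plancherel0] is the imaginary part of the same pairing, up to sign. *)
Lemma heat_plancherel s f g : s != 0 -> L1 f -> L1 g ->
  \int[mu]_k (gk s k * (ftc f k * ftc g k + fts f k * fts g k)) =
  2 * pi * \int[mu]_x (f x * heat s g x).
Proof.
move=> s0 f1 g1; have [h1 _] := L1_heat s0 g1.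
have fh1 : L1 (fun x => f x * heat s g x).
  apply: (L1Mb (M := normal_peak s * \int[mu]_y `|g y|)) => //; first exact: L1_meas.
  by move=> x; exact: heat_bound.
rewrite -intZ//.
under [RHS]eq_int do rewrite mulrCA heatE//.
rewrite (@fubini_bounded _ f (gk s) (fun z => cos (z.1 * z.2) * ftc g z.2 + sin (z.1 * z.2) * fts g z.2)
   (2 * \int[mu]_x `|g x|))//.
- apply: eq_int => k; congr (_ * _).
  have -> : ftc f k * ftc g k + fts f k * fts g k = ftc g k * ftc f k + fts g k * fts f k by ring.
  rewrite {2}/ftc {2}/fts -intZ; last exact: L1c.
  rewrite -intZ; last exact: L1s.
  rewrite -intD; [|exact/L1Z/L1c|exact/L1Z/L1s].
  by apply: eq_int => x; rewrite (mulrC k); ring.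
- exact: L1_gk.
- by apply: measurable_funD; apply: measurable_funM => //; apply: meas_snd;
    [exact: cont_ftc|exact: cont_fts].
- by move=> z; apply: (trig_bound _ _ _ _).1; [exact: norm_cos|exact: norm_sin|exact: ftc_bound|exact: fts_bound].
Qed.

Lemma heat_plancherel0 s f g : s != 0 -> L1 f -> L1 g ->
  \int[mu]_k (gk s k * (fts f k * ftc g k - ftc f k * fts g k)) = 0.
Proof.
move=> s0 f1 g1.
have -> : 0 = \int[mu]_x (f x * \int[mu]_k (gk s k * (sin (x * k) * ftc g k - cos (x * k) * fts g k))).
  by rewrite (@eq_int _ _ (cst 0)) ?Rintegral_cst ?mul0r// => x; rewrite heatE0// mulr0.
rewrite (@fubini_bounded _ f (gk s) (fun z => sin (z.1 * z.2) * ftc g z.2 - cos (z.1 * z.2) * fts g z.2)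
   (2 * \int[mu]_x `|g x|))//.
- apply: eq_int => k; congr (_ * _).
  have -> : fts f k * ftc g k - ftc f k * fts g k = ftc g k * fts f k - fts g k * ftc f k by ring.
  rewrite {2}/ftc {1}/fts -intZ; last exact: L1s.
  rewrite -intZ; last exact: L1c.
  rewrite -intB; [|exact/L1Z/L1s|exact/L1Z/L1c].
  by apply: eq_int => x; rewrite (mulrC k); ring.
- exact: L1_gk.
- by apply: measurable_funB; apply: measurable_funM => //; apply: meas_snd;
    [exact: cont_ftc|exact: cont_fts].
- by move=> z; apply: (trig_bound _ _ _ _).2; [exact: norm_sin|exact: norm_cos|exact: ftc_bound|exact: fts_bound].
Qed.

Let sn n : R := n.+1%:R^-1.

Let sn0 n : sn n != 0. Proof. by rewrite invr_eq0 pnatr_eq0. Qed.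

Let gk_le1 n k : `|gk (sn n) k| <= 1.
Proof.
rewrite ger0_norm ?gw_ge0// /gk /gw mul0r addr0 -expR0 ler_expR oppr_le0.
by rewrite mulr_ge0 ?sqr_ge0// divr_ge0// sqr_ge0.
Qed.

Let cont_gk s : continuous (gk s).
Proof. by move=> k; exact: der_cont (der_gw _ _ _). Qed.

Let gk_cvg k : gk (sn n) k @[n --> \oo] --> (1 : R).
Proof.
have h0 : sn n * sn n @[n --> \oo] --> (0 * 0 : R) by apply: cvgM; exact: cvg_harmonic.
have h1 : - (sn n ^+ 2 / 2 * k ^+ 2) + 0 * k @[n --> \oo] --> - (0 * 0 / 2 * k ^+ 2) + 0 * k.
  apply: cvgD; last exact: cvg_cst.
  by apply: cvgN; do 2 (apply: cvgM; last exact: cvg_cst); exact: h0.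
have E : expR (- (0 * 0 / 2 * k ^+ 2) + 0 * k) = 1.
  by rewrite !mul0r oppr0 addr0 expR0.
by rewrite -E; exact: (continuous_cvg _ (@continuous_expR R _) h1).
Qed.

Lemma int_gk_cvg F : L1 F -> \int[mu]_k (gk (sn n) k * F k) @[n --> \oo] --> \int[mu]_k F k.
Proof.
move=> F1.
have [||||_] := @dominated_cvg _ (fun n k => gk (sn n) k * F k) F (fun k => `|F k|) => //.
- move=> n; apply: measurable_funM; last exact: L1_meas.
  by apply: cont_meas; exact: cont_gk.
- by move=> k; rewrite -[X in _ --> X]mul1r; apply: cvgM; [exact: gk_cvg|exact: cvg_cst].
- exact: L1_norm.
- by move=> n k; rewrite normrM -[leRHS]mul1r ler_wpM2r.
Qed.

(** [gk (sn n)] increases to one, so monotone convergence passes to the limit in the bound given by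
    [heat_contract]. The inequality comes first because it supplies the square-integrability of
    [ftc g] and [fts g] that the dominated limit in [plancherel] requires. *)
Lemma plancherel_le g : L1 g -> sqint g ->
  [/\ sqint (ftc g), sqint (fts g) & nrm2 (ftc g) + nrm2 (fts g) <= 2 * pi * nrm2 g].
Proof.
move=> g1 Sg; have p0 := @pi_gt0 R.
have mc : measurable_fun setT (ftc g) by apply: cont_meas; exact: cont_ftc.
have ms : measurable_fun setT (fts g) by apply: cont_meas; exact: cont_fts.
pose F k := ftc g k * ftc g k + fts g k * fts g k.
have F0 k : 0 <= F k by rewrite addr_ge0// -expr2 sqr_ge0.
have mF : measurable_fun setT F by apply: measurable_funD; apply: measurable_funM.
have Fn n : L1 (fun k => gk (sn n) k * F k).
  have h k := ftc_bound k g1; have h' k := fts_bound k g1.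
  pose M := \int[mu]_x `|g x|.
  apply: (L1Mb (M := M * M + M * M)) => //; first exact: (L1_gk (sn0 n)).
  move=> k; rewrite ger0_norm// /F.
  by apply: lerD; rewrite -expr2 -[leLHS]real_normK ?num_real// expr2 ler_pM ?h ?h'.
have bound n : \int[mu]_k (gk (sn n) k * F k) <= 2 * pi * nrm2 g.
  rewrite [leLHS](heat_plancherel (sn0 n) g1 g1) ler_wpM2l//; first by rewrite mulr_ge0// ltW.
  have [Sh hn] := heat_contract (sn0 n) g1 Sg.
  apply: le_trans (ler_norm _) (le_trans (cauchy_schwarz Sg Sh) _).
  by rewrite -nrm_sqr expr2 ler_wpM2l// nrm_ge0.
have Foo : (\int[mu]_k (F k)%:E <= (2 * pi * nrm2 g)%:E)%E.
  have cv : (\int[mu]_k (gk (sn n) k * F k)%:E)%E @[n --> \oo] --> (\int[mu]_k (F k)%:E)%E.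
    rewrite [X in _ --> X](_ : _ = (\int[mu]_k limn (fun n => (gk (sn n) k * F k)%:E))%E); last first.
      apply: eq_integral => k _; apply/esym/cvg_lim => //.
      apply: cvg_EFin; first exact: nearW.
      by rewrite -[X in _ --> X]mul1r; apply: cvgM; [exact: gk_cvg|exact: cvg_cst].
    apply: (@cvg_monotone_convergence _ _ _ mu setT measurableT (fun n k => (gk (sn n) k * F k)%:E)).
    - by move=> n; apply/measurable_EFinP; exact: L1_meas.
    - by move=> n k _; rewrite lee_fin mulr_ge0// gw_ge0.
    - move=> k _ m n mn; rewrite lee_fin ler_wpM2r// ler_expR !mul0r !addr0 lerN2.
      rewrite ler_wpM2r ?sqr_ge0// ler_pM2r// lerXn2r// ?nnegrE ?invr_ge0//.
      by rewrite lef_pV2 ?posrE ?ltr0n// ler_nat.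
  rewrite -(cvg_lim _ cv)//; apply: lime_le; first by apply/cvg_ex; eexists; exact: cv.
  by apply: nearW => n; rewrite L1_EFin// lee_fin.
have F1 : L1 F by apply: L1_ge0_lty => //; exact: le_lt_trans Foo (ltry _).
have Sc : sqint (ftc g).
  split => //; apply: L1_le F1; first exact: measurable_funX.
  by move=> k; rewrite ger0_norm ?sqr_ge0// /F -!expr2 lerDl sqr_ge0.
have Ss : sqint (fts g).
  split => //; apply: L1_le F1; first exact: measurable_funX.
  by move=> k; rewrite ger0_norm ?sqr_ge0// /F -!expr2 lerDr sqr_ge0.
split => //; rewrite /nrm2 -intD; [|by case: Sc|by case: Ss].
by move: Foo; rewrite L1_EFin// lee_fin.
Qed.

Lemma plancherel f g : L1 f -> sqint f -> L1 g -> sqint g ->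
  \int[mu]_k (ftc f k * ftc g k + fts f k * fts g k) = 2 * pi * \int[mu]_x (f x * g x).
Proof.
move=> f1 Sf g1 Sg.
have [Sfc Sfs _] := plancherel_le f1 Sf; have [Sgc Sgs _] := plancherel_le g1 Sg.
have := @int_gk_cvg (fun k => ftc f k * ftc g k + fts f k * fts g k)
  (L1D (sqintM Sfc Sgc) (sqintM Sfs Sgs)).
under eq_fun do rewrite (heat_plancherel (sn0 _) f1 g1).
move=> /(cvg_lim (@Rhausdorff _)) <-.
apply/cvg_lim => //; apply: cvgM; first exact: cvg_cst.
exact: heat_approx_id.
Qed.

Lemma plancherel0 f g : L1 f -> sqint f -> L1 g -> sqint g ->
  \int[mu]_k (fts f k * ftc g k - ftc f k * fts g k) = 0.
Proof.
move=> f1 Sf g1 Sg.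
have [Sfc Sfs _] := plancherel_le f1 Sf; have [Sgc Sgs _] := plancherel_le g1 Sg.
have := @int_gk_cvg (fun k => fts f k * ftc g k - ftc f k * fts g k)
  (L1B (sqintM Sfs Sgc) (sqintM Sfc Sgs)).
under eq_fun do rewrite (heat_plancherel0 (sn0 _) f1 g1).
by move=> /(cvg_lim (@Rhausdorff _)) <-; apply/cvg_lim => //; exact: cvg_cst.
Qed.

End Plancherel.

(** * Complex functions and Parseval's formula for the L^2 Fourier transform *)

Section ComplexL2.
Variable R : realType.
Local Notation mu := (@lebesgue_measure R).
Implicit Types (f g : R -> R) (u w Fu : R -> R[i]) (A : set R).

Definition re u x : R := complex.Re (u x).
Definition im u x : R := complex.Im (u x).

Lemma csqE u x : csq (u x) = re u x ^+ 2 + im u x ^+ 2.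
Proof. by []. Qed.

Lemma L2_sqint u : L2 u -> sqint (re u) /\ sqint (im u).
Proof.
move=> [mre [mim foo]].
have mc : measurable_fun setT (fun x => csq (u x)).
  by apply: measurable_funD; apply: measurable_funX.
have c1 : L1 (fun x => csq (u x)).
  by apply: L1_ge0_lty => // x; rewrite csqE addr_ge0 ?sqr_ge0.
split; split => //; apply: L1_le c1; try exact: measurable_funX.
- by move=> x; rewrite ger0_norm ?sqr_ge0// csqE lerDl sqr_ge0.
- by move=> x; rewrite ger0_norm ?sqr_ge0// csqE lerDr sqr_ge0.
Qed.

Lemma l2norm_onE A w : measurable A -> L2 w ->
  l2norm_on A w = Num.sqrt (nrm2 (cut A (re w)) + nrm2 (cut A (im w))).
Proof.
move=> mA /L2_sqint[S1 S2]; congr Num.sqrt.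
rewrite -[LHS]/(\int[mu]_(x in A) csq (w x)) Rintegral_mkcond.
have [_ i1] := sqint_cut mA S1; have [_ i2] := sqint_cut mA S2.
rewrite /nrm2 -intD//; apply: eq_int => x.
rewrite patchE /cut indicE; case: ifPn => _; first by rewrite !mulr1 csqE.
by rewrite !mulr0 expr0n addr0.
Qed.

Lemma cut_setT f : cut setT f = f.
Proof. by apply/funext => x; rewrite /cut indicT mulr1. Qed.

Lemma l2norm_ge0 A w : 0 <= l2norm_on A w.
Proof. exact: sqrtr_ge0. Qed.

Lemma nrm_re_on A w : measurable A -> L2 w -> nrm (cut A (re w)) <= l2norm_on A w.
Proof. by move=> mA Lw; rewrite l2norm_onE// ler_wsqrtr// lerDl nrm2_ge0. Qed.

Lemma nrm_im_on A w : measurable A -> L2 w -> nrm (cut A (im w)) <= l2norm_on A w.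
Proof. by move=> mA Lw; rewrite l2norm_onE// ler_wsqrtr// lerDr nrm2_ge0. Qed.

Lemma nrm_re w : L2 w -> nrm (re w) <= l2norm w.
Proof. by move=> Lw; have := nrm_re_on measurableT Lw; rewrite cut_setT. Qed.

Lemma nrm_im w : L2 w -> nrm (im w) <= l2norm w.
Proof. by move=> Lw; have := nrm_im_on measurableT Lw; rewrite cut_setT. Qed.

Lemma l2norm_le w : L2 w -> l2norm w <= nrm (re w) + nrm (im w).
Proof.
move=> Lw; rewrite /l2norm l2norm_onE// !cut_setT.
have h1 := nrm_ge0 (re w); have h2 := nrm_ge0 (im w).
rewrite -(@ler_pXn2r _ 2)// ?nnegrE ?addr_ge0 ?sqrtr_ge0//.
rewrite sqr_sqrtr ?addr_ge0 ?nrm2_ge0// -!nrm_sqr sqrrD.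
by rewrite lerD2r lerDl mulrn_wge0// mulr_ge0.
Qed.

Lemma ip_cvg (f_ : nat -> R -> R) f g : (forall n, sqint (f_ n)) -> sqint f -> sqint g ->
  nrm (fun x => f x - f_ n x) @[n --> \oo] --> 0 ->
  \int[mu]_x (f_ n x * g x) @[n --> \oo] --> \int[mu]_x (f x * g x).
Proof.
move=> Sn Sf Sg cf; apply/subr_cvg0.
have cz : nrm (fun x => f x - f_ n x) * nrm g @[n --> \oo] --> 0.
  by rewrite -(mul0r (nrm g)); apply: cvgM => //; exact: cvg_cst.
apply: norm_cvg0; apply: (@squeeze_cvgr _ _ _ _ (fun=> 0) _ _ _ _ _ cz); last exact: cvg_cst.
apply: nearW => n; rewrite normr_ge0/= distrC.
rewrite -intB; [|exact: sqintM|exact: sqintM].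
under eq_int do rewrite -mulrBl.
by apply: cauchy_schwarz => //; exact: sqintB.
Qed.

Definition ball0 (n : nat) : set R := `[- n%:R, n%:R]%classic.

Lemma meas_ball0 n : measurable (ball0 n).
Proof. exact: measurable_itv. Qed.

Lemma ball0_near (x : R) : \forall n \near \oo, ball0 n x.
Proof.
near=> n; rewrite /ball0/= in_itv/= -ler_norml.
by near: n; exact: nbhs_infty_ger.
Unshelve. all: by end_near. Qed.

Definition nf : R := (Num.sqrt (2 * pi))^-1.

Lemma nf_gt0 : 0 < nf.
Proof. by rewrite invr_gt0 sqrtr_gt0 mulr_gt0 ?pi_gt0. Qed.

Lemma nf_le1 : nf <= 1.
Proof.
rewrite invf_le1 ?sqrtr_gt0 ?mulr_gt0 ?pi_gt0//.
apply: (@le_trans _ _ (Num.sqrt 1)); first by rewrite sqrtr1.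
rewrite ler_wsqrtr//; apply: (@le_trans _ _ 2); first by rewrite ler1n.
by rewrite ler_peMr//; apply: le_trans (pi_ge2 R); rewrite ler1n.
Qed.

Lemma nf_sqr : nf * (2 * pi) = nf^-1.
Proof.
rewrite /nf invrK -{2}(@sqr_sqrtr _ (2 * pi)) ?mulr_ge0 ?pi_ge0// expr2 mulKf//.
by rewrite gt_eqF// sqrtr_gt0 mulr_gt0 ?pi_gt0.
Qed.

Section Fourier.
Variables (u Fu : R -> R[i]).
Hypotheses (Lu : L2 u) (Fou : is_fourier u Fu).

Let u1 n := cut (ball0 n) (re u).
Let u2 n := cut (ball0 n) (im u).

Let Su1 : sqint (re u). Proof. by have [] := L2_sqint Lu. Qed.
Let Su2 : sqint (im u). Proof. by have [] := L2_sqint Lu. Qed.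
Let LFu : L2 Fu. Proof. by have [] := Fou. Qed.
Let SFu1 : sqint (re Fu). Proof. by have [] := L2_sqint LFu. Qed.
Let SFu2 : sqint (im Fu). Proof. by have [] := L2_sqint LFu. Qed.

Let Sc f n : sqint f -> sqint (cut (ball0 n) f).
Proof. by move=> Sf; apply: sqint_cut => //; exact: meas_ball0. Qed.

Let Lc f n : sqint f -> L1 (cut (ball0 n) f).
Proof. by move=> Sf; apply: L1_sqint_cut => //; [exact: meas_ball0|exact: L1_indic_itv]. Qed.

(** [A n] and [B n] are the real and imaginary parts of the Fourier integral of [u] over [[-n, n]],
    as [ft_re] and [ft_im] verify. *)
Let A n k := nf * (ftc (u1 n) k + fts (u2 n) k).
Let B n k := nf * (ftc (u2 n) k - fts (u1 n) k).

Let ft_re n k : complex.Re (fourier_trunc n%:R u k) = A n k.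
Proof.
rewrite /fourier_trunc /= mul0r subr0; congr (_ * _).
rewrite Rintegral_mkcond /ftc /fts -intD; last 2 first.
- by apply: L1c; exact: Lc.
- by apply: L1s; exact: Lc.
apply: eq_int => x; rewrite patchE /u1 /u2 /cut indicE /ball0.
case: ifPn => _; last by rewrite !mulr0 !mul0r addr0.
rewrite !mulr1 /re /im; case: (u x) => a c /=.
by rewrite cosN sinN mulrN opprK.
Qed.

Let ft_im n k : complex.Im (fourier_trunc n%:R u k) = B n k.
Proof.
rewrite /fourier_trunc /= mul0r addr0; congr (_ * _).
rewrite Rintegral_mkcond /ftc /fts -intB; last 2 first.
- by apply: L1c; exact: Lc.
- by apply: L1s; exact: Lc.
apply: eq_int => x; rewrite patchE /u1 /u2 /cut indicE /ball0.
case: ifPn => _; last by rewrite !mulr0 !mul0r subr0.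
rewrite !mulr1 /re /im; case: (u x) => a c /=.
by rewrite cosN sinN mulrN addrC.
Qed.

Let SA n : sqint (A n).
Proof.
have [h1 _ _] := plancherel_le (Lc n Su1) (Sc n Su1).
have [_ h2 _] := plancherel_le (Lc n Su2) (Sc n Su2).
by apply: sqintZ; exact: sqintD.
Qed.

Let SB n : sqint (B n).
Proof.
have [_ h1 _] := plancherel_le (Lc n Su1) (Sc n Su1).
have [h2 _ _] := plancherel_le (Lc n Su2) (Sc n Su2).
by apply: sqintZ; exact: sqintB.
Qed.

Let cvg_AB : nrm2 (fun k => re Fu k - A n k) + nrm2 (fun k => im Fu k - B n k) @[n --> \oo] --> 0.
Proof.
have [_ cF] := Fou.
have cn : (\int[mu]_k (csq (Fu k - fourier_trunc n%:R u k))%:E)%E @[n --> \oo] --> 0%E.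
  by apply: cvg_comp cF; exact: cvgr_idn.
have E n : (\int[mu]_k (csq (Fu k - fourier_trunc n%:R u k))%:E)%E =
    (nrm2 (fun k => re Fu k - A n k) + nrm2 (fun k => im Fu k - B n k))%:E.
  have [_ i1] := sqintB SFu1 (SA n); have [_ i2] := sqintB SFu2 (SB n).
  rewrite /nrm2 -intD// -L1_EFin; last exact: L1D.
  apply: eq_integral => k _; rewrite /csq -ft_re -ft_im /re /im.
  by case: (Fu k) => a c; case: (fourier_trunc _ _ _).
move: cn; under eq_fun do rewrite E.
by move/fine_cvg.
Qed.

Let sqrt_cvg0 (a : nat -> R) : a n @[n --> \oo] --> 0 -> Num.sqrt (a n) @[n --> \oo] --> 0.
Proof.
by move=> ca; rewrite -(sqrtr0 R); exact: (continuous_cvg _ (@sqrt_continuous R 0)).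
Qed.

Let cvg_A : nrm (fun k => re Fu k - A n k) @[n --> \oo] --> 0.
Proof.
apply: sqrt_cvg0; apply: (@squeeze_cvgr _ _ _ _ (fun=> 0) _ _ _ _ _ cvg_AB); last exact: cvg_cst.
by apply: nearW => n; rewrite nrm2_ge0/= lerDl nrm2_ge0.
Qed.

Let cvg_B : nrm (fun k => im Fu k - B n k) @[n --> \oo] --> 0.
Proof.
apply: sqrt_cvg0; apply: (@squeeze_cvgr _ _ _ _ (fun=> 0) _ _ _ _ _ cvg_AB); last exact: cvg_cst.
by apply: nearW => n; rewrite nrm2_ge0/= lerDr nrm2_ge0.
Qed.

Let cvg_u f g : sqint f -> sqint g ->
  \int[mu]_x (cut (ball0 n) f x * g x) @[n --> \oo] --> \int[mu]_x (f x * g x).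
Proof.
move=> Sf Sg; apply: ip_cvg => //; first by move=> n; exact: Sc.
by apply: cut_cvg => // [n|x]; [exact: meas_ball0|exact: ball0_near].
Qed.

(** The real part of the pairing of [F[u]] with the transform of the real function [g], one factor
    [nf] being divided out. It holds for truncated [u] by [plancherel] and passes to the limit by
    [ip_cvg]. *)
Lemma parseval_re g : L1 g -> sqint g ->
  \int[mu]_k (re Fu k * ftc g k) - \int[mu]_k (im Fu k * fts g k) = nf^-1 * \int[mu]_x (re u x * g x).
Proof.
move=> g1 Sg; have [Sgc Sgs _] := plancherel_le g1 Sg.
have cl : \int[mu]_k (A n k * ftc g k) - \int[mu]_k (B n k * fts g k) @[n --> \oo] -->
    \int[mu]_k (re Fu k * ftc g k) - \int[mu]_k (im Fu k * fts g k).
  by apply: cvgB; apply: ip_cvg.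
have E n : \int[mu]_k (A n k * ftc g k) - \int[mu]_k (B n k * fts g k) =
    nf^-1 * \int[mu]_x (u1 n x * g x).
  rewrite -nf_sqr -mulrA -(plancherel (Lc n Su1) (Sc n Su1) g1 Sg).
  (* The cross terms produced by the imaginary part of [u] are the integrand of [plancherel0], which
     accounts for the added zero. *)
  rewrite -[X in _ = nf * X]addr0 -(plancherel0 (Lc n Su2) (Sc n Su2) g1 Sg).
  have [S1 S2 _] := plancherel_le (Lc n Su1) (Sc n Su1).
  have [S3 S4 _] := plancherel_le (Lc n Su2) (Sc n Su2).
  rewrite -intB; [|exact: sqintM|exact: sqintM].
  rewrite -intD; last 2 first.
  - by apply: L1D; exact: sqintM.
  - by apply: L1B; exact: sqintM.
  rewrite -intZ; last by apply: L1D; [apply: L1D|apply: L1B]; exact: sqintM.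
  by apply: eq_int => k; rewrite /A /B /u1 /u2; ring.
move: cl; under eq_fun do rewrite E.
move/(cvg_lim (@Rhausdorff _)) => <-; apply/cvg_lim => //.
by apply: cvgM; [exact: cvg_cst|exact: cvg_u].
Qed.

Lemma parseval_im g : L1 g -> sqint g ->
  \int[mu]_k (im Fu k * ftc g k) + \int[mu]_k (re Fu k * fts g k) = nf^-1 * \int[mu]_x (im u x * g x).
Proof.
move=> g1 Sg; have [Sgc Sgs _] := plancherel_le g1 Sg.
have cl : \int[mu]_k (B n k * ftc g k) + \int[mu]_k (A n k * fts g k) @[n --> \oo] -->
    \int[mu]_k (im Fu k * ftc g k) + \int[mu]_k (re Fu k * fts g k).
  by apply: cvgD; apply: ip_cvg.
have E n : \int[mu]_k (B n k * ftc g k) + \int[mu]_k (A n k * fts g k) =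
    nf^-1 * \int[mu]_x (u2 n x * g x).
  rewrite -nf_sqr -mulrA -(plancherel (Lc n Su2) (Sc n Su2) g1 Sg).
  rewrite -[X in _ = nf * X]subr0 -(plancherel0 (Lc n Su1) (Sc n Su1) g1 Sg).
  have [S1 S2 _] := plancherel_le (Lc n Su1) (Sc n Su1).
  have [S3 S4 _] := plancherel_le (Lc n Su2) (Sc n Su2).
  rewrite -intD; [|exact: sqintM|exact: sqintM].
  rewrite -intB; last 2 first.
  - by apply: L1D; exact: sqintM.
  - by apply: L1B; exact: sqintM.
  rewrite -intZ; last by apply: L1B; [apply: L1D|apply: L1B]; exact: sqintM.
  by apply: eq_int => k; rewrite /A /B /u1 /u2; ring.
move: cl; under eq_fun do rewrite E.
move/(cvg_lim (@Rhausdorff _)) => <-; apply/cvg_lim => //.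
by apply: cvgM; [exact: cvg_cst|exact: cvg_u].
Qed.

Lemma nrm_ft f : L1 f -> sqint f -> nf * nrm (ftc f) <= nrm f /\ nf * nrm (fts f) <= nrm f.
Proof.
move=> f1 Sf; have [Sc1 Ss1 le] := plancherel_le f1 Sf.
have key g : nrm2 g <= 2 * pi * nrm2 f -> nf * nrm g <= nrm f.
  move=> h; have n0 := ltW nf_gt0.
  rewrite -(@ler_pXn2r _ 2)// ?nnegrE ?mulr_ge0 ?nrm_ge0//.
  rewrite exprMn !nrm_sqr; apply: (@le_trans _ _ (nf ^+ 2 * (2 * pi * nrm2 f))).
    by rewrite ler_wpM2l// sqr_ge0.
  by rewrite expr2 -!mulrA (mulrA 2) (mulrA nf (2 * pi)) nf_sqr mulVKf// gt_eqF// nf_gt0.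
split; apply: key; apply: le_trans le; first by rewrite lerDl nrm2_ge0.
by rewrite lerDr nrm2_ge0.
Qed.

Let nrm_fourier_aux f (f_ : nat -> R -> R) (a : R) : (forall n, sqint (f_ n)) -> sqint f ->
  nrm (fun x => f x - f_ n x) @[n --> \oo] --> 0 -> (forall n, nrm (f_ n) <= a) -> nrm f <= a.
Proof.
move=> Sn Sf cf an; rewrite -[leRHS]add0r.
have ca : nrm (fun x => f x - f_ n x) + a @[n --> \oo] --> 0 + a.
  by apply: cvgD => //; exact: cvg_cst.
rewrite -(cvg_lim (@Rhausdorff _) ca); apply: limr_ge.
  by apply/cvg_ex; eexists; exact: ca.
apply: nearW => n; rewrite -{1}(_ : (fun x => (f x - f_ n x) + f_ n x) = f); last first.
  by apply/funext => x; rewrite subrK.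
by apply: le_trans (nrmD _ (Sn n)) _; [exact: sqintB|rewrite lerD2l].
Qed.

Let nrm_cut0 f n : sqint f -> nrm (cut (ball0 n) f) <= nrm f.
Proof. by move=> Sf; apply: nrm_cut => //; exact: meas_ball0. Qed.

(** A triangle-inequality substitute for the isometry; its loss is absorbed in the constant of
    [key_estimate]. *)
Lemma nrm_fourier_re : nrm (re Fu) <= nrm (re u) + nrm (im u).
Proof.
apply: (nrm_fourier_aux SA SFu1 cvg_A) => n.
have [S1 S2 _] := plancherel_le (Lc n Su1) (Sc n Su1).
have [S3 S4 _] := plancherel_le (Lc n Su2) (Sc n Su2).
have [h1 _] := nrm_ft (Lc n Su1) (Sc n Su1); have [_ h2] := nrm_ft (Lc n Su2) (Sc n Su2).
rewrite nrmZ; last exact: sqintD.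
rewrite (gtr0_norm nf_gt0); apply: (@le_trans _ _ (nf * (nrm (ftc (u1 n)) + nrm (fts (u2 n))))).
  by rewrite ler_wpM2l ?(ltW nf_gt0)//; exact: nrmD.
rewrite mulrDr lerD//; first exact: le_trans h1 (nrm_cut0 n Su1).
exact: le_trans h2 (nrm_cut0 n Su2).
Qed.

Lemma nrm_fourier_im : nrm (im Fu) <= nrm (re u) + nrm (im u).
Proof.
apply: (nrm_fourier_aux SB SFu2 cvg_B) => n.
have [S1 S2 _] := plancherel_le (Lc n Su1) (Sc n Su1).
have [S3 S4 _] := plancherel_le (Lc n Su2) (Sc n Su2).
have [_ h1] := nrm_ft (Lc n Su1) (Sc n Su1); have [h2 _] := nrm_ft (Lc n Su2) (Sc n Su2).
rewrite nrmZ; last exact: sqintB.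
rewrite (gtr0_norm nf_gt0) addrC; apply: (@le_trans _ _ (nf * (nrm (ftc (u2 n)) + nrm (fts (u1 n))))).
  rewrite ler_wpM2l ?(ltW nf_gt0)//.
  have := nrmD S3 (sqintN S2); rewrite (_ : nrm (fun x => - fts _ x) = nrm (fts (u1 n)))//.
  by rewrite /nrm /nrm2; congr Num.sqrt; apply: eq_int => x; rewrite sqrrN.
rewrite mulrDr lerD//; first exact: le_trans h2 (nrm_cut0 n Su2).
exact: le_trans h1 (nrm_cut0 n Su1).
Qed.

End Fourier.
End ComplexL2.

(** * Functions orthogonal to the Hermite space *)

Section KeyEstimate.
Variables (R : realType) (N : nat) (beta : R).
Hypotheses (N1 : (1 <= N)%N) (beta0 : 0 < beta).
Local Notation mu := (@lebesgue_measure R).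
Implicit Types (f g : R -> R) (u Fu : R -> R[i]) (x y k : R).

Let b := beta ^+ 2.
Let s := beta^-1.
Let M := Num.sqrt N%:R / beta / (2 * Num.sqrt 2).
Let B := Num.sqrt N%:R * beta / (2 * Num.sqrt 2).
Let a := 2 * M.

Let b0 : 0 < b. Proof. by rewrite exprn_gt0. Qed.
Let s0 : s != 0. Proof. by rewrite invr_eq0 gt_eqF. Qed.
Let N0 : 0 < N%:R :> R. Proof. by rewrite ltr0n. Qed.
Let q2 : 0 < Num.sqrt 2 :> R. Proof. by rewrite sqrtr_gt0. Qed.
Let r0 : 0 < Num.sqrt N%:R :> R. Proof. by rewrite sqrtr_gt0. Qed.
Let M0 : 0 < M. Proof. by rewrite !divr_gt0// mulr_gt0. Qed.
Let a0 : 0 < a. Proof. by rewrite mulr_gt0. Qed.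
Let B0 : 0 < B. Proof. by rewrite !(divr_gt0, mulr_gt0). Qed.

Let q2_sqr : Num.sqrt 2 ^+ 2 = 2 :> R. Proof. by rewrite sqr_sqrtr. Qed.
Let r_sqr : Num.sqrt N%:R ^+ 2 = N%:R :> R. Proof. by rewrite sqr_sqrtr// ltW. Qed.

(** With [B2b], the source of all exponents below: both thresholds are worth [N/8] in the natural
    units of the oscillator. *)
Let bM2 : b * M ^+ 2 = N%:R / 8.
Proof.
rewrite /M /b !(exprMn, exprVn) r_sqr q2_sqr; field; by rewrite gt_eqF.
Qed.

Let B2b : B ^+ 2 / b = N%:R / 8.
Proof.
rewrite /B /b !(exprMn, exprVn) r_sqr q2_sqr; field; by rewrite gt_eqF.
Qed.

Let s2 : s ^+ 2 *+ 2 = 2 / b.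
Proof. by rewrite /s /b exprVn -mulr_natl. Qed.

Let I : R -> R := \1_(`[- a, a]%classic).

Let I_in x : `|x| <= a -> I x = 1.
Proof. by move=> xa; rewrite /I indicE mem_set//= in_itv/= -ler_norml. Qed.

Let I_out x : a < `|x| -> I x = 0.
Proof.
move=> xa; rewrite /I indicE memNset//= in_itv/= -ler_norml.
by apply/negP; rewrite -ltNge.
Qed.

Let I1 : L1 I. Proof. exact: L1_indic_itv. Qed.

Let mI : measurable_fun setT I. Proof. exact: L1_meas. Qed.

Let int_indic_itv (c : R) : 0 <= c -> \int[mu]_x \1_(`[- c, c]%classic : set R) x = 2 * c.
Proof.
move=> c0; set E : set R := `[- c, c]%classic.
have -> : \int[mu]_x \1_E x = \int[mu]_(x in E) (1 : R).
  rewrite [RHS]Rintegral_mkcond; apply: eq_int => x.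
  by rewrite patchE indicE; case: (_ \in _).
rewrite Rintegral_cst ?mul1r; last exact: measurable_itv.
have mE : fine (mu E) = 2 * c.
  rewrite /E lebesgue_measure_itv/= lte_fin.
  have [cc|cc] := ltP (- c) c; first by rewrite /= opprK mulr_natl mulr2n.
  have -> : c = 0 by lra.
  by rewrite mulr0.
exact: mE.
Qed.

Let chi := heat s I.

Let chi1 : L1 chi. Proof. by have [] := L1_heat s0 I1. Qed.

Let mchi : measurable_fun setT chi. Proof. exact: L1_meas. Qed.

Let chi_ge0 x : 0 <= chi x.
Proof. by apply: int_ge0 => y; rewrite mulr_ge0// normal_pdf_ge0. Qed.

Let chi_compl x : 1 - chi x = \int[mu]_y (normal_pdf x s y * (1 - I y)).
Proof.
rewrite -{1}(int_pdf x s0) /chi /heat -intB; [|exact: L1_pdf|exact: L1_heat_kernel].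
by apply: eq_int => y; rewrite mulrBr mulr1 mulrC.
Qed.

Let IC_norm y : `|1 - I y| <= 1.
Proof. by have [/I_in ->|/I_out ->] := leP `|y| a; rewrite ?subrr ?subr0 ?normr1 ?normr0. Qed.

Let mIC : measurable_fun setT (fun y => 1 - I y).
Proof. exact: measurable_funB. Qed.

Let chiC_norm x : `|1 - chi x| <= 1.
Proof.
have p1 := L1_pdf x s0.
have i1 : L1 (fun y => normal_pdf x s y * (1 - I y)) by exact: L1Mb p1 mIC IC_norm.
rewrite chi_compl; apply: le_trans (int_norm i1) _.
apply: (@le_trans _ _ (\int[mu]_y normal_pdf x s y)); last by rewrite int_pdf.
apply: int_le => //; first exact: L1_norm.
move=> y; rewrite normrM (ger0_norm (normal_pdf_ge0 _ _ _)).
by rewrite -[leRHS]mulr1 ler_wpM2l// normal_pdf_ge0.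
Qed.

Let chi_norm x : `|chi x| <= 1.
Proof.
rewrite ger0_norm//; have := chiC_norm x; rewrite ler_norml => /andP[_].
have -> : 1 - chi x = \int[mu]_y (normal_pdf x s y * (1 - I y)) by exact: chi_compl.
move=> _; have : 0 <= \int[mu]_y (normal_pdf x s y * (1 - I y)).
  apply: int_ge0 => y; rewrite mulr_ge0 ?normal_pdf_ge0//.
  by have [/I_in ->|/I_out ->] := leP `|y| a; rewrite ?subrr ?subr0.
by rewrite -chi_compl subr_ge0.
Qed.

(** A point of [[-M, M]] is at distance at least [M] from the complement of [[-2M, 2M]], and
    [M^2/(2 s^2) = b M^2/2 = N/16]. This matches the exponent in [Eh]. *)
Let chiC_small x : `|x| <= M -> `|1 - chi x| <= 2 * expR (- (N%:R / 16)).
Proof.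
move=> xM; rewrite chi_compl.
have := @pdf_tail _ x s M 1 (fun y => 1 - I y) s0 (ltW M0) mIC IC_norm.
rewrite s2 mul1r (_ : M ^+ 2 / (2 / b) = N%:R / 16); last first.
  rewrite (_ : M ^+ 2 / (2 / b) = b * M ^+ 2 / 2); last by field; rewrite gt_eqF.
  by rewrite bM2; field.
apply=> y yx; rewrite I_in ?subrr//.
rewrite -(subrK x y) (le_trans (ler_normD _ _))// /a mulr_natl mulr2n lerD// ltW//.
Qed.

Let sqint_chi : sqint chi.
Proof.
split => //; apply: L1_le (L1_norm chi1); first exact: measurable_funX.
by move=> x; rewrite normrX expr2 -[leRHS]mulr1 ler_wpM2l.
Qed.

Let As : set R := [set x | M < `|x|].
Let Af : set R := [set k | B < `|k|].

Let mAs : measurable As.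
Proof. by rewrite -[X in measurable X]setTI; exact: (measurable_fun_ltr (g := fun x : R => `|x|)). Qed.

Let mAf : measurable Af.
Proof. by rewrite -[X in measurable X]setTI; exact: (measurable_fun_ltr (g := fun x : R => `|x|)). Qed.

Let pk := normal_peak s.
Let Q := Num.sqrt (pi / b).
(** A bound, per unit of [nrm2 f], on the squared pairings in [localized], uniform over the region
    [|y| <= a], [|k| <= B]. *)
Let X := pk ^+ 2 * Q * expR (- (3 * N%:R / 16)).

Let X0 : 0 <= X.
Proof.
rewrite /X mulr_ge0 ?expR_ge0//.
by apply: mulr_ge0; [exact: sqr_ge0|exact: sqrtr_ge0].
Qed.

(** Expanding the square shows the kernel as a packet with [c = b y]. Its quadratic coefficient
    [b / 2] is that of the Hermite functions, thanks to [s = 1/beta]. *)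
Let pdf_gw x y : normal_pdf x s y = pk * expR (- (b * y ^+ 2 / 2)) * gw (b / 2) (b * y) x.
Proof.
rewrite (pdfE _ _ s0) s2 -mulrA -expRD; congr (_ * expR _).
by field; rewrite gt_eqF.
Qed.

Let half_pow : (2^-1 : R) ^+ N <= expR (- (N%:R / 2)).
Proof.
have h : (2^-1 : R) <= expR (- 2^-1) by have := expR_ge1Dx (- 2^-1 : R); lra.
rewrite (_ : - (N%:R / 2) = - 2^-1 * N%:R); last by rewrite mulrC mulNr.
by rewrite expRM_natr lerXn2r// nnegrE ?expR_ge0// invr_ge0.
Qed.

(** The exponent is at most [-N/2 + b y^2/2 + k^2/(2 b)]. By [bM2] and [B2b] the positive terms are
    at most [N/4] and [N/16], which leaves [-3N/16]. *)
Let exp_bound y k : `|y| <= a -> `|k| <= B ->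
  expR (- (b * y ^+ 2)) * ((2^-1) ^+ N * expR ((b * y) ^+ 2 / b + ((b * y) ^+ 2 + k ^+ 2) / (2 * b)))
  <= expR (- (3 * N%:R / 16)).
Proof.
move=> ya kB.
have y2 : b * y ^+ 2 <= N%:R / 2.
  apply: (@le_trans _ _ (b * a ^+ 2)).
    by rewrite ler_wpM2l ?(ltW b0)// -[y ^+ 2]real_normK ?num_real// lerXn2r ?nnegrE// ltW.
  by rewrite /a exprMn mulrCA bM2; lra.
have k2 : k ^+ 2 / b <= N%:R / 8.
  rewrite -B2b ler_wpM2r ?invr_ge0 ?(ltW b0)// -[k ^+ 2]real_normK ?num_real//.
  by rewrite lerXn2r ?nnegrE// ltW.
apply: (@le_trans _ _ (expR (- (b * y ^+ 2)) * (expR (- (N%:R / 2)) *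
   expR ((b * y) ^+ 2 / b + ((b * y) ^+ 2 + k ^+ 2) / (2 * b))))).
  by rewrite ler_wpM2l ?expR_ge0// ler_wpM2r ?expR_ge0.
rewrite -!expRD ler_expR.
rewrite (_ : (b * y) ^+ 2 / b + _ = 3 / 2 * (b * y ^+ 2) + (k ^+ 2 / b) / 2); last first.
  by field; rewrite gt_eqF.
lra.
Qed.

Let localized f y k : sqint f -> orth b N.+1 f -> `|y| <= a -> `|k| <= B ->
  `|\int[mu]_x (f x * (normal_pdf x s y * cos (k * x)))| <= Num.sqrt X * nrm f /\
  `|\int[mu]_x (f x * (normal_pdf x s y * sin (k * x)))| <= Num.sqrt X * nrm f.
Proof.
move=> Sf of_ ya kB.
have [hc hs] := orth_gabor_bound b0 (b * y) k Sf of_.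
pose e := pk * expR (- (b * y ^+ 2 / 2)).
have e2 : e ^+ 2 = pk ^+ 2 * expR (- (b * y ^+ 2)).
  by rewrite exprMn -expRM_natr; congr (_ * expR _); field.
have key (h : R -> R) : continuous h -> (forall x, `|h x| <= 1) ->
    (\int[mu]_x (f x * (gw (b / 2) (b * y) x * h x))) ^+ 2 <= nrm2 f * (Q * (2^-1) ^+ N *
      expR ((b * y) ^+ 2 / b + ((b * y) ^+ 2 + k ^+ 2) / (2 * b))) ->
    `|\int[mu]_x (f x * (normal_pdf x s y * h x))| <= Num.sqrt X * nrm f.
  move=> ch h1 H.
  have -> : \int[mu]_x (f x * (normal_pdf x s y * h x)) =
      e * \int[mu]_x (f x * (gw (b / 2) (b * y) x * h x)).
    rewrite -intZ; last by apply: sqintM => //; exact: sqint_gwb.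
    by apply: eq_int => x; rewrite pdf_gw -/e; ring.
  rewrite -sqrtr_sqr -sqrtrM// ler_wsqrtr// exprMn e2.
  apply: (@le_trans _ _ (pk ^+ 2 * expR (- (b * y ^+ 2)) * (nrm2 f * (Q * (2^-1) ^+ N *
      expR ((b * y) ^+ 2 / b + ((b * y) ^+ 2 + k ^+ 2) / (2 * b)))))).
    by rewrite ler_wpM2l// mulr_ge0 ?sqr_ge0 ?expR_ge0.
  have := exp_bound ya kB; set e1 := expR _; set e3 := expR (_ + _) => h3.
  rewrite (_ : _ * _ * _ = pk ^+ 2 * Q * (e1 * ((2^-1) ^+ N * e3)) * nrm2 f); last by ring.
  rewrite ler_wpM2r ?nrm2_ge0// ler_wpM2l// mulr_ge0 ?sqr_ge0 ?sqrtr_ge0//.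
by split; apply: key => //; [exact: cont_cosk|move=> x; exact: norm_cos|exact: cont_sink|move=> x; exact: norm_sin].
Qed.

(* Fubini needs an integrable function of [x]: the factor [gw (b / 4) 0 x] is moved from the kernel to [f]. *)
Let chi_fubini f (h : R -> R) : sqint f -> continuous h -> (forall x, `|h x| <= 1) ->
  L1 (fun y => I y * \int[mu]_x (f x * (normal_pdf x s y * h x))) /\
  \int[mu]_x (f x * chi x * h x) = \int[mu]_y (I y * \int[mu]_x (f x * (normal_pdf x s y * h x))).
Proof.
move=> Sf ch h1; have b4 : 0 < b / 4 by rewrite divr_gt0.
have mh : measurable_fun setT h by exact: cont_meas.
pose fg x := f x * gw (b / 4) 0 x.
have fg1 : L1 fg.
  have b2 : 0 < b / 2 by rewrite divr_gt0.
  apply: sqintM => //.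
  have : sqint (fun x => gw (b / 2 / 2) 0 x * 1).
    by apply: (sqint_gwb b2 0 (h := fun=> 1)) => x; [exact: cvg_cst|rewrite normr1].
  have -> : b / 2 / 2 = b / 4 by lra.
  by under eq_fun do rewrite mulr1.
pose K (z : R * R) := I z.2 * (normal_pdf z.1 s z.2 * (expR (b / 4 * z.1 ^+ 2) * h z.1)).
have mK : measurable_fun setT K.
  apply: measurable_funM; first exact: measurableT_comp.
  apply: measurable_funM; first exact: meas_pdf2.
  apply: measurable_funM; last exact: measurableT_comp.
  apply: measurableT_comp => //; apply: measurable_funM => //.
  by apply: measurable_funX.
have KM z : `|K z| <= pk * expR (b * a ^+ 2 / 2).
  rewrite /K; have [za|za] := leP `|z.2| a; last first.
    by rewrite I_out// mul0r normr0 mulr_ge0 ?expR_ge0 ?normal_peak_ge0.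
  rewrite I_in// mul1r !normrM (ger0_norm (normal_pdf_ge0 _ _ _)) (ger0_norm (expR_ge0 _)).
  apply: (@le_trans _ _ (normal_pdf z.1 s z.2 * (expR (b / 4 * z.1 ^+ 2) * 1))).
    by rewrite ler_wpM2l ?normal_pdf_ge0// ler_wpM2l// expR_ge0.
  rewrite mulr1 (pdfE _ _ s0) s2 -[leLHS]mulrA ler_wpM2l ?normal_peak_ge0//.
  rewrite -expRD ler_expR.
  (* With [x = z.1] and [y = z.2], the exponent [b x^2/4 - b (x - y)^2/2] equals
     [b y^2/2 - b (x - 2 y)^2/4]: the density decays faster than the borrowed factor grows. *)
  apply: (@le_trans _ _ (b * z.2 ^+ 2 / 2)).
    rewrite -subr_ge0 (_ : _ - _ = b / 4 * (z.1 - 2 * z.2) ^+ 2); last by field; rewrite gt_eqF.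
    by rewrite mulr_ge0 ?sqr_ge0// ltW.
  rewrite ler_wpM2r// ler_wpM2l ?(ltW b0)// -[z.2 ^+ 2]real_normK ?num_real//.
  by rewrite lerXn2r ?nnegrE// ltW.
have gwK x : gw (b / 4) 0 x * expR (b / 4 * x ^+ 2) = 1.
  by rewrite /gw mul0r addr0 -expRD addNr expR0.
(* One copy of [I] is the integrable factor in [y]; the other sits in [K] and keeps it bounded. *)
have II y : I y * I y = I y by have [/I_in ->|/I_out ->] := leP `|y| a; rewrite ?mulr1 ?mulr0.
have Gy y : I y * \int[mu]_x (fg x * K (x, y)) = I y * \int[mu]_x (f x * (normal_pdf x s y * h x)).
  rewrite -[in RHS]II -[RHS]mulrA; congr (_ * _).
  have Sy : sqint (fun x => normal_pdf x s y * h x).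
    rewrite (_ : (fun _ => _) = fun x => (pk * expR (- (b * y ^+ 2 / 2))) * (gw (b / 2) (b * y) x * h x)).
      by apply: sqintZ; exact: sqint_gwb.
    by apply/funext => x; rewrite pdf_gw !mulrA.
  rewrite -intZ; last exact: sqintM.
  apply: eq_int => x; rewrite /fg /K/=.
  transitivity (I y * (f x * (normal_pdf x s y * h x)) * (gw (b / 4) 0 x * expR (b / 4 * x ^+ 2))).
    by ring.
  by rewrite gwK mulr1.
have E : \int[mu]_x (f x * chi x * h x) = \int[mu]_x (fg x * \int[mu]_y (I y * K (x, y))).
  apply: eq_int => x.
  rewrite (_ : \int[mu]_y (I y * K (x, y)) = expR (b / 4 * x ^+ 2) * h x * chi x).
    rewrite /fg; transitivity (f x * chi x * h x * (gw (b / 4) 0 x * expR (b / 4 * x ^+ 2))).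
      by rewrite gwK mulr1.
    by ring.
  rewrite /chi /heat -intZ; last exact: L1_heat_kernel.
  by apply: eq_int => y; rewrite /K/= mulrA II; ring.
split; last first.
  rewrite E (fubini_bounded fg1 I1 mK KM); exact: eq_int.
under eq_fun do rewrite -Gy.
apply: (@fubini_bounded_L1 _ I fg (fun z => K (z.2, z.1)) _ I1 fg1 _ (fun z => KM _)).
by apply: measurableT_comp => //; exact: measurable_fun_pair.
Qed.

(** [chi_fubini] writes the transform as an integral over [|y| <= a], an interval of length [2 a],
    of pairings each bounded by [localized]. *)
Let ft_chi_bound f k : sqint f -> orth b N.+1 f -> `|k| <= B ->
  `|ftc (fun x => f x * chi x) k| <= 2 * a * (Num.sqrt X * nrm f) /\
  `|fts (fun x => f x * chi x) k| <= 2 * a * (Num.sqrt X * nrm f).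
Proof.
move=> Sf of_ kB.
set D := Num.sqrt X * nrm f.
have D0 : 0 <= D by rewrite mulr_ge0 ?sqrtr_ge0.
have key (h : R -> R) : continuous h -> (forall x, `|h x| <= 1) ->
    (forall y, `|y| <= a -> `|\int[mu]_x (f x * (normal_pdf x s y * h x))| <= D) ->
    `|\int[mu]_x (f x * chi x * h x)| <= 2 * a * D.
  move=> ch h1 hD; have [G1 ->] := chi_fubini Sf ch h1.
  have GI y : `|I y * \int[mu]_x (f x * (normal_pdf x s y * h x))| <= D * I y.
    have [ya|ya] := leP `|y| a; last by rewrite I_out// mul0r mulr0 normr0.
    by rewrite I_in// mul1r mulr1 hD.
  rewrite -(int_indic_itv (ltW a0)) mulrC -intZ//.
  by apply: le_trans (int_norm G1) _; apply: int_le => //; [exact: L1_norm|exact: L1Z].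
split; apply: key.
- exact: cont_cosk.
- by move=> x; exact: norm_cos.
- by move=> y ya; have [] := localized Sf of_ ya kB.
- exact: cont_sink.
- by move=> x; exact: norm_sin.
- by move=> y ya; have [] := localized Sf of_ ya kB.
Qed.

Let volume_aux (r q t bt e : R) : q != 0 -> t != 0 -> bt != 0 -> q ^+ 2 = 2 ->
  2 * (r * bt / (2 * q)) * (2 * (2 * (r / bt / (2 * q)))) ^+ 2 *
    (bt ^+ 2 / (2 * t ^+ 2) * (t / bt) * e) = r ^+ 3 * e / (q * t).
Proof.
move=> q_neq0 t_neq0 bt_neq0 qq.
have -> : r ^+ 3 * e / (q * t) = q ^+ 2 * (r ^+ 3 * e) / (q ^+ 3 * t) by field; apply/andP.
by rewrite qq; field; rewrite q_neq0 t_neq0 bt_neq0.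
Qed.

Let sqr_le_exp (x : R) : 0 <= x -> x ^+ 2 <= 32 ^+ 2 * expR (x / 16).
Proof.
move=> x0; have h := expR_ge1Dx (x / 32).
have -> : x / 16 = x / 32 * 2%:R by field.
rewrite expRM_natr -exprMn; have := expR_ge0 (x / 32); move: (expR (x / 32)) h => y h y0.
by apply: lerXn2r; rewrite ?nnegrE; lra.
Qed.

Let volume_fin (K E1 E2 e t : R) : 0 <= K -> E1 * E2 = 1 -> 0 <= e -> 1 <= t ->
  K * E1 * (e * E2) <= K * e * t.
Proof.
move=> K0 EE e0 t1; have -> : K * E1 * (e * E2) = K * e * (E1 * E2) by ring.
by rewrite EE ler_wpM2l// mulr_ge0.
Qed.

Let peak_aux (c p : R) : c != 0 -> p != 0 -> (c^-1 ^+ 2 * p *+ 2)^-1 = c ^+ 2 / (2 * p).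
Proof. by move=> c_neq0 p_neq0; rewrite -mulr_natr; field; rewrite c_neq0 p_neq0. Qed.

Let pk_sqr : pk ^+ 2 = b / (2 * pi).
Proof.
have p0 := @pi_gt0 R; rewrite /pk /normal_peak exprVn sqr_sqrtr.
  by rewrite /s peak_aux// gt_eqF.
by rewrite mulrn_wge0// mulr_ge0 ?sqr_ge0// ltW.
Qed.

Let QE : Q = Num.sqrt pi / beta.
Proof.
rewrite /Q sqrtrM ?pi_ge0// sqrtrV ?(ltW b0)// /b sqrtr_sqr.
by rewrite (gtr0_norm beta0).
Qed.

(** All powers of [beta] cancel and the left side is [N^(3/2) exp(-3N/16) / sqrt (2 pi)]. Of the
    exponent, [-N/8] is kept, and the remaining [-N/16] absorbs
    [N^(3/2) <= N^2 <= 32^2 exp(N/16)]. *)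
Let volume_bound : 2 * B * (2 * a) ^+ 2 * X <= (32 * expR (- (N%:R / 16))) ^+ 2.
Proof.
set r : R := Num.sqrt N%:R; set q : R := Num.sqrt 2.
have r1 : 1 <= r by rewrite -(@sqrtr1 R) ler_wsqrtr// ler1n.
have rr : N%:R = r ^+ 2 :> R by rewrite r_sqr.
have sp0 : 0 < Num.sqrt pi :> R by rewrite sqrtr_gt0 pi_gt0.
have sp2 : pi = Num.sqrt pi ^+ 2 :> R by rewrite sqr_sqrtr// pi_ge0.
have E : 2 * B * (2 * a) ^+ 2 * X = r ^+ 3 * expR (- (3 * N%:R / 16)) / (q * Num.sqrt pi).
  rewrite -(@volume_aux r q (Num.sqrt pi) beta) ?gt_eqF//.
  by rewrite -sp2 /X pk_sqr QE.
have qt1 : 1 <= q * Num.sqrt pi.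
  have h1 : 1 <= q by rewrite -(@sqrtr1 R) ler_wsqrtr// ler1n.
  have h2 : 1 <= Num.sqrt pi :> R.
    by rewrite -(@sqrtr1 R) ler_wsqrtr//; apply: le_trans (pi_ge2 R); rewrite ler1n.
  by rewrite -[leLHS]mul1r ler_pM.
rewrite E ler_pdivrMr ?mulr_gt0//.
have e1 := sqr_le_exp (ltW N0).
have r3 : r ^+ 3 <= N%:R ^+ 2 by rewrite rr -exprM ler_weXn2l.
rewrite exprMn -expRM_natr.
have -> : - (3 * N%:R / 16) = - (N%:R / 16) * 2%:R + - (N%:R / 16) :> R by field.
rewrite expRD; set e := expR (- (N%:R / 16) * 2%:R).
have e0 : 0 <= e by exact: expR_ge0.
apply: (@le_trans _ _ (32 ^+ 2 * expR (N%:R / 16) * (e * expR (- (N%:R / 16))))).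
  by rewrite ler_wpM2r ?mulr_ge0 ?expR_ge0// (le_trans r3).
apply: volume_fin => //.
by rewrite -expRD subrr expR0.
Qed.

Let T_aux (p q r t : R) : p * (q * r) * t = t * p * q * r.
Proof. by ring. Qed.

(** A uniform bound on an interval of length [2 B] costs a factor [sqrt (2 B)] in L^2, and
    [volume_bound] evaluates the product. [T] will be [ftc] or [fts] of [f chi]. *)
Let T_small (T : R -> R) D : measurable_fun setT T -> 0 <= D ->
  (forall k, `|k| <= B -> `|T k| <= 2 * a * (Num.sqrt X * D)) ->
  let F := cut (~` Af) T in sqint F /\ nrm F <= 32 * expR (- (N%:R / 16)) * D.
Proof.
move=> mT D0 TD F; set L := 2 * a * (Num.sqrt X * D).
have L0 : 0 <= L.
  apply: mulr_ge0; first by apply: mulr_ge0 => //; exact: ltW.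
  by apply: mulr_ge0 => //; exact: sqrtr_ge0.
pose IB : R -> R := \1_(`[- B, B]%classic).
have IB1 : L1 IB by exact: L1_indic_itv.
have FI k : F k ^+ 2 <= L ^+ 2 * IB k.
  have [kB|kB] := leP `|k| B.
    have -> : IB k = 1 by rewrite /IB indicE mem_set//= in_itv/= -ler_norml.
    rewrite mulr1 -[leLHS]real_normK ?num_real// lerXn2r ?nnegrE//.
    exact: le_trans (norm_cut _ _ _) (TD _ kB).
  have -> : F k = 0.
    by rewrite /F /cut indicE memNset ?mulr0//= => /(_ kB).
  have -> : IB k = 0.
    rewrite /IB indicE memNset//= in_itv/= -ler_norml.
    by apply/negP; rewrite -ltNge.
  by rewrite mulr0 expr0n.
have mF : measurable_fun setT F by apply: meas_cut => //; exact: measurableC.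
have SF : sqint F.
  split => //; apply: (L1_le _ _ (L1Z (L ^+ 2) IB1)); first exact: measurable_funX.
  by move=> k; rewrite ger0_norm ?sqr_ge0.
split => //.
rewrite -(@ler_pXn2r _ 2)// ?nnegrE ?nrm_ge0 ?mulr_ge0 ?expR_ge0// nrm_sqr.
apply: (@le_trans _ _ (L ^+ 2 * (2 * B))).
  rewrite -(int_indic_itv (ltW B0)) -intZ//.
  by apply: int_le => //; [case: SF|exact: L1Z].
have -> : L ^+ 2 = (2 * a) ^+ 2 * (X * D ^+ 2).
  by rewrite /L exprMn [(_ * D) ^+ 2]exprMn sqr_sqrtr.
rewrite [leRHS]exprMn T_aux.
by rewrite ler_wpM2r ?sqr_ge0.
Qed.

Let tri_aux (n x y z t F K : R) : 0 <= n -> `|x - y| <= F -> y = n * (z + t) ->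
  n * `|z| + n * `|t| <= K - F -> `|x| <= K.
Proof.
move=> n0 h1 h2 h3; rewrite -(subrK y x); apply: le_trans (ler_normD _ _) _.
have : `|y| <= n * `|z| + n * `|t|.
  by rewrite h2 normrM (ger0_norm n0) -mulrDr ler_wpM2l// ler_normD.
by move: h1 h3; move: (`|x - y|) (`|y|) (n * `|z|) (n * `|t|) => *; lra.
Qed.

Let sum_aux (F T K p q : R) : F + 2 * T <= K -> p <= T -> q <= T -> p + q <= K - F.
Proof. by move=> *; lra. Qed.

(** Origin of [130 = 2 + 2 * 64]: the first [2] is from [chiC_small]; [64] is the [32] of
    [volume_bound] times the [2] lost in [nrm_fourier_re]; it occurs once for the cosine and once
    for the sine transform. *)
Let fin_aux (E1 E2 e U f : R) : 0 <= E1 -> 0 <= E2 -> 0 <= e -> 0 <= U -> 0 <= f ->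
  (E1 + 2 * e * U) * f + 2 * ((E2 + 64 * e * U) * f) <= 130 * (E1 + E2 + U * e) * f.
Proof.
move=> h1 h2 h3 h4 h5; rewrite mulrA -mulrDl ler_wpM2r// (mulrC U).
have := mulr_ge0 h3 h4; rewrite -!mulrA; move: (e * U) => t t0; lra.
Qed.

Lemma key_estimate u Fu f : L2 u -> is_fourier u Fu -> sqint f -> orth b N.+1 f ->
  `|\int[mu]_x (re u x * f x)| <= 130 * EN N beta u Fu * nrm f /\
  `|\int[mu]_x (im u x * f x)| <= 130 * EN N beta u Fu * nrm f.
Proof.
move=> Lu Fou Sf of_.
have [Su1 Su2] := L2_sqint Lu.
have LFu : L2 Fu by case: Fou.
have [SF1 SF2] := L2_sqint LFu.
pose g x := f x * chi x.
have g1 : L1 g by exact: sqintM.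
have Sg : sqint g by exact: (sqintMb Sf mchi chi_norm).
have f0 := nrm_ge0 f.
have gf : nrm g <= nrm f.
  apply: nrm_le => // x; rewrite normrM -[leRHS]mulr1 ler_wpM2l//.
pose e : R := expR (- (N%:R / 16)).
have e0 : 0 <= e by exact: expR_ge0.
pose U := l2norm u.
have U0 : 0 <= U by exact: l2norm_ge0.
have mchiC : measurable_fun setT (fun x => 1 - chi x) by exact: measurable_funB.
have space v : sqint v -> nrm (cut As v) <= Es N beta u -> nrm v <= U ->
    `|\int[mu]_x (v x * f x) - \int[mu]_x (v x * g x)| <= (Es N beta u + 2 * e * U) * nrm f.
  move=> Sv vE vU.
  have mAsC : measurable (~` As) by exact: measurableC.
  pose v1 x := cut As v x * (1 - chi x); pose v2 x := cut (~` As) v x * (1 - chi x).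
  have S1 : sqint v1 by apply: (sqintMb (sqint_cut mAs Sv) mchiC chiC_norm).
  have S2 : sqint v2 by apply: (sqintMb (sqint_cut mAsC Sv) mchiC chiC_norm).
  (* [v (1 - chi)] is split at [|x| = M]: outside, [v] is measured by [Es]; inside, [1 - chi] is
     exponentially small. *)
  have -> : \int[mu]_x (v x * f x) - \int[mu]_x (v x * g x) =
      \int[mu]_x ((v1 x + v2 x) * f x).
    rewrite -intB; [|exact: sqintM|exact: sqintM].
    apply: eq_int => x; rewrite /v1 /v2 /g /cut !indicE in_setC.
    by case: (x \in As) => /=; ring.
  apply: le_trans (cauchy_schwarz (sqintD S1 S2) Sf) _.
  rewrite ler_wpM2r//; apply: le_trans (nrmD S1 S2) _; apply: lerD.
    apply: le_trans vE; apply: nrm_le => //; first exact: sqint_cut.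
    by move=> x; rewrite normrM -[leRHS]mulr1 ler_wpM2l.
  apply: (@le_trans _ _ (nrm (fun x => 2 * e * v x))).
    apply: nrm_le => //; first exact: sqintZ.
    move=> x; rewrite /v2 normrM mulrC [leRHS]normrM (ger0_norm (mulr_ge0 _ e0))//.
    have [xM|xM] := leP `|x| M.
      by rewrite ler_pM ?norm_cut ?chiC_small.
    rewrite /cut indicE memNset; first by rewrite mulr0 normr0 mulr0 !mulr_ge0.
    by move=> /(_ xM).
  by rewrite nrmZ// ger0_norm ?mulr_ge0// ler_wpM2l// mulr_ge0.
have [Sc Ss _] := plancherel_le g1 Sg.
have [nc ns] := nrm_ft g1 Sg.
have [SFc nFc] := @T_small (ftc g) (nrm f) (proj1 Sc) f0 (fun k kB => proj1 (ft_chi_bound Sf of_ kB)).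
have [SFs nFs] := @T_small (fts g) (nrm f) (proj1 Ss) f0 (fun k kB => proj2 (ft_chi_bound Sf of_ kB)).
have nf0 := nf_gt0 R.
have nf1 := nf_le1 R.
(* The analogous split at [|k| = B]: beyond it [v], a component of [F[u]], is measured by [Ef];
   below it the transform [T] of [f chi] is exponentially small. *)
have freq v T : sqint v -> sqint T -> nrm (cut Af v) <= Ef N beta Fu -> nrm v <= 2 * U ->
    nf R * nrm T <= nrm g -> sqint (cut (~` Af) T) -> nrm (cut (~` Af) T) <= 32 * e * nrm f ->
    nf R * `|\int[mu]_k (v k * T k)| <= (Ef N beta Fu + 64 * e * U) * nrm f.
  move=> Sv ST vE vU Tg ST' TD.
  have -> : \int[mu]_k (v k * T k) = \int[mu]_k (cut Af v k * T k) + \int[mu]_k (v k * cut (~` Af) T k).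
    rewrite -intD; [|by apply: sqintM => //; exact: sqint_cut|exact: sqintM].
    apply: eq_int => k; rewrite /cut !indicE in_setC.
    by case: (k \in Af) => /=; ring.
  apply: (@le_trans _ _ (nf R * (nrm (cut Af v) * nrm T + nrm v * nrm (cut (~` Af) T)))).
    rewrite ler_wpM2l ?(ltW nf0)//; apply: le_trans (ler_normD _ _) _; apply: lerD.
      by apply: cauchy_schwarz => //; exact: sqint_cut.
    exact: cauchy_schwarz.
  rewrite mulrDr mulrDl; apply: lerD.
    rewrite mulrCA ler_pM ?nrm_ge0 ?(mulr_ge0 (ltW nf0)) ?nrm_ge0//.
    exact: le_trans Tg gf.
  apply: (@le_trans _ _ (1 * (2 * U * (32 * e * nrm f)))).
    by rewrite ler_pM ?(ltW nf0) ?mulr_ge0 ?nrm_ge0// ler_pM ?nrm_ge0.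
  by rewrite le_eqVlt; apply/orP; left; apply/eqP; ring.
have nu : nrm (re u) + nrm (im u) <= 2 * U.
  by rewrite mulr_natl mulr2n lerD ?nrm_re ?nrm_im.
have nF1 : nrm (re Fu) <= 2 * U by exact: le_trans (nrm_fourier_re Lu Fou) nu.
have nF2 : nrm (im Fu) <= 2 * U by exact: le_trans (nrm_fourier_im Lu Fou) nu.
have cF1 : nrm (cut Af (re Fu)) <= Ef N beta Fu by exact: nrm_re_on.
have cF2 : nrm (cut Af (im Fu)) <= Ef N beta Fu by exact: nrm_im_on.
have Es0 : 0 <= Es N beta u by exact: l2norm_ge0.
have Ef0 : 0 <= Ef N beta Fu by exact: l2norm_ge0.
have fin := fin_aux Es0 Ef0 e0 U0 f0.
have pr := parseval_re Lu Fou g1 Sg; have pi_ := parseval_im Lu Fou g1 Sg.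
have space1 := space _ Su1 (nrm_re_on mAs Lu) (nrm_re Lu).
have space2 := space _ Su2 (nrm_im_on mAs Lu) (nrm_im Lu).
split.
- apply: (tri_aux (z := \int[mu]_k (re Fu k * ftc g k)) (t := - \int[mu]_k (im Fu k * fts g k)) (ltW nf0) space1).
    by rewrite pr mulVKf ?gt_eqF.
  rewrite normrN; apply: (sum_aux fin).
    exact: freq SF1 Sc cF1 nF1 nc SFc nFc.
  exact: freq SF2 Ss cF2 nF2 ns SFs nFs.
- apply: (tri_aux (z := \int[mu]_k (im Fu k * ftc g k)) (t := \int[mu]_k (re Fu k * fts g k)) (ltW nf0) space2).
    by rewrite pi_ mulVKf ?gt_eqF.
  apply: (sum_aux fin).
    exact: freq SF2 Sc cF2 nF2 nc SFc nFc.
  exact: freq SF1 Ss cF1 nF1 ns SFs nFs.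
Qed.

End KeyEstimate.

(** * Weak derivatives *)

Section Smooth.
Variable R : realType.
Local Notation mu := (@lebesgue_measure R).
Implicit Types (f g phi : R -> R) (x : R) (n k : nat) (p : {poly R}).

(** Carrying an explicit derivative at each order makes closure under sums, products and composition
    a direct induction; [Ck_derivable] returns to iterated [derive1n]. *)
Fixpoint Ck n f := if n is n'.+1 then
  exists2 f', (forall x, is_derive x 1 f (f' x)) & Ck n' f' else True.

Definition smooth f := forall n, Ck n f.

Lemma CkS n f : Ck n.+1 f -> Ck n f.
Proof. by elim: n f => [//|n IH] f [f' df cf]; exists f' => //; exact: IH. Qed.

Lemma CkD n f g : Ck n f -> Ck n g -> Ck n (fun x => f x + g x).
Proof.
elim: n f g => [//|n IH] f g [f' df cf] [g' dg cg].
by exists (fun x => f' x + g' x); [move=> x; exact: derD|exact: IH].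
Qed.

Lemma CkZ n (c : R) f : Ck n f -> Ck n (fun x => c * f x).
Proof.
elim: n f => [//|n IH] f [f' df cf].
by exists (fun x => c * f' x); [move=> x; exact: derZ|exact: IH].
Qed.

Lemma CkM n f g : Ck n f -> Ck n g -> Ck n (fun x => f x * g x).
Proof.
elim: n f g => [//|n IH] f g Cf Cg; have [f' df cf] := Cf; have [g' dg cg] := Cg.
exists (fun x => f' x * g x + f x * g' x); first by move=> x; exact: derM.
by apply: CkD; apply: IH => //; exact: CkS.
Qed.

Lemma Ck_comp n f g : Ck n f -> Ck n g -> Ck n (fun x => f (g x)).
Proof.
elim: n f g => [//|n IH] f g Cf Cg; have [f' df cf] := Cf; have [g' dg cg] := Cg.
exists (fun x => f' (g x) * g' x); first by move=> x; exact: der_comp.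
by apply: CkM => //; apply: IH => //; exact: CkS.
Qed.

Lemma smooth_poly p : smooth (horner p).
Proof.
move=> n; elim: n p => [//|n IH] p.
by exists (horner p^`()); [move=> x; exact: is_derive_poly|exact: IH].
Qed.

Lemma smooth_expR : smooth (@expR R).
Proof. by elim=> [//|n IH]; exists (@expR R) => // x; exact: is_derive_expR. Qed.

Lemma smoothM f g : smooth f -> smooth g -> smooth (fun x => f x * g x).
Proof. by move=> sf sg n; exact: CkM. Qed.

Lemma smooth_comp f g : smooth f -> smooth g -> smooth (fun x => f (g x)).
Proof. by move=> sf sg n; exact: Ck_comp. Qed.

Lemma smoothZ (c : R) f : smooth f -> smooth (fun x => c * f x).
Proof. by move=> sf n; exact: CkZ. Qed.

Lemma derive1_is f f' : (forall x, is_derive x 1 f (f' x)) -> derive1 f = f'.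
Proof. by move=> df; apply/funext => x; rewrite derive1E; exact: derive_val. Qed.

Lemma Ck_derivable n f x : Ck n.+1 f -> derivable (derive1n n f) x 1.
Proof.
elim: n f => [|n IH] f [f' df cf]; first by apply: ex_derive; exact: df.
by rewrite derive1Sn (derive1_is df); exact: IH.
Qed.

Lemma smooth_der f : smooth f -> forall x, is_derive x 1 f (derive1 f x).
Proof. by move=> /(_ 1%N) [f' df _]; rewrite (derive1_is df). Qed.

Lemma smooth_test f (M : R) : smooth f -> (forall x, M < `|x| -> f x = 0) -> test_fun f.
Proof.
move=> sf fM; split; last by exists M.
by move=> n x; apply: Ck_derivable; exact: sf.
Qed.

Lemma test_der phi x : test_fun phi -> is_derive x 1 phi (derive1 phi x).
Proof. by case=> d _; rewrite derive1E; apply: DeriveDef => //; exact: (d 0%N). Qed.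

Lemma test_derive1 phi : test_fun phi -> test_fun (derive1 phi).
Proof.
move=> tphi; have [d [M hM]] := tphi; split.
  by move=> n x; rewrite -derive1Sn; exact: d.
exists M => x Mx; rewrite derive1E.
have z : is_derive x 1 phi 0.
  apply: (near_eq_is_derive (f := cst (0 : R))).
  near=> y; rewrite hM//.
  by near: y; apply: (@cvgr_gt _ _ _ _ (fun y : R => `|y|) `|x|) => //; exact: norm_continuous.
exact: derive_val.
Unshelve. all: by end_near. Qed.

Lemma test_cont phi : test_fun phi -> continuous phi.
Proof. by move=> tphi x; exact: der_cont (test_der x tphi). Qed.

Lemma cont_compact_bounded f (M : R) : continuous f -> (forall x, M < `|x| -> f x = 0) ->
  exists K, forall x, `|f x| <= K.
Proof.
(* [M] may be negative, and the extreme value theorem needs a nonempty interval. *)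
move=> cf fM; pose m := Num.max 0 M.
have mm : - m <= m by rewrite ge0_cp// le_max lexx.
have cn : {within `[- m, m], continuous (fun x => `|f x|)}.
  apply: continuous_subspaceT => x; apply: continuous_comp; first exact: cf.
  exact: norm_continuous.
have [c _ hc] := EVT_max mm cn.
exists `|f c| => x; have [xm|xm] := leP `|x| m.
  by apply: hc; rewrite in_itv/= -ler_norml.
by rewrite fM ?normr0// (le_lt_trans _ xm)// le_max lexx orbT.
Qed.

Lemma test_bounded phi : test_fun phi -> exists K, forall x, `|phi x| <= K.
Proof. by move=> tphi; have [_ [M hM]] := tphi; exact: cont_compact_bounded (test_cont tphi) hM. Qed.

Lemma test_L1 phi : test_fun phi -> L1 phi.
Proof.
move=> tphi; have [_ [M hM]] := tphi; have [K hK] := test_bounded tphi.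
have -> : phi = fun x => \1_(`[- M, M]%classic : set R) x * phi x.
  apply/funext => x; rewrite indicE; have [xm|xm] := leP `|x| M.
    by rewrite mem_set ?mul1r//= in_itv/= -ler_norml.
  by rewrite hM// mulr0.
apply: (L1Mb (M := K)) => //; first exact: L1_indic_itv.
by apply: cont_meas; exact: test_cont.
Qed.

Lemma test_sqint phi : test_fun phi -> sqint phi.
Proof.
move=> tphi; have [K hK] := test_bounded tphi.
have mphi : measurable_fun setT phi by apply: cont_meas; exact: test_cont.
by split => //; under eq_fun do rewrite expr2; exact: L1Mb (test_L1 tphi) mphi hK.
Qed.

End Smooth.

(** * A smooth bump function *)

Section Bump.
Variable R : realType.
Local Notation mu := (@lebesgue_measure R).
Implicit Types (x : R) (n k : nat).

(** [k = 0] is the classical flat function. The powers of [1/x] make the family closed under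
    differentiation, so smoothness is an induction over all [k] at once. *)
Let flat k x : R := if 0 < x then x^-1 ^+ k * expR (- (x^-1 ^+ 2)) else 0.

(** Boundedness of [t^(k+2) exp(-t^2)] at [t = 1/x]. A quadratic bound is what makes the derivative
    at zero vanish. *)
Let flat_bound k : exists M, forall x, `|flat k x| <= M * x ^+ 2.
Proof.
have [M hM] := Xgw_bounded (ltr01 : (0 : R) < 1) k.+2 0.
have M0 : 0 <= M by exact: le_trans (hM 0).
exists M => x; rewrite /flat; case: ifPn => [x0|_]; last first.
  by rewrite normr0 mulr_ge0// sqr_ge0.
have := hM x^-1; rewrite /gw mul1r mul0r addr0 => h.
rewrite -ler_pdivrMr ?exprn_gt0//; apply: le_trans h.
rewrite -[x ^+ 2]gtr0_norm ?exprn_gt0// -normfV -normrM -exprVn.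
by rewrite !exprS expr0 mulr1 le_eqVlt; apply/orP; left; apply/eqP; congr Num.norm; ring.
Qed.

Let der_flat0 k : is_derive (0 : R) 1 (flat k) 0.
Proof.
have [M hM] := flat_bound k; have M0 : 0 <= M.
  by have := hM 1; rewrite expr1n mulr1; exact: le_trans.
have f0 : flat k 0 = 0 by rewrite /flat ltxx.
have cv : h^-1 *: ((flat k \o shift 0) (h *: 1) - flat k 0) @[h --> 0^'] --> (0 : R).
  apply/cvgr0Pnorm_le => e e0; near=> h.
  rewrite /= f0 subr0 addr0 [h *: 1]mulr1 normrM.
  have h0 : h != 0 by near: h; exact: nbhs_dnbhs_neq.
  rewrite normfV mulrC ler_pdivrMr ?normr_gt0//.
  apply: le_trans (hM h) _.
  rewrite -[h ^+ 2]real_normK ?num_real// expr2 mulrA ler_wpM2r//.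
  apply: (@le_trans _ _ ((M + 1) * `|h|)); first by rewrite ler_wpM2r// lerDl.
  rewrite mulrC -ler_pdivlMr ?ltr_wpDl//.
  near: h; apply: dnbhs0_le; rewrite divr_gt0// ltr_wpDl//.
apply: DeriveDef; first by apply/cvg_ex; exists 0; exact: cv.
by apply/cvg_lim => //; exact: cv.
Unshelve. all: by end_near. Qed.

Let der_flat k x : is_derive x 1 (flat k) (- k%:R * flat k.+1 x + 2 * flat k.+3 x).
Proof.
have [x0|x0|->] := ltgtP x 0.
- rewrite {2 3}/flat !ifN -?leNgt ?(ltW x0)// !mulr0 addr0.
  apply: (near_eq_is_derive (f := cst (0 : R))).
  near=> y; rewrite /flat ifN// -leNgt ltW//.
  by near: y; exact: lt_nbhsl.
- rewrite {2 3}/flat x0.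
  apply: (near_eq_is_derive (f := fun y : R => y^-1 ^+ k * expR (- (y^-1 ^+ 2)))).
    near=> y; rewrite /flat ifT//.
    by near: y; exact: lt_nbhsr.
  have xn0 : x != 0 by rewrite gt_eqF.
  have di : is_derive x 1 (fun y : R => y^-1) (- (x^-1 ^+ 2)).
    by apply: der_eq (is_deriveV _ (is_derive_id x 1)) _ => //; rewrite /GRing.scale/= mulr1 exprVn.
  have dX j : is_derive x 1 (fun y : R => y^-1 ^+ j) (- j%:R * x^-1 ^+ j.+1).
    elim: j => [|j IH].
      by rewrite oppr0 mul0r; exact: is_derive_cst.
    have := derM di IH; under eq_fun do rewrite -exprS.
    move/der_eq; apply; rewrite -[in RHS]natr1 !exprS; ring.
  have dN : is_derive x 1 (fun y : R => - (y^-1 ^+ 2)) (2 * x^-1 ^+ 3).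
    have := derZ (-1) (dX 2); under eq_fun do rewrite mulN1r.
    by move/der_eq; apply; ring.
  apply: der_eq (derM (dX k) (der_comp (is_derive_expR _) dN)) _.
  rewrite !exprS; ring.
- by rewrite /flat !ltxx !mulr0 addr0; exact: der_flat0.
Unshelve. all: by end_near. Qed.

Let smooth_flat k : smooth (flat k).
Proof.
move=> n; elim: n k => [//|n IH] k.
exists (fun x => - k%:R * flat k.+1 x + 2 * flat k.+3 x); first exact: der_flat.
by apply: CkD; apply: CkZ; exact: IH.
Qed.

Lemma bump_exists : exists beta : R -> R,
  [/\ smooth beta, beta 0 = 1 & forall x, 1 < `|x| -> beta x = 0].
Proof.
pose p : {poly R} := 1 - 'X^2.
have pE x : p.[x] = 1 - x ^+ 2 by rewrite /p hornerD hornerN hornerC hornerXn.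
have f1 : flat 0 1 != 0 by rewrite /flat ltr01 expr0 mul1r gt_eqF ?expR_gt0.
exists (fun x => (flat 0 1)^-1 * flat 0 p.[x]); split.
- apply: smoothZ; exact: smooth_comp (smooth_flat 0) (smooth_poly p).
- by rewrite pE expr0n/= subr0 mulVf.
- move=> x x1; suff h : p.[x] <= 0
    by rewrite /flat; move: h; rewrite leNgt => /negbTE ->; rewrite mulr0.
  rewrite pE subr_le0.
  by rewrite -real_normK ?num_real// -[leLHS](expr1n _ 2) lerXn2r ?nnegrE// ltW.
Qed.

End Bump.

(** * Testing weak derivatives against functions without compact support *)

Section WeakDerivative.
Variable R : realType.
Local Notation mu := (@lebesgue_measure R).
Implicit Types (f g h d phi psi : R -> R) (u v : R -> R[i]) (x b : R) (p q : {poly R}).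

Definition weak_deriv f g := forall phi, test_fun phi ->
  \int[mu]_x (f x * derive1 phi x) = - \int[mu]_x (g x * phi x).

Lemma Re_mulr_real (z : R[i]) (r : R) : complex.Re (z * r%:C%C) = complex.Re z * r.
Proof. by case: z => a c /=; rewrite mulr0 subr0. Qed.

Lemma Im_mulr_real (z : R[i]) (r : R) : complex.Im (z * r%:C%C) = complex.Im z * r.
Proof. by case: z => a c /=; rewrite mulr0 add0r. Qed.

Lemma weak_deriv_re_im u v : is_weak_deriv u v -> weak_deriv (re u) (re v) /\ weak_deriv (im u) (im v).
Proof.
move=> h; split=> phi tphi; have := h phi tphi.
  move/(congr1 (@complex.Re R)) => /=.
  by under eq_int do rewrite Re_mulr_real; under [in RHS]eq_int do rewrite Re_mulr_real.
move/(congr1 (@complex.Im R)) => /=.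
by under eq_int do rewrite Im_mulr_real; under [in RHS]eq_int do rewrite Im_mulr_real.
Qed.

(** Dilations [x / (m+1)] of one bump; the chain rule gives the factor [1/(m+1)] in the
    derivative. *)
Lemma cutoffs : exists (chi : nat -> R -> R) (K : R),
  [/\ forall m, smooth (chi m),
      forall m x, m.+1%:R < `|x| -> chi m x = 0,
      forall m x, `|chi m x| <= K,
      forall m x, `|derive1 (chi m) x| <= K / m.+1%:R &
      forall x, chi m x @[m --> \oo] --> (1 : R)].
Proof.
have [beta [sb b0 b1]] := bump_exists R.
have tb : test_fun beta by exact: smooth_test sb b1.
have [K1 hK1] := test_bounded tb; have [K2 hK2] := test_bounded (test_derive1 tb).
have dl m x : is_derive x 1 (fun y : R => m.+1%:R^-1 * y) m.+1%:R^-1.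
  by apply: der_eq (derZ m.+1%:R^-1 (is_derive_id x 1)) _; rewrite mulr1.
have dchi m x : is_derive x 1 (fun y => beta (m.+1%:R^-1 * y))
    (derive1 beta (m.+1%:R^-1 * x) * m.+1%:R^-1).
  by apply: der_comp => //; exact: smooth_der.
exists (fun m x => beta (m.+1%:R^-1 * x)), (Num.max K1 K2); split.
- move=> m; apply: smooth_comp => // n.
  have := smooth_poly ((m.+1%:R^-1 : R) *: 'X) n.
  rewrite (_ : horner _ = fun y => m.+1%:R^-1 * y)//.
  by apply/funext => x; rewrite hornerZ hornerX.
- move=> m x mx; apply: b1; rewrite normrM gtr0_norm ?invr_gt0//.
  by rewrite mulrC ltr_pdivlMr ?mul1r.
- by move=> m x; rewrite le_max hK1.
- move=> m x; rewrite (derive1_is (dchi m)) normrM [X in _ * X]gtr0_norm ?invr_gt0//.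
  by rewrite ler_wpM2r ?invr_ge0// le_max hK2 orbT.
- move=> x; suff: beta (m.+1%:R^-1 * x) @[m --> \oo] --> beta 0 by rewrite b0.
  apply: continuous_cvg; first exact: test_cont.
  rewrite -[X in _ --> X](mul0r x); apply: cvgM; last exact: cvg_cst.
  exact: cvg_harmonic.
Qed.

(** Hermite functions are not compactly supported, so [chi m * psi] is tested instead and [m] sent
    to infinity; the term with the derivative of [chi m] is [O(1/m)]. *)
Lemma weak_deriv_ext f g psi : weak_deriv f g -> sqint f -> sqint g -> smooth psi ->
  sqint psi -> sqint (derive1 psi) ->
  \int[mu]_x (f x * derive1 psi x) = - \int[mu]_x (g x * psi x).
Proof.
move=> wfg sf sg sp qp qdp; have [chi [K [sc c0 cK dcK cc]]] := cutoffs.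
have K0 : 0 <= K by exact: le_trans (cK 0%N 0).
have mchi m : measurable_fun setT (chi m).
  by apply: cont_meas => x; exact: der_cont (smooth_der (sc m) x).
have tchi m : test_fun (chi m) by exact: smooth_test (sc m) (c0 m).
have mdchi m : measurable_fun setT (derive1 (chi m)).
  by apply: cont_meas; exact: test_cont (test_derive1 (tchi m)).
have tm m : test_fun (fun x => chi m x * psi x).
  apply: (@smooth_test _ _ m.+1%:R); first exact: smoothM.
  by move=> x mx; rewrite c0 ?mul0r.
have dE m : derive1 (fun x => chi m x * psi x) =
    fun x => derive1 (chi m) x * psi x + chi m x * derive1 psi x.
  by apply: derive1_is => x; apply: derM; exact: smooth_der.
have [_ A] : L1 (fun x => f x * derive1 psi x) /\
    \int[mu]_x (f x * derive1 (fun x => chi m x * psi x) x) @[m --> \oo] -->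
    \int[mu]_x (f x * derive1 psi x).
  apply: (@dominated_cvg _ _ _ (fun x => K * `|f x * psi x| + K * `|f x * derive1 psi x|)).
  - move=> m; apply: measurable_funM; first exact: sf.1.
    by apply: cont_meas; exact: test_cont (test_derive1 (tm m)).
  - move=> x; apply: cvgM; first exact: cvg_cst.
    have d0 : derive1 (chi m) x @[m --> \oo] --> (0 : R).
      apply: norm_cvg0; apply: (@squeeze_cvgr _ _ _ _ (fun=> 0) (fun m : nat => K * m.+1%:R^-1)).
      + by near=> m; rewrite normr_ge0 dcK.
      + exact: cvg_cst.
      + rewrite -[X in _ --> X](mulr0 K); apply: cvgM; [exact: cvg_cst|exact: cvg_harmonic].
    rewrite (_ : (fun m => derive1 (fun x => chi m x * psi x) x) =
      fun m => derive1 (chi m) x * psi x + chi m x * derive1 psi x); last first.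
      by apply/funext => m; rewrite dE.
    rewrite -[X in _ --> X]add0r -[X in _ --> X + _](mul0r (psi x)) -[X in _ --> _ + X]mul1r.
    by apply: cvgD; apply: cvgM => //; exact: cvg_cst.
  - by apply: L1D; apply: L1Z; apply: L1_norm; exact: sqintM.
  - move=> m x; rewrite dE mulrDr; apply: le_trans (ler_normD _ _) _; apply: lerD.
      rewrite mulrCA normrM ler_wpM2r//; apply: le_trans (dcK m x) _.
      by rewrite ler_pdivrMr// ler_peMr// ler1n.
    by rewrite mulrCA normrM ler_wpM2r.
have [_ B] : L1 (fun x => g x * psi x) /\
    \int[mu]_x (g x * (chi m x * psi x)) @[m --> \oo] --> \int[mu]_x (g x * psi x).
  apply: (@dominated_cvg _ _ _ (fun x => K * `|g x * psi x|)).
  - move=> m; apply: measurable_funM; first exact: sg.1.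
    by apply: measurable_funM; [exact: mchi|exact: qp.1].
  - move=> x; apply: cvgM; first exact: cvg_cst.
    rewrite -[X in _ --> X]mul1r; apply: cvgM; [exact: cc|exact: cvg_cst].
  - by apply: L1Z; apply: L1_norm; exact: sqintM.
  - by move=> m x; rewrite mulrCA normrM ler_wpM2r.
have A' : (fun m => \int[mu]_x (f x * derive1 (fun x => chi m x * psi x) x)) =
    fun m => - \int[mu]_x (g x * (chi m x * psi x)).
  by apply/funext => m; exact: wfg.
apply: (cvg_unique _ A) => //; rewrite A'; exact: cvgN.
Unshelve. all: by end_near. Qed.

Let smooth_pdf x (s : R) : s != 0 -> smooth (normal_pdf x s).
Proof.
move=> s0; pose r : {poly R} := - (s ^+ 2 *+ 2)^-1 *: ('X - x%:P) ^+ 2.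
have -> : normal_pdf x s = fun y => normal_peak s * expR r.[y].
  apply/funext => y; rewrite pdfE// /r hornerZ horner_exp hornerXsubC.
  by congr (_ * expR _); rewrite mulNr mulNr mulrC.
by apply: smoothZ; apply: smooth_comp; [exact: smooth_expR|exact: smooth_poly].
Qed.

(** A cut-off times a normal density is a test function, so [heat] annihilates [d * chi m] at every
    scale; [heat_approx_id] then gives [d * chi m] norm zero. The conclusion is stated as a pairing,
    the form in which uniqueness is applied. *)
Lemma du_bois_reymond d h : sqint d ->
  (forall phi, test_fun phi -> \int[mu]_x (d x * phi x) = 0) ->
  sqint h -> \int[mu]_x (d x * h x) = 0.
Proof.
move=> sd d0 sh; have [chi [K [sc c0 cK dcK cc]]] := cutoffs.
have tchi m : test_fun (chi m) by exact: smooth_test (sc m) (c0 m).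
have mchi m : measurable_fun setT (chi m) by apply: cont_meas; exact: test_cont.
pose e m x := d x * chi m x.
have Le m : L1 (e m) by apply: sqintM => //; exact: test_sqint.
have se m : sqint (e m) by exact: sqintMb sd (mchi m) (cK m).
have heat0 m n x : heat n.+1%:R^-1 (e m) x = 0.
  rewrite /heat /e; under eq_int do rewrite -mulrA.
  apply: d0; apply: (@smooth_test _ _ m.+1%:R).
    by apply: smoothM => //; apply: smooth_pdf; rewrite invr_eq0.
  by move=> y my; rewrite c0 ?mul0r.
have n0 m : nrm (e m) = 0.
  have := heat_approx_id (Le m) (se m) (Le m) (se m).
  under eq_fun do (under eq_int do rewrite heat0 mulr0).
  move=> H; rewrite /nrm /nrm2; under eq_int do rewrite expr2.
  have <- := cvg_lim (@Rhausdorff R) H.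
  have -> : (fun=> \int[mu]_x (0 : R)) = fun _ : nat => (0 : R).
    by apply/funext => _; rewrite Rintegral_cst// mul0r.
  by rewrite lim_cst// sqrtr0.
have i0 m : \int[mu]_x (e m x * h x) = 0.
  by apply/eqP; rewrite -normr_le0; have := cauchy_schwarz (se m) sh; rewrite n0 mul0r.
have [_ B] : L1 (fun x => d x * h x) /\
    \int[mu]_x (e m x * h x) @[m --> \oo] --> \int[mu]_x (d x * h x).
  apply: (@dominated_cvg _ _ _ (fun x => K * `|d x * h x|)).
  - by move=> m; apply: measurable_funM; [exact: (se m).1|exact: sh.1].
  - move=> x; apply: cvgM; last exact: cvg_cst.
    rewrite -[X in _ --> X]mulr1; apply: cvgM; [exact: cvg_cst|exact: cc].
  - by apply: L1Z; apply: L1_norm; exact: sqintM.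
  - by move=> m x; rewrite /e mulrAC normrM mulrC ler_wpM2r.
rewrite -(cvg_lim (@Rhausdorff R) B).
by under eq_fun do rewrite i0; rewrite lim_cst.
Qed.

Lemma derive1_hfun b p : 0 < b -> derive1 (hfun b p) = hfun b (dfun b p).
Proof. by move=> b0; apply: derive1_is => x; exact: der_hfun. Qed.

Lemma smooth_hfun b p : smooth (hfun b p).
Proof.
have -> : hfun b p = fun x => expR ((- (b / 2)) *: 'X^2).[x] * p.[x].
  apply/funext => x; rewrite /hfun hornerZ hornerXn.
  by congr (expR _ * _); ring.
apply: smoothM; last exact: smooth_poly.
by apply: smooth_comp; [exact: smooth_expR|exact: smooth_poly].
Qed.

Lemma weak_deriv_hfun b p : 0 < b -> weak_deriv (hfun b p) (hfun b (dfun b p)).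
Proof.
move=> b0 phi tphi; have [_ [M hM]] := tphi.
have dphi := test_derive1 tphi.
have L1a : L1 (fun x => hfun b (dfun b p) x * phi x).
  by apply: sqintM; [exact: sqint_hfun|exact: test_sqint].
have L1b : L1 (fun x => hfun b p x * derive1 phi x).
  by apply: sqintM; [exact: sqint_hfun|exact: test_sqint].
have : \int[mu]_x (hfun b (dfun b p) x * phi x + hfun b p x * derive1 phi x) = 0.
  apply: (@int_derive0 _ (fun x => hfun b p x * phi x)
    (fun x => hfun b (dfun b p) x * phi x + hfun b p x * derive1 phi x)).
  - by move=> x; apply: derM; [exact: der_hfun|exact: test_der].
  - move=> x; apply: cvgD; apply: cvgM.
    + exact: cont_hfun.
    + exact: test_cont.
    + exact: cont_hfun.
    + exact: test_cont.
  - exact: L1D.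
  - apply: cvg_near_cst; near=> n; rewrite hM ?mulr0// normr_nat.
    by near: n; exact: nbhs_infty_gtr.
  - apply: cvg_near_cst; near=> n; rewrite hM ?mulr0// normrN normr_nat.
    by near: n; exact: nbhs_infty_gtr.
by rewrite intD// => /eqP; rewrite addrC addr_eq0 => /eqP.
Unshelve. all: by end_near. Qed.

Lemma weak_derivB f g f' g' : sqint f -> sqint g -> sqint f' -> sqint g' -> weak_deriv f f' -> weak_deriv g g' ->
  weak_deriv (fun x => f x - g x) (fun x => f' x - g' x).
Proof.
move=> sf sg sf' sg' wf wg phi tphi.
have qp := test_sqint tphi; have qdp := test_sqint (test_derive1 tphi).
under eq_int do rewrite mulrBl; under [in RHS]eq_int do rewrite mulrBl.
rewrite (intB (sqintM sf qdp) (sqintM sg qdp)) (intB (sqintM sf' qp) (sqintM sg' qp)).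
by rewrite wf// wg// opprB opprK addrC.
Qed.

Lemma weak_deriv_unique f g g' h : sqint g -> sqint g' -> sqint h -> weak_deriv f g -> weak_deriv f g' ->
  \int[mu]_x (g x * h x) = \int[mu]_x (g' x * h x).
Proof.
move=> sg sg' sh wg wg'; apply/eqP; rewrite -subr_eq0 -intB; [|exact: sqintM..].
under eq_int do rewrite -mulrBl.
apply/eqP; apply: (du_bois_reymond (d := fun x => g x - g' x)) => //; first exact: sqintB.
move=> phi tphi; have qp := test_sqint tphi.
under eq_int do rewrite mulrBl.
rewrite intB; [|exact: sqintM..].
by apply/eqP; rewrite subr_eq0 -eqr_opp -wg// -wg'.
Qed.

End WeakDerivative.

(** * The projection error *)

Section Projection.
Variable R : realType.
Local Notation mu := (@lebesgue_measure R).
Implicit Types (e f g h v w : R -> R) (u : R -> R[i]) (b x K L : R) (q r : {poly R}) (m n N : nat).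

Let Re_horner (psi : {poly R[i]}) x :
  complex.Re psi.[x%:C%C] = (\poly_(i < size psi) complex.Re psi`_i).[x].
Proof.
rewrite horner_coef horner_poly raddf_sum/=; apply: eq_bigr => i _.
by rewrite -(rmorphXn (real_complex R)) Re_mulr_real.
Qed.

Let Im_horner (psi : {poly R[i]}) x :
  complex.Im psi.[x%:C%C] = (\poly_(i < size psi) complex.Im psi`_i).[x].
Proof.
rewrite horner_coef horner_poly raddf_sum/=; apply: eq_bigr => i _.
by rewrite -(rmorphXn (real_complex R)) Im_mulr_real.
Qed.

(** Testing with real polynomials makes the conjugation trivial and separates real and imaginary
    parts. *)
Lemma is_proj_re_im N (beta : R) u p : is_proj N beta u p ->
  exists p1 p2 : {poly R}, [/\ (size p1 <= N.+1)%N, (size p2 <= N.+1)%N,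
    re p = hfun (beta ^+ 2) p1, im p = hfun (beta ^+ 2) p2 &
    orth (beta ^+ 2) N.+1 (fun x => re u x - re p x) /\
    orth (beta ^+ 2) N.+1 (fun x => im u x - im p x)].
Proof.
case=> [[psi [spsi pE]] op].
exists (\poly_(i < size psi) complex.Re psi`_i), (\poly_(i < size psi) complex.Im psi`_i).
split.
- exact: leq_trans (size_poly _ _) _.
- exact: leq_trans (size_poly _ _) _.
- by apply/funext => x; rewrite /re pE mulrC Re_mulr_real Re_horner mulrC.
- by apply/funext => x; rewrite /im pE mulrC Im_mulr_real Im_horner mulrC.
have hq r : (size r <= N.+1)%N ->
    cint setT (fun x => (u x - p x) * (hfun (beta ^+ 2) r x)%:C%C) = 0.
  move=> sr; rewrite -[RHS](op (fun x => (hfun (beta ^+ 2) r x)%:C%C)).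
    by congr cint; apply/funext => x; rewrite conjc_real.
  exists (map_poly (real_complex R) r); split.
    by rewrite size_map_poly.
  by move=> x; rewrite horner_map/= -rmorphM.
split=> r sr; have := hq r sr.
  move/(congr1 (@complex.Re R)) => /= <-; apply: eq_int => x.
  by rewrite Re_mulr_real raddfB.
move/(congr1 (@complex.Im R)) => /= <-; apply: eq_int => x.
by rewrite Im_mulr_real raddfB.
Qed.

Lemma orth_le b m n f : (m <= n)%N -> orth b n f -> orth b m f.
Proof. by move=> mn of_ r sr; apply: of_; exact: leq_trans mn. Qed.

Let nrm_le_of_sqr f K : 0 <= K -> nrm2 f <= K * nrm f -> nrm f <= K.
Proof.
move=> K0; rewrite -nrm_sqr expr2; have [->//|f0] := eqVneq (nrm f) 0.
by rewrite ler_pM2r// lt_def f0 nrm_ge0.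
Qed.

Lemma best_approx_bound b m f v q K : 0 < b -> 0 <= K -> sqint v ->
  (size q <= m)%N -> (forall x, f x = v x - hfun b q x) -> orth b m f ->
  `|\int[mu]_x (v x * f x)| <= K * nrm f -> nrm f <= K.
Proof.
move=> b0 K0 sv sq fE of_ hv; apply: nrm_le_of_sqr => //.
have sp := sqint_hfun b0 q.
have sf : sqint f by rewrite (_ : f = fun x => v x - hfun b q x); [exact: sqintB|exact/funext].
apply: le_trans hv; apply: le_trans (ler_norm _).
have := of_ q sq; have := intB (sqintM sv sf) (sqintM sp sf).
rewrite (eq_int (g := fun x => f x ^+ 2)); last by move=> x; rewrite -mulrBl -fE expr2.
rewrite (eq_int (f := fun x => hfun b q x * f x) (g := fun x => f x * hfun b q x)); last first.
  by move=> x; rewrite mulrC.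
by rewrite /nrm2 => -> ->; rewrite subr0.
Qed.

(** The common core of both derivative estimates. [w] is split into its projection [hfun b r] and a
    remainder [g]; pairing [w] with [g] loses [q] by orthogonality and is controlled by [K], pairing
    [w] with the projection by [L]. [w] and [e - hfun b q] are identified only through pairings, as
    for weak derivatives. *)
Lemma weak_derivative_bound b m e w q K L : 0 < b -> 0 <= K -> 0 <= L ->
  sqint e -> sqint w -> (size q <= m)%N ->
  (forall h, sqint h ->
    \int[mu]_x (w x * h x) = \int[mu]_x ((e x - hfun b q x) * h x)) ->
  (forall g, sqint g -> orth b m g -> `|\int[mu]_x (e x * g x)| <= K * nrm g) ->
  (forall r, (size r <= m)%N -> `|\int[mu]_x (w x * hfun b r x)| <= L * nrm (hfun b r)) ->
  nrm w <= K + L.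
Proof.
move=> b0 K0 L0 se sw sq wE he hw.
have [r [sr og]] := proj_exists b0 m sw.
pose g x := w x - hfun b r x.
have shr := sqint_hfun b0 r; have shq := sqint_hfun b0 q.
have sg : sqint g by exact: sqintB.
have g0 (t : {poly R}) : (size t <= m)%N -> \int[mu]_x (hfun b t x * g x) = 0.
  by move=> st; rewrite -(og _ st); apply: eq_int => x; rewrite mulrC.
have Kg : nrm g <= K.
  apply: (@best_approx_bound b m g w r) => //.
  rewrite wE//; under eq_int do rewrite mulrBl.
  by rewrite (intB (sqintM se sg) (sqintM shq sg)) g0// subr0 he.
have Lr : nrm (hfun b r) <= L.
  apply: nrm_le_of_sqr => //; apply: le_trans (hw _ sr); apply: le_trans (ler_norm _).
  have := intB (sqintM sw shr) (sqintM sg shr).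
  rewrite (og _ sr) subr0 => <-; rewrite le_eqVlt; apply/orP; left; apply/eqP.
  by apply: eq_int => x; rewrite /g; ring.
apply: le_trans (lerD Kg Lr); rewrite (_ : w = fun x => g x + hfun b r x); first exact: nrmD.
by apply/funext => x; rewrite /g subrK.
Qed.

End Projection.

(** * One real component of the projection error *)

Section Components.
Variables (R : realType) (N : nat) (beta : R).
Hypotheses (N1 : (1 <= N)%N) (beta0 : 0 < beta).
Local Notation mu := (@lebesgue_measure R).
Local Notation b := (beta ^+ 2).
Implicit Types (v dv ddv f g w : R -> R) (p r : {poly R}) (K : R).

Let b0 : 0 < b. Proof. exact: exprn_gt0. Qed.
Let M := beta * Num.sqrt N%:R.
Let M0 : 0 <= M. Proof. by rewrite mulr_ge0 ?sqrtr_ge0// ltW. Qed.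

Let M3_ge0 : 0 <= 3 * M. Proof. by apply: mulr_ge0. Qed.

(** Degree at most [N + 3] gives [2 (N + 3) + 1 <= 9 N] for [N >= 1], hence the [3]. Size [N.+4] is
    what [dfun b r] can reach when [r] has size [N.+3], as in [component_error2]. *)
Let bernstein r : (size r <= N.+4)%N -> nrm (hfun b (dfun b r)) <= 3 * M * nrm (hfun b r).
Proof.
move=> sr; have h := nrm2_dfun b0 sr.
have k0 : 0 <= 3 * M * nrm (hfun b r) by apply: mulr_ge0 (nrm_ge0 _).
rewrite -[leLHS]ger0_norm ?nrm_ge0// -[leRHS]ger0_norm//.
rewrite -ler_sqr ?nnegrE// !real_normK ?num_real// nrm_sqr; apply: le_trans h _.
rewrite !exprMn nrm_sqr sqr_sqrtr ?ler0n// ler_wpM2r ?nrm2_ge0//.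
rewrite mulrCA ler_wpM2l ?(ltW b0)// -natrM natr1 -natrX -natrM ler_nat.
lia.
Qed.

Let weak_deriv_moment f w r : sqint f -> sqint w -> weak_deriv f w ->
  \int[mu]_x (w x * hfun b r x) = - \int[mu]_x (f x * hfun b (dfun b r) x).
Proof.
move=> sf sw fw; rewrite -(derive1_hfun _ b0) (weak_deriv_ext fw)// ?opprK//.
- exact: smooth_hfun.
- exact: sqint_hfun.
- by rewrite derive1_hfun//; exact: sqint_hfun.
Qed.

(** The norm of [v] as a functional on the complement of [P_N], that is, its distance to [P_N]. In
    this form a bound passes at once to the smaller complements of [P_{N+1}] and [P_{N+2}]. *)
Definition dual_bounded v K := forall g, sqint g -> orth b N.+1 g ->
  `|\int[mu]_x (v x * g x)| <= K * nrm g.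

Variables (v : R -> R) (p : {poly R}).
Hypotheses (sv : sqint v) (sp : (size p <= N.+1)%N).
Let f x := v x - hfun b p x.
Hypothesis of_ : orth b N.+1 f.

Let sf : sqint f. Proof. by apply: sqintB => //; exact: sqint_hfun. Qed.

Lemma component_error K : 0 <= K -> dual_bounded v K -> nrm f <= K.
Proof. by move=> K0 hv; apply: (best_approx_bound b0 K0 sv sp) => //; exact: hv. Qed.

Let weak_deriv_f dv : sqint dv -> weak_deriv v dv -> weak_deriv f (fun x => dv x - hfun b (dfun b p) x).
Proof. by move=> sdv vdv; apply: weak_derivB => //; [exact: sqint_hfun..|exact: weak_deriv_hfun]. Qed.

Lemma component_error1 dv w K : 0 <= K -> sqint dv -> sqint w -> weak_deriv v dv -> weak_deriv f w ->
  dual_bounded dv K -> nrm w <= K + 3 * M * nrm f.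
Proof.
move=> K0 sdv sw vdv fw hdv.
have shd := sqint_hfun b0 (dfun b p).
(* Size [N.+2] is degree at most [N + 1], the degree that [dfun b p] can reach. *)
apply: (weak_derivative_bound (b := b) (m := N.+2) (e := dv) (q := dfun b p)) => //.
- exact: mulr_ge0 (nrm_ge0 _).
- exact: size_dfun.
- by move=> h sh; apply: (weak_deriv_unique sw _ sh fw); [exact: sqintB|exact: weak_deriv_f].
- by move=> g sg og; apply: hdv => //; exact: orth_le og.
move=> r sr; rewrite (weak_deriv_moment _ sf)// normrN.
apply: le_trans (cauchy_schwarz sf (sqint_hfun b0 _)) _.
rewrite [leRHS]mulrAC [leLHS]mulrC; apply: ler_wpM2r; first exact: nrm_ge0.
by apply: bernstein; apply: leq_trans sr (leq_addl 2 N.+2).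
Qed.

(** Two integrations by parts move both derivatives from [w2] to the Hermite function, so Bernstein
    is applied twice: [9 M^2 = (3 M)^2]. *)
Lemma component_error2 dv ddv w1 w2 K : 0 <= K -> sqint dv -> sqint ddv ->
  sqint w1 -> sqint w2 -> weak_deriv v dv -> weak_deriv dv ddv -> weak_deriv f w1 -> weak_deriv w1 w2 ->
  dual_bounded ddv K -> nrm w2 <= K + 9 * M ^+ 2 * nrm f.
Proof.
move=> K0 sdv sddv sw1 sw2 vdv dvddv fw1 w12 hddv.
have shd := sqint_hfun b0 (dfun b p); have shdd := sqint_hfun b0 (dfun b (dfun b p)).
have sp1 := size_dfun b sp.
have sdf : sqint (fun x => dv x - hfun b (dfun b p) x) by exact: sqintB.
(* [w2] is given as a derivative of [w1]; uniqueness lets [dv - hfun b (dfun b p)] take the place of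
   [w1] against test functions. *)
have dfw2 : weak_deriv (fun x => dv x - hfun b (dfun b p) x) w2.
  move=> phi tphi; rewrite -(w12 _ tphi).
  by apply: (weak_deriv_unique sdf sw1 _ (weak_deriv_f sdv vdv) fw1); apply: test_sqint; exact: test_derive1.
have dfd : weak_deriv (fun x => dv x - hfun b (dfun b p) x)
    (fun x => ddv x - hfun b (dfun b (dfun b p)) x).
  by apply: weak_derivB => //; exact: weak_deriv_hfun.
have M9 : 0 <= 9 * M ^+ 2 by apply: mulr_ge0 => //; exact: sqr_ge0.
apply: (weak_derivative_bound (b := b) (m := N.+3) (e := ddv) (q := dfun b (dfun b p))) => //.
- exact: mulr_ge0 (nrm_ge0 _).
- exact: size_dfun.
- by move=> h sh; apply: (weak_deriv_unique sw2 _ sh dfw2); [exact: sqintB|exact: dfd].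
- by move=> g sg og; apply: hddv => //; exact: orth_le (leq_addl 2 N.+1) og.
move=> r sr; rewrite (weak_deriv_moment _ sw1)// (weak_deriv_moment _ sf)// opprK.
apply: le_trans (cauchy_schwarz sf (sqint_hfun b0 _)) _.
rewrite [leRHS]mulrAC [leLHS]mulrC; apply: ler_wpM2r; first exact: nrm_ge0.
apply: le_trans (bernstein (size_dfun b sr)) _.
rewrite (_ : 9 * M ^+ 2 * _ = 3 * M * (3 * M * nrm (hfun b r))); last by ring.
by apply: ler_wpM2l => //; apply: bernstein; exact: leq_trans sr _.
Qed.

End Components.

(** * From components to the complex error bounds *)

Section Errors.
Variable R : realType.
Implicit Types (u v w Fu : R -> R[i]) (N : nat) (beta : R).

Lemma sqint_L2 u : sqint (re u) -> sqint (im u) -> L2 u.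
Proof.
move=> [m1 i1] [m2 i2]; do 2 split => //.
by have /L1_EFin -> := L1D i1 i2; exact: ltry.
Qed.

Lemma EN_ge0 N beta u Fu : 0 <= EN N beta u Fu.
Proof.
apply: addr_ge0; first by apply: addr_ge0; exact: sqrtr_ge0.
by apply: mulr_ge0; [exact: sqrtr_ge0|exact: expR_ge0].
Qed.

Lemma dual_bounded_re_im N beta u Fu : (1 <= N)%N -> 0 < beta -> L2 u -> is_fourier u Fu ->
  dual_bounded N beta (re u) (130 * EN N beta u Fu) /\
  dual_bounded N beta (im u) (130 * EN N beta u Fu).
Proof.
by move=> N1 beta0 Lu Fou; split=> g sg og; have [] := key_estimate N1 beta0 Lu Fou sg og.
Qed.

(** [c] will be the Bernstein factor, [3] or [9], and [n] the norm of the undifferentiated error;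
    the larger factor gives one constant for both orders. *)
Lemma error_combine (a c n E E' K M : R) : 0 <= K -> 0 <= M -> 0 <= E -> 0 <= E' ->
  0 <= c <= 9 -> a <= K * E + c * M * n -> n <= K * E' -> a <= 9 * K * (E + M * E').
Proof.
move=> K0 M0 E0 E'0 /andP[c0 c9] ha hn; apply: le_trans ha _.
rewrite mulrDr lerD//; first by rewrite ler_wpM2r// ler_peMl// ler1n.
apply: (@le_trans _ _ (c * M * (K * E'))).
  by rewrite ler_wpM2l// mulr_ge0.
rewrite (_ : 9 * K * (M * E') = 9 * M * (K * E')); last by ring.
by rewrite ler_wpM2r ?mulr_ge0// ler_wpM2r.
Qed.

End Errors.

Theorem theorem3p4 (R : realType) :
  exists C : R, 0 < C /\
  forall (N : nat) (beta : R), (1 <= N)%N -> 0 < beta ->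
  (* (i) *)
  (forall (u Fu p : R -> R[i]),
     L2 u -> is_fourier u Fu -> is_proj N beta u p ->
     l2norm (u \- p) <= C * EN N beta u Fu) /\
  (* (ii) u in H^1, du = u', w = (u - Pi u)' *)
  (forall (u du Fu Fdu p w : R -> R[i]),
     L2 u -> L2 du -> is_weak_deriv u du ->
     is_fourier u Fu -> is_fourier du Fdu -> is_proj N beta u p ->
     L2 w -> is_weak_deriv (u \- p) w ->
     l2norm w <= C * (EN N beta du Fdu + beta * Num.sqrt N%:R * EN N beta u Fu)) /\
  (* (iii) u in H^2, du = u', d2u = u'', w1 = (u - Pi u)', w2 = (u - Pi u)'' *)
  (forall (u du d2u Fu Fdu Fd2u p w1 w2 : R -> R[i]),
     L2 u -> L2 du -> L2 d2u -> is_weak_deriv u du -> is_weak_deriv du d2u ->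
     is_fourier u Fu -> is_fourier du Fdu -> is_fourier d2u Fd2u ->
     is_proj N beta u p ->
     L2 w1 -> is_weak_deriv (u \- p) w1 -> L2 w2 -> is_weak_deriv w1 w2 ->
     l2norm w2 <= C * (EN N beta d2u Fd2u + beta * EN N beta du Fdu
                       + beta ^+ 2 * N%:R * EN N beta u Fu)).
Proof.
set K : R := 130; have K0 : 0 < K by rewrite /K.
(* [2] adds the real and imaginary parts, [9] is the second-order Bernstein factor, and [K] is the
   constant of [key_estimate]. *)
exists (2 * (9 * K)); split; first by rewrite !mulr_gt0.
move=> N beta N1 beta0; set M := beta * Num.sqrt N%:R.
have M0 : 0 <= M by rewrite mulr_ge0 ?sqrtr_ge0// ltW.
have M2 : M ^+ 2 = beta ^+ 2 * N%:R by rewrite exprMn sqr_sqrtr.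
have KE w Fw : 0 <= K * EN N beta w Fw by rewrite mulr_ge0 ?EN_ge0// ltW.
have dual w Fw := @dual_bounded_re_im R N beta w Fw N1 beta0.
have reB u p q : re p = hfun (beta ^+ 2) q ->
    re (u \- p) = fun x => re u x - hfun (beta ^+ 2) q x.
  by move=> <-; apply/funext => x; rewrite /re raddfB.
have imB u p q : im p = hfun (beta ^+ 2) q ->
    im (u \- p) = fun x => im u x - hfun (beta ^+ 2) q x.
  by move=> <-; apply/funext => x; rewrite /im raddfB.
have base u Fu p : L2 u -> is_fourier u Fu -> is_proj N beta u p ->
    exists p1 p2 : {poly R},
    [/\ (size p1 <= N.+1)%N, (size p2 <= N.+1)%N,
        re (u \- p) = fun x => re u x - hfun (beta ^+ 2) p1 x,
        im (u \- p) = fun x => im u x - hfun (beta ^+ 2) p2 x &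
        [/\ orth (beta ^+ 2) N.+1 (re (u \- p)), orth (beta ^+ 2) N.+1 (im (u \- p)),
            nrm (re (u \- p)) <= K * EN N beta u Fu &
            nrm (im (u \- p)) <= K * EN N beta u Fu]].
  move=> Lu Fou /is_proj_re_im[p1 [p2 [sp1 sp2 ep1 ep2 []]]].
  rewrite ep1 ep2 => o1 o2; exists p1, p2.
  have [d1 d2] := dual _ _ Lu Fou; have [s1 s2] := L2_sqint Lu.
  rewrite (reB _ _ _ ep1) (imB _ _ _ ep2); split => //; split => //.
    exact: (component_error beta0 s1 sp1).
  exact: (component_error beta0 s2 sp2).
have twice a c E : a <= 9 * K * E -> c <= 9 * K * E -> a + c <= 2 * (9 * K) * E.
  by move=> ha hc; rewrite -mulrA mulr_natl mulr2n lerD.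
have c3 : 0 <= (3 : R) <= 9 by rewrite ler0n ler_nat.
have c9 : 0 <= (9 : R) <= 9 by rewrite ler0n lexx.
split; [|split].
- move=> u Fu p Lu Fou pp.
  have [p1 [p2 [sp1 sp2 e1 e2 []]]] := base _ _ _ Lu Fou pp => o1 o2 n1 n2.
  have [s1 s2] := L2_sqint Lu.
  have Lup : L2 (u \- p).
    apply: sqint_L2; [rewrite e1|rewrite e2]; apply: sqintB => //; apply: sqint_hfun;
    exact: exprn_gt0.
  apply: le_trans (l2norm_le Lup) _; apply: twice.
    by apply: le_trans n1 _; rewrite -mulrA ler_peMl// ler1n.
  by apply: le_trans n2 _; rewrite -mulrA ler_peMl// ler1n.
- move=> u du Fu Fdu p w Lu Ldu udu Fou Fodu pp Lw uw.
  have [p1 [p2 [sp1 sp2 e1 e2 []]]] := base _ _ _ Lu Fou pp => o1 o2 n1 n2.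
  have [d1 d2] := dual _ _ Ldu Fodu; have [s1 s2] := L2_sqint Lu.
  have [t1 t2] := L2_sqint Ldu; have [w1 w2] := L2_sqint Lw.
  have [a1 a2] := weak_deriv_re_im udu; have [b1 b2] := weak_deriv_re_im uw.
  rewrite e1 in b1 o1 n1; rewrite e2 in b2 o2 n2.
  have h1 := component_error1 N1 beta0 s1 sp1 (KE du Fdu) t1 w1 a1 b1 d1.
  have h2 := component_error1 N1 beta0 s2 sp2 (KE du Fdu) t2 w2 a2 b2 d2.
  apply: le_trans (l2norm_le Lw) _; apply: twice.
    exact: error_combine (ltW K0) M0 (EN_ge0 _ _ _ _) (EN_ge0 _ _ _ _) c3 h1 n1.
  exact: error_combine (ltW K0) M0 (EN_ge0 _ _ _ _) (EN_ge0 _ _ _ _) c3 h2 n2.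
- move=> u du d2u Fu Fdu Fd2u p v w Lu Ldu Ld2u udu dud2 Fou Fodu Fod2u pp Lv uv Lw vw.
  have [p1 [p2 [sp1 sp2 e1 e2 []]]] := base _ _ _ Lu Fou pp => o1 o2 n1 n2.
  have [d1 d2] := dual _ _ Ld2u Fod2u; have [s1 s2] := L2_sqint Lu.
  have [t1 t2] := L2_sqint Ldu; have [t1' t2'] := L2_sqint Ld2u.
  have [w1 w2] := L2_sqint Lw; have [v1 v2] := L2_sqint Lv.
  have [a1 a2] := weak_deriv_re_im udu; have [a1' a2'] := weak_deriv_re_im dud2.
  have [b1 b2] := weak_deriv_re_im uv; have [b1' b2'] := weak_deriv_re_im vw.
  rewrite e1 in b1 o1 n1; rewrite e2 in b2 o2 n2.
  have h1 := component_error2 N1 beta0 s1 sp1 (KE d2u Fd2u) t1 t1' v1 w1 a1 a1' b1 b1' d1.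
  have h2 := component_error2 N1 beta0 s2 sp2 (KE d2u Fd2u) t2 t2' v2 w2 a2 a2' b2 b2' d2.
  have MM0 : 0 <= M ^+ 2 by exact: sqr_ge0.
  apply: le_trans (l2norm_le Lw) _; apply: le_trans.
    apply: (@twice _ _ (EN N beta d2u Fd2u + M ^+ 2 * EN N beta u Fu)).
      exact: error_combine (ltW K0) MM0 (EN_ge0 _ _ _ _) (EN_ge0 _ _ _ _) c9 h1 n1.
    exact: error_combine (ltW K0) MM0 (EN_ge0 _ _ _ _) (EN_ge0 _ _ _ _) c9 h2 n2.
  (* The nonnegative middle term [beta * EN N beta du Fdu] is added to the right side here. *)
  rewrite -M2 ler_wpM2l ?mulr_ge0// ?(ltW K0)// lerD2r lerDl mulr_ge0 ?EN_ge0//.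
  exact: ltW.
Qed.
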